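(* Let $1<p<\infty$, $p\neq 2$, and let $\mathcal{U}$ be a selective nonprincipal ultrafilter on $\mathbb{N}$. Then there is a unique complemented closed subspace $M$ of $\widehat{L^{p}}$ with the following property: an operator $S\in B((L^{p})^{\mathcal{U}})$ belongs to the WOT closure of $\{T^{\mathcal{U}}:T\in B(L^{p})\}$ if and only if all three subspaces $L^{p}$, $\widehat{L^{p}}$ and $M$ of $(L^{p})^{\mathcal{U}}$ are invariant under $S$.
   Context: $L^{p}=L^{p}([0,1],\mu)$ with $\mu$ Lebesgue measure; scalars are real (the result also holds over $\mathbb{C}$). For a Banach space $X$ and a nonprincipal ultrafilter $\mathcal{U}$ on $\mathbb{N}$, $X^{\mathcal{U}}$ is the ultrapower: bounded sequences $(x_n)_{n\ge1}$ in $X$ modulo those with $\lim_{n,\mathcal{U}}\|x_n\|=0$, normed by $\|(x_n)_{n,\mathcal{U}}\|=\lim_{n,\mathcal{U}}\|x_n\|$; $(x_n)_{n,\mathcal{U}}$ denotes the class of $(x_n)$. For $T\in B(X)$, $T^{\mathcal{U}}\in B(X^{\mathcal{U}})$ is $(x_n)_{n,\mathcal{U}}\mapsto(Tx_n)_{n,\mathcal{U}}$. $X$ is identified with the subspace of constant classes $\{(x)_{n,\mathcal{U}}:x\in X\}$. For reflexive $X$, $\widehat{X}=\{(x_n)_{n,\mathcal{U}}: w\text{-}\lim_{n,\mathcal{U}}x_n=0\}$ (weak limit along $\mathcal{U}$), and $X^{\mathcal{U}}=X\oplus\widehat{X}$ via the projection $(x_n)_{n,\mathcal{U}}\mapsto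 w\text{-}\lim_{n,\mathcal{U}}x_n$. An ultrafilter $\mathcal{U}$ on $\mathbb{N}$ is selective if (1) for every sequence $A_1,A_2,\dots$ in $\mathcal{U}$ there is $A\in\mathcal{U}$ with $A\setminus A_k$ finite for each $k$; and (2) for every partition of $\mathbb{N}$ into finite sets $A_1,A_2,\dots$ there is $A\in\mathcal{U}$ with $A\cap A_k$ a singleton for each $k$. WOT denotes the weak operator topology. *)

(* Defs.v *)
(* Concrete model of L^p[0,1], its ultrapower,
   bounded operators, duals and the weak operator topology, with elements
   of quotient spaces represented by representatives. *)
From mathcomp Require Import all_boot all_order all_algebra.
From mathcomp Require Import all_classical all_reals all_analysis.
Set Implicit Arguments. Unset Strict Implicit. Unset Printing Implicit Defensive.
Import Order.TTheory GRing.Theory Num.Theory.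
Local Open Scope classical_set_scope.
Local Open Scope ring_scope.

Section Defs.
Variables (R : realType) (p : R).

Definition I01 : set R := `[(0:R), (1:R)].
Definition Lp (f : R -> R) : Prop :=
  measurable_fun I01 f /\
  (\int[(@lebesgue_measure R)]_(t in I01) ((`|f t| `^ p)%:E) < +oo)%E.

Definition lpn (f : R -> R) : R :=
  (fine (\int[(@lebesgue_measure R)]_(t in I01) ((`|f t| `^ p)%:E)))
    `^ p^-1.

Definition fadd (f g : R -> R) : R -> R := fun t => f t + g t.
Definition fsub (f g : R -> R) : R -> R := fun t => f t - g t.
Definition fscale (a : R) (f : R -> R) : R -> R := fun t => a * f t.

(* representatives T : (R -> R) -> (R -> R) of bounded operators on L^p *)
Definition LpOp (T : (R -> R) -> (R -> R)) : Prop :=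
  (forall f, Lp f -> Lp (T f)) /\
  (forall f g, Lp f -> Lp g -> lpn (fsub f g) = 0 -> lpn (fsub (T f) (T g)) = 0) /\
  (forall f g, Lp f -> Lp g -> lpn (fsub (T (fadd f g)) (fadd (T f) (T g))) = 0) /\
  (forall a f, Lp f -> lpn (fsub (T (fscale a f)) (fscale a (T f))) = 0) /\
  (exists C : R, forall f, Lp f -> lpn (T f) <= C * lpn f).

Definition LpDual (phi : (R -> R) -> R) : Prop :=
  (forall f g, Lp f -> Lp g -> phi (fadd f g) = phi f + phi g) /\
  (forall a f, Lp f -> phi (fscale a f) = a * phi f) /\
  (exists C : R, forall f, Lp f -> `|phi f| <= C * lpn f).

Definition ultrafilter_nat (U : set (set nat)) : Prop :=
  ~ U set0 /\ U setT /\
  (forall A B, U A -> A `<=` B -> U B) /\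
  (forall A B, U A -> U B -> U (A `&` B)) /\
  (forall A, U A \/ U (~` A)).

Definition nonprincipal (U : set (set nat)) : Prop := forall n, ~ U [set n].

Definition selective (U : set (set nat)) : Prop :=
  (forall A : nat -> set nat, (forall k, U (A k)) ->
     exists B, U B /\ forall k, finite_set (B `\` A k)) /\
  (forall A : nat -> set nat,
     (forall k, finite_set (A k)) -> (forall k, A k !=set0) ->
     (forall k l, k <> l -> A k `&` A l = set0) ->
     \bigcup_k A k = setT ->
     exists B, U B /\ forall k, exists n, B `&` A k = [set n]).

Definition ulim (U : set (set nat)) (a : nat -> R) (l : R) : Prop :=
  forall e : R, 0 < e -> U [set n | `|a n - l| < e].

Definition useq := nat -> R -> R.

Definition UP (x : useq) : Prop :=
  (forall n, Lp (x n)) /\ exists M : R, forall n, lpn (x n) <= M.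

Definition uadd (x y : useq) : useq := fun n => fadd (x n) (y n).
Definition usub (x y : useq) : useq := fun n => fsub (x n) (y n).
Definition uscale (a : R) (x : useq) : useq := fun n => fscale a (x n).
Definition uzero : useq := fun _ _ => 0.

Definition unorm (U : set (set nat)) (x : useq) (r : R) : Prop :=
  ulim U (fun n => lpn (x n)) r.

Definition ueq (U : set (set nat)) (x y : useq) : Prop := unorm U (usub x y) 0.

(* representatives S of bounded operators on (L^p)^U *)
Definition UOp (U : set (set nat)) (S : useq -> useq) : Prop :=
  (forall x, UP x -> UP (S x)) /\
  (forall x y, UP x -> UP y -> ueq U x y -> ueq U (S x) (S y)) /\
  (forall x y, UP x -> UP y -> ueq U (S (uadd x y)) (uadd (S x) (S y))) /\
  (forall a x, UP x -> ueq U (S (uscale a x)) (uscale a (S x))) /\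
  (exists C : R, forall x a b, UP x -> unorm U x a -> unorm U (S x) b -> b <= C * a).

Definition UDual (U : set (set nat)) (phi : useq -> R) : Prop :=
  (forall x y, UP x -> UP y -> ueq U x y -> phi x = phi y) /\
  (forall x y, UP x -> UP y -> phi (uadd x y) = phi x + phi y) /\
  (forall a x, UP x -> phi (uscale a x) = a * phi x) /\
  (exists C : R, forall x a, UP x -> unorm U x a -> `|phi x| <= C * a).

Definition ultraop (T : (R -> R) -> (R -> R)) : useq -> useq := fun x n => T (x n).

(* closed linear subspaces of (L^p)^U, as ueq-saturated sets of representatives *)
Definition usubspace (U : set (set nat)) (A : set useq) : Prop :=
  A `<=` UP /\
  (forall x y, A x -> UP y -> ueq U x y -> A y) /\
  A uzero /\
  (forall x y, A x -> A y -> A (uadd x y)) /\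
  (forall a x, A x -> A (uscale a x)).

Definition uclosed (U : set (set nat)) (A : set useq) : Prop :=
  forall x, UP x ->
    (forall e : R, 0 < e -> exists y r, A y /\ unorm U (usub x y) r /\ r < e) -> A x.

Definition Lconst (U : set (set nat)) : set useq :=
  [set x | UP x /\ exists f, Lp f /\ ueq U x (fun _ => f)].

Definition Lhat (U : set (set nat)) : set useq :=
  [set x | UP x /\ forall phi, LpDual phi -> ulim U (fun n => phi (x n)) 0].

Definition complemented_in (U : set (set nat)) (D M : set useq) : Prop :=
  exists P : useq -> useq,
    (forall x, D x -> M (P x)) /\
    (forall x y, D x -> D y -> ueq U x y -> ueq U (P x) (P y)) /\
    (forall x y, D x -> D y -> ueq U (P (uadd x y)) (uadd (P x) (P y))) /\
    (forall a x, D x -> ueq U (P (uscale a x)) (uscale a (P x))) /\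
    (exists C : R, forall x a b, D x -> unorm U x a -> unorm U (P x) b -> b <= C * a) /\
    (forall m, M m -> ueq U (P m) m).

Definition uinvariant (S : useq -> useq) (A : set useq) : Prop :=
  forall x, A x -> A (S x).

Definition WOT_closure_ultraops (U : set (set nat)) (S : useq -> useq) : Prop :=
  forall (k : nat) (xs : 'I_k -> useq) (phis : 'I_k -> useq -> R) (e : R),
    0 < e -> (forall i, UP (xs i)) -> (forall i, UDual U (phis i)) ->
    exists T, LpOp T /\
      forall i, `|phis i (S (xs i)) - phis i (ultraop T (xs i))| < e.

End Defs.

(* Main.v *)
(* Modulo null sequences, every bounded sequence in L^r splits into a part concentrating on
   sets of measure tending to 0 and a part with uniformly integrable r-th powers. For p > 2
   the subspace M consists of the concentrating sequences; for p < 2 it consists of the weakly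
   null sequences that annihilate the concentrating sequences of the dual L^q.

   Operators preserve M: signed sums of N almost disjoint functions have L^r norm of order
   N^(1/r), whereas well chosen signed sums of N functions bounded below in L^1 have L^2 norm
   at least of order N^(1/2); hence for r > 2 an operator on L^r maps concentrating sequences
   to concentrating sequences.

   Conversely, a functional on operators vanishing on all ultrapowers T^U must vanish on every
   operator S that preserves L^p, its complement and M. A selective ultrafilter contains a set
   along which g and psi are so sparse that their linear combinations obey upper s- and
   s'-estimates; when 1/s + 1/s' = 1, the block operator x |-> \sum_n <x, psi_n> g_n is then
   bounded and induces x |-> <x, psi> g on the weakly null sequences. Such estimates are
   available when g lies in a dense part of M, or psi in a set with annihilator M, which lets
   finite biorthogonal families strip the functional of all the terms on which S could act.

   Uniqueness: if two nonzero subspaces both describe the closure, then the operators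
   x |-> <x, psi> z with z in the first preserve the first, hence the second, which therefore
   contains z. *)

Require Import Defs.
From mathcomp Require Import all_boot all_order all_algebra.
From mathcomp Require Import all_classical all_reals all_analysis.
From mathcomp Require Import measurable_realfun ring lra.
From HB Require Import structures.
Set Implicit Arguments. Unset Strict Implicit. Unset Printing Implicit Defensive.
Import Order.TTheory GRing.Theory Num.Theory.
Import numFieldNormedType.Exports.
Local Open Scope classical_set_scope.
Local Open Scope ring_scope.

(** * Conjugate exponents and powers *)

Section powers.
Context {R : realType}.
Implicit Types (r s e a b c t u v w : R).

Definition conj_exp r s := [/\ 1 < r, 1 < s & r^-1 + s^-1 = 1].

Lemma conj_expC r s : conj_exp r s -> conj_exp s r.
Proof. by move=> [r1 s1 rs]; split=> //; rewrite addrC. Qed.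

Lemma conj_exp_gt1 r s : conj_exp r s -> 1 < r.
Proof. by case. Qed.

Lemma gt1_ge0 r : 1 < r -> 0 <= r.
Proof. by move=> r1; rewrite ltW // (lt_trans ltr01). Qed.

Lemma gt1_subr1_gt0 r : 1 < r -> 0 < r - 1.
Proof. by rewrite subr_gt0. Qed.

Lemma conj_exp_div r : 1 < r -> conj_exp r (r / (r - 1)).
Proof.
move=> r1; have r0 : r - 1 != 0 by rewrite subr_eq0 gt_eqF.
have rn : r != 0 by rewrite gt_eqF // (lt_trans _ r1).
split=> //; last by field; apply/andP.
by rewrite ltr_pdivlMr ?subr_gt0 // mul1r gtrBl.
Qed.

Lemma conj_exp2 : conj_exp 2 2.
Proof. by split; [lra|lra|field]. Qed.

Lemma conj_expM r s : conj_exp r s -> (r - 1) * s = r.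
Proof.
move=> [r1 s1 rs].
have rn : r != 0 by rewrite gt_eqF // (lt_trans _ r1).
have sn : s != 0 by rewrite gt_eqF // (lt_trans _ s1).
have : (r^-1 + s^-1) * (r * s) = r * s by rewrite rs mul1r.
have -> : (r^-1 + s^-1) * (r * s) = s + r by field; apply/andP.
by move=> h; rewrite mulrBl mul1r -h; ring.
Qed.

Lemma conj_expV r s : conj_exp r s -> r * s^-1 = r - 1.
Proof.
by move=> rs; rewrite -{1}(conj_expM rs) mulfK //; case: rs => _ s1 _; rewrite gt_eqF //; lra.
Qed.

Lemma conj_exp_gt2 r s : conj_exp r s -> r < 2 -> 2 < s.
Proof. by move=> c r2; have := conj_expM c; case: c => r1 s1 _ h; nra. Qed.

Lemma conj_exp_lt2 r s : conj_exp r s -> 2 < r -> s < 2.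
Proof. by move=> c r2; have := conj_expM c; case: c => r1 s1 _ h; nra. Qed.

Lemma ler_powR2r r u v : 0 <= r -> 0 <= u -> u <= v -> u `^ r <= v `^ r.
Proof. by move=> r0 u0 uv; apply: ge0_ler_powR; rewrite ?nnegrE // (le_trans u0). Qed.

Lemma ler_pPowR2r r : 0 < r -> {in Num.nneg &, {mono @powR R ^~ r : u v / u <= v}}.
Proof. by move=> r0; apply: le_mono_in; exact: gt0_ltr_powR. Qed.

Lemma powRVK r u : 0 < r -> 0 <= u -> (u `^ r^-1) `^ r = u.
Proof. by move=> r0 u0; rewrite -powRrM mulVf ?gt_eqF // powRr1. Qed.

Lemma powRKV r u : 0 < r -> 0 <= u -> (u `^ r) `^ r^-1 = u.
Proof. by move=> r0 u0; rewrite -powRrM mulfV ?gt_eqF // powRr1. Qed.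

Lemma powRV r u : 0 <= u -> u^-1 `^ r = (u `^ r)^-1.
Proof. by move=> u0; rewrite -powR_inv1 // -powRrM mulN1r powRN. Qed.

Lemma powR_conj_exp r s u : conj_exp r s -> 0 <= u -> u `^ r^-1 * u `^ s^-1 = u.
Proof.
move=> [r1 s1 rs] u0; rewrite -powRD; first by rewrite rs powRr1.
by rewrite rs oner_eq0.
Qed.

Lemma powR_mulB1 r u : 0 <= u -> 1 < r -> u `^ (r - 1) * u = u `^ r.
Proof. by move=> u0 r1; rewrite mulrC mulr_powRB1 // (lt_trans _ r1). Qed.

Lemma powR_interpolation r u K : 2 <= r -> 0 <= u -> 0 < K ->
  u `^ (r - 1) <= K `^ (r - 2) * u + K^-1 * u `^ r.
Proof.
move=> r2 u0 K0; have uB : u `^ (r - 1) = u `^ (r - 2) * u.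
  rewrite -(@mulr_powRB1 _ u (r - 1)) //; last lra.
  by rewrite mulrC (_ : r - 1 - 1 = r - 2) //; lra.
have [uK|Ku] := leP u K.
  rewrite ler_wpDr //; first by rewrite mulr_ge0 ?invr_ge0 ?powR_ge0 ?ltW.
  by rewrite uB ler_wpM2r // ler_powR2r // subr_ge0.
rewrite ler_wpDl //; first by rewrite mulr_ge0 ?powR_ge0.
rewrite -(@powR_mulB1 r) //; last lra.
by rewrite mulrC -mulrA ler_peMr ?powR_ge0 // ler_pdivlMr // mul1r ltW.
Qed.

Lemma young r s a b : conj_exp r s -> `|a * b| <= `|a| `^ r / r + `|b| `^ s / s.
Proof. by move=> [r1 s1 rs]; rewrite normrM; apply: conjugate_powR; rewrite ?normr_ge0 //; lra. Qed.

Lemma normrM_le_powR r s a b : conj_exp r s -> `|a * b| <= `|a| `^ r + `|b| `^ s.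
Proof.
move=> c; apply: (le_trans (young _ _ c)); case: c => r1 s1 _.
by apply: lerD; rewrite ler_pdivrMr; [|lra| |lra]; rewrite ler_peMr ?powR_ge0 // ltW.
Qed.

Lemma powR_tangent r u v : 1 < r -> 0 <= u -> 0 <= v ->
  u `^ r + r * u `^ (r - 1) * (v - u) <= v `^ r.
Proof.
move=> r1 u0 v0; have r0 : 0 < r by lra.
have cs := conj_exp_div r1; set s := r / (r - 1) in cs.
have := young (u `^ (r - 1)) v (conj_expC cs).
rewrite normrM !ger0_norm ?powR_ge0 // -powRrM (conj_expM cs).
have -> : s^-1 = 1 - r^-1 by case: cs => _ _ <-; rewrite addrC addKr.
rewrite -(ler_pM2l r0) -(powR_mulB1 u0 r1) -(powR_mulB1 v0 r1).
have -> : r * (u `^ (r - 1) * u * (1 - r^-1) + v `^ (r - 1) * v / r) =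
    r * (u `^ (r - 1) * u) - u `^ (r - 1) * u + v `^ (r - 1) * v.
  by field; rewrite gt_eqF.
lra.
Qed.

Lemma powR_subadd e u v : 0 < e -> e <= 1 -> 0 <= u -> 0 <= v ->
  (u + v) `^ e <= u `^ e + v `^ e.
Proof.
move=> e0 e1 u0 v0; have [->|uv0] := eqVneq (u + v) 0.
  by rewrite powR0 ?gt_eqF // addr_ge0 ?powR_ge0.
have uv_gt0 : 0 < u + v by rewrite lt_neqAle eq_sym uv0 addr_ge0.
have proportion w : 0 <= w -> w <= u + v -> (u + v) `^ e * (w / (u + v)) <= w `^ e.
  rewrite le_eqVlt => /predU1P[<- _|w0 wuv]; first by rewrite mul0r mulr0 powR_ge0.
  have -> : w `^ e = (u + v) `^ e * (w / (u + v)) `^ e.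
    by rewrite -powRM ?divr_ge0 // ?ltW // mulrC mulfVK.
  rewrite ler_wpM2l ?powR_ge0 // ger1_powR // divr_gt0 //=.
  by rewrite ler_pdivrMr // mul1r.
have := lerD (proportion u u0 _) (proportion v v0 _).
by rewrite -mulrDr -mulrDl divff // mulr1; apply; lra.
Qed.

Lemma normr_powR_add_le r a b : 0 <= r -> `|a + b| `^ r <= 2 `^ r * (`|a| `^ r + `|b| `^ r).
Proof.
move=> r0; wlog ab : a b / `|a| <= `|b| => [H|].
  by case: (leP `|a| `|b|) => [/H //|/ltW/H]; rewrite addrC [X in _ * X]addrC.
have := ler_normD a b => h.
apply: (@le_trans _ _ ((2 * `|b|) `^ r)); first by apply: ler_powR2r; rewrite ?normr_ge0 //; lra.
by rewrite powRM // ler_wpM2l ?powR_ge0 // lerDr powR_ge0.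
Qed.

Definition spowR e t := Num.sg t * `|t| `^ e.

Lemma spowR0 e : spowR e 0 = 0. Proof. by rewrite /spowR sgr0 mul0r. Qed.

Lemma spowRN e t : spowR e (- t) = - spowR e t.
Proof. by rewrite /spowR sgrN normrN mulNr. Qed.

Lemma normr_spowR e t : 0 < e -> `|spowR e t| = `|t| `^ e.
Proof.
move=> e0; rewrite /spowR normrM normr_sg.
case: eqVneq => [->|_]; last by rewrite mul1r ger0_norm ?powR_ge0.
by rewrite mul0r normr0 powR0 // gt_eqF.
Qed.

Lemma ge0_spowR e t : 0 < e -> 0 <= t -> spowR e t = t `^ e.
Proof.
move=> e0; rewrite le_eqVlt => /predU1P[<-|t0]; first by rewrite spowR0 powR0 // gt_eqF.
by rewrite /spowR gtr0_sg // mul1r gtr0_norm.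
Qed.

Lemma spowR_mul r t : 1 < r -> spowR (r - 1) t * t = `|t| `^ r.
Proof. by move=> r1; rewrite /spowR mulrAC -normrEsg mulrC powR_mulB1. Qed.

Lemma spowR_conj r s t : conj_exp r s -> `|spowR (r - 1) t| `^ s = `|t| `^ r.
Proof. by move=> c; have [r1 _ _] := c; rewrite normr_spowR ?subr_gt0 // -powRrM conj_expM. Qed.

Lemma normr_powR_tangent r a b : 1 < r ->
  `|a + b| `^ r <= `|a| `^ r + r * (spowR (r - 1) (a + b) * b).
Proof.
move=> r1; have := @powR_tangent r `|a + b| `|a| r1 (normr_ge0 _) (normr_ge0 _).
suff : `|a + b| `^ (r - 1) * `|a + b| - `|a + b| `^ (r - 1) * `|a|
    <= spowR (r - 1) (a + b) * b by nra.
rewrite powR_mulB1 // -spowR_mul // [X in X - _]mulrDr.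
have : spowR (r - 1) (a + b) * a <= `|a + b| `^ (r - 1) * `|a|.
  by rewrite -normr_spowR ?subr_gt0 // -normrM ler_norm.
lra.
Qed.

Lemma normr_powR_add_cross r a b : 1 < r ->
  `|a + b| `^ r <=
    `|a| `^ r + r * 2 `^ r * (`|a| `^ (r - 1) * `|b|) + r * 2 `^ r * `|b| `^ r.
Proof.
move=> r1; have r10 : 0 < r - 1 by lra.
apply: le_trans (normr_powR_tangent _ _ r1) _.
have split_power : spowR (r - 1) (a + b) * b <= 2 `^ r * (`|a| `^ (r - 1) * `|b| + `|b| `^ r).
  apply: (@le_trans _ _ (2 `^ (r - 1) * (`|a| `^ (r - 1) + `|b| `^ (r - 1)) * `|b|)).
    apply: (le_trans (ler_norm _)); rewrite normrM ler_wpM2r // normr_spowR //.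
    by apply: normr_powR_add_le; exact: ltW.
  rewrite -mulrA [(_ + _) * `|b|]mulrDl powR_mulB1 //.
  by rewrite ler_wpM2r ?addr_ge0 ?mulr_ge0 ?powR_ge0 //; apply: ler_powR; lra.
rewrite -addrA lerD2l -mulrDr -mulrA ler_pM2l //; lra.
Qed.

Lemma sign_wlog (P : R -> R -> Prop) :
  (forall a b, P a b -> P b a) -> (forall a b, P a b -> P (- a) (- b)) ->
  (forall a b, 0 <= a -> a <= b -> P a b) -> (forall a b, a <= 0 -> 0 <= b -> P a b) ->
  forall a b, P a b.
Proof.
move=> Psym Popp Psame Popposite a b; wlog ab : a b / a <= b => [H|].
  by have [/H//|/ltW/H/Psym] := leP a b.
have [a0|/ltW a0] := leP 0 a; first exact: Psame.
have [b0|/ltW b0] := leP 0 b; first exact: Popposite.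
rewrite -[a]opprK -[b]opprK; apply: Popp; apply: Psym; apply: Psame; lra.
Qed.

Lemma spowR_hoelder e a b : 0 < e -> e <= 1 -> `|spowR e a - spowR e b| <= 2 * `|a - b| `^ e.
Proof.
move=> e0 e1; move: a b; apply: sign_wlog => [a b|a b|a b a0 ab|a b a0 b0].
- by rewrite distrC [`|a - b|]distrC.
- by rewrite !spowRN -!opprD !normrN.
- have b0 := le_trans a0 ab; rewrite !ge0_spowR // distrC ger0_norm; last first.
    by rewrite subr_ge0 ler_powR2r // ltW.
  apply: (@le_trans _ _ (`|a - b| `^ e)); last by rewrite ler_peMl ?powR_ge0 //; lra.
  rewrite lerBlDl distrC ger0_norm ?subr_ge0 //.
  by rewrite -{1}[b](subrK a) [_ + a]addrC powR_subadd // subr_ge0.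
- apply: le_trans (ler_normB _ _) _; rewrite !normr_spowR // mulr2n mulrDl mul1r.
  rewrite (ler0_norm a0) (ger0_norm b0) distrC ger0_norm ?subr_ge0 ?(le_trans a0) //.
  by apply: lerD; apply: ler_powR2r; lra.
Qed.

Lemma spowR_lipschitz e a b u : 1 <= e -> `|a| <= u -> `|b| <= u ->
  `|spowR e a - spowR e b| <= e * u `^ (e - 1) * `|a - b|.
Proof.
move=> e1; have e0 : 0 < e by lra.
move: a b; apply: sign_wlog => [a b h bu au|a b h|a b a0 ab _ bu|a b a0 b0 au bu].
- by rewrite distrC [`|b - a|]distrC h.
- by rewrite !spowRN -!opprD !normrN.
- have b0 := le_trans a0 ab; rewrite !ge0_spowR // distrC ger0_norm; last first.
    by rewrite subr_ge0 ler_powR2r // ltW.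
  rewrite distrC ger0_norm ?subr_ge0 //; rewrite ger0_norm // in bu.
  move: e1; rewrite le_eqVlt => /predU1P[<-|e1].
    by rewrite !powRr1 // subrr powRr0 mulr1 mul1r.
  have slope : e * b `^ (e - 1) * (b - a) <= e * u `^ (e - 1) * (b - a).
    by rewrite ler_wpM2r ?subr_ge0 // ler_pM2l // ler_powR2r //; lra.
  by have := powR_tangent e1 b0 a0; lra.
- have linear w : `|w| <= u -> `|w| `^ e <= e * u `^ (e - 1) * `|w|.
    move=> wu; have [->|w0] := eqVneq w 0; first by rewrite normr0 powR0 ?mulr0 // gt_eqF.
    rewrite -[e in `|w| `^ e](subrK 1) [`|w| `^ _]powRD; last by rewrite normr_eq0 w0 implybT.
    rewrite powRr1 // ler_wpM2r // -[leLHS]mul1r ler_pM ?powR_ge0 //.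
    by rewrite ler_powR2r //; lra.
  apply: le_trans (ler_normB _ _) _; rewrite !normr_spowR //.
  apply: (le_trans (lerD (linear _ au) (linear _ bu))).
  rewrite -mulrDr (ler0_norm a0) (ger0_norm b0) distrC ger0_norm ?subr_ge0 ?(le_trans a0) //.
  by rewrite [- a + b]addrC.
Qed.

Lemma spowR_increment r : 1 < r -> exists2 C : R, 0 <= C & forall a b c, `|c| <= 1 ->
  `|spowR (r - 1) (a + c * b) - spowR (r - 1) a| * `|c * b|
    <= C * `|c| `^ Num.min r 2 * (`|a| `^ r + `|b| `^ r).
Proof.
move=> r1; have [r2|r2] := leP r 2.
  exists 2 => // a b c c1.
  apply: (@le_trans _ _ (2 * `|c * b| `^ (r - 1) * `|c * b|)).
    rewrite ler_wpM2r //; apply: le_trans (spowR_hoelder _ _ _ _) _; [lra|lra|].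
    by rewrite addrC addKr.
  rewrite -mulrA powR_mulB1 // normrM powRM // mulrA ler_wpM2l ?mulr_ge0 ?powR_ge0 //.
  by rewrite lerDr powR_ge0.
exists ((r - 1) * 2 `^ (r - 2)) => [|a b c c1].
  by rewrite mulr_ge0 ?powR_ge0 // subr_ge0 ltW.
pose m : R := Num.max `|a| `|b|.
have am : `|a| <= m by rewrite le_max lexx.
have bm : `|b| <= m by rewrite le_max lexx orbT.
have m0 : 0 <= m by rewrite (le_trans _ am).
have cb : `|c * b| <= `|b| by rewrite normrM ler_piMl.
have square t : `|t| `^ 2 = `|t| * `|t| by rewrite (powR_mulrn 2) // expr2.
apply: (@le_trans _ _ ((r - 1) * (2 * m) `^ (r - 2) * `|c * b| * `|c * b|)).
  rewrite ler_wpM2r //; have := @spowR_lipschitz (r - 1) (a + c * b) a (2 * m).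
  rewrite [a + _]addrC addrK (_ : r - 1 - 1 = r - 2); last by ring.
  by apply; [lra|have := ler_normD (c * b) a; lra|lra].
rewrite powRM // normrM square.
have -> : (r - 1) * (2 `^ (r - 2) * m `^ (r - 2)) * (`|c| * `|b|) * (`|c| * `|b|) =
  (r - 1) * 2 `^ (r - 2) * (`|c| * `|c|) * (m `^ (r - 2) * (`|b| * `|b|)) by ring.
rewrite ler_wpM2l ?mulr_ge0 ?powR_ge0 ?subr_ge0 ?(ltW r1) //.
apply: (@le_trans _ _ (m `^ r)).
  have [m00|mn] := eqVneq m 0.
    by rewrite m00 powR0 ?mul0r ?powR_ge0 // subr_eq0 gt_eqF.
  rewrite -[r in leRHS](subrK 2) [leRHS]powRD ?mn ?implybT //.
  by rewrite ler_wpM2l ?powR_ge0 // -square; apply: ler_powR2r.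
by rewrite /m; case: (leP `|a| `|b|) => _; rewrite ?lerDl ?lerDr powR_ge0.
Qed.

Lemma normr_powR_expand r : 1 < r -> exists2 C : R, 0 <= C & forall a b c, `|c| <= 1 ->
  `|a + c * b| `^ r <= `|a| `^ r + r * (c * (spowR (r - 1) a * b))
     + C * `|c| `^ Num.min r 2 * (`|a| `^ r + `|b| `^ r).
Proof.
move=> r1; have r0 : 0 < r by lra.
have [C C0 incr] := spowR_increment r1; exists (r * C) => [|a b c c1].
  by rewrite mulr_ge0 // ltW.
apply: le_trans (normr_powR_tangent _ _ r1) _.
have := incr a b c c1; rewrite -normrM => /(le_trans (ler_norm _)).
rewrite -(ler_pM2l r0); lra.
Qed.

End powers.

Ltac exponent_bound r implied :=
  match goal with
  | r1 : is_true (1 < r) |- _ => exact: (implied r1)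
  | rs : conj_exp r _ |- _ => exact: (implied (conj_exp_gt1 rs))
  | rs : conj_exp _ r |- _ => exact: (implied (conj_exp_gt1 (conj_expC rs)))
  end.

#[global] Hint Extern 0 (is_true (1 < ?r)) => exponent_bound r (@id (1 < r)) : core.
#[global] Hint Extern 0 (is_true (1 <= ?r)) => exponent_bound r (@ltW _ _ 1 r) : core.
#[global] Hint Extern 0 (is_true (0 < ?r)) => exponent_bound r (@lt_trans _ _ 1 0 r ltr01) : core.
#[global] Hint Extern 0 (is_true (0 <= ?r)) => exponent_bound r (@gt1_ge0 _ r) : core.
#[global] Hint Extern 0 (is_true (0 < ?r - 1)) => exponent_bound r (@gt1_subr1_gt0 _ r) : core.

(** * Subspaces and linear functionals *)

Section subspaces.
Context {K : nzRingType} {V : lmodType K}.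
Implicit Types (W : set V) (u v : V) (a : K) (phi : V -> K).

Definition subspace W := W 0 /\ forall a u v, W u -> W v -> W (a *: u + v).

Definition linear_on W phi :=
  forall a u v, W u -> W v -> phi (a *: u + v) = a * phi u + phi v.

Lemma subspaceD W u v : subspace W -> W u -> W v -> W (u + v).
Proof. by move=> [_ WP] Wu Wv; rewrite -[u]scale1r; exact: WP. Qed.

Lemma subspaceZ W a u : subspace W -> W u -> W (a *: u).
Proof. by move=> [W0 WP] Wu; rewrite -[_ *: _]addr0; exact: WP. Qed.

Lemma subspaceB W u v : subspace W -> W u -> W v -> W (u - v).
Proof. by move=> [_ WP] Wu Wv; rewrite addrC -scaleN1r; exact: WP. Qed.

Lemma subspace_sum W (I : Type) (s : seq I) (F : I -> V) :
  subspace W -> (forall i, W (F i)) -> W (\sum_(i <- s) F i).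
Proof.
by move=> sW WF; elim/big_ind: _ => // [|u v]; [case: sW|exact: subspaceD].
Qed.

Lemma subspaceI W W' : subspace W -> subspace W' -> subspace (W `&` W').
Proof.
move=> [W0 WP] [W'0 W'P]; split=> // a u v [Wu W'u] [Wv W'v].
by split; [exact: WP|exact: W'P].
Qed.

Section linear_on.
Variables (W : set V) (phi : V -> K).
Hypotheses (subW : subspace W) (lin : linear_on W phi).

Lemma linear_on0 : phi 0 = 0.
Proof.
have W0 := subW.1; have := lin 1 W0 W0; rewrite scaler0 addr0 mul1r => /eqP.
by rewrite -subr_eq subrr eq_sym => /eqP.
Qed.

Lemma linear_onD u v : W u -> W v -> phi (u + v) = phi u + phi v.
Proof. by move=> Wu Wv; rewrite -[u]scale1r lin // scale1r mul1r. Qed.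

Lemma linear_onZ a u : W u -> phi (a *: u) = a * phi u.
Proof. by move=> Wu; rewrite -[_ *: _]addr0 lin ?linear_on0 ?addr0 //; case: subW. Qed.

Lemma linear_onB u v : W u -> W v -> phi (u - v) = phi u - phi v.
Proof. by move=> Wu Wv; rewrite addrC -scaleN1r lin // mulN1r addrC. Qed.

Lemma linear_on_sum (I : Type) (s : seq I) (c : I -> K) (F : I -> V) :
  (forall i, W (F i)) -> phi (\sum_(i <- s) c i *: F i) = \sum_(i <- s) c i * phi (F i).
Proof.
move=> WF; elim: s => [|i s IH]; first by rewrite !big_nil linear_on0.
rewrite !big_cons linear_onD ?IH ?linear_onZ //; first exact: subspaceZ.
by apply: subspace_sum => // j; exact: subspaceZ.
Qed.

End linear_on.

End subspaces.

Section pointwise_operations.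
Context {R : realType}.
Implicit Types (f g : R -> R) (x y : useq R) (a : R).

Lemma faddE f g : fadd f g = f + g. Proof. by []. Qed.
Lemma fscaleE a f : fscale a f = a *: f. Proof. by []. Qed.
Lemma uaddE x y : uadd x y = x + y. Proof. by []. Qed.
Lemma usubE x y : usub x y = x - y. Proof. by []. Qed.
Lemma uscaleE a x : uscale a x = a *: x. Proof. by []. Qed.

End pointwise_operations.

(** * Integration over the unit interval *)

Local Notation mu := (@lebesgue_measure _).
Local Notation measurable01 f := (measurable_fun (@I01 _) f).

(* Sealed: unfolding integrals during unification is never useful and always expensive. *)
HB.lock Definition int01 {R : realType} (f : R -> R) : R := \int[mu]_(t in @I01 R) f t.

HB.lock Definition inLp {R : realType} (r : R) (f : R -> R) : Prop := Lp r f.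

HB.lock Definition normLp {R : realType} (r : R) (f : R -> R) : R := lpn r f.

Definition pairing {R : realType} (f g : R -> R) : R := int01 (fun t => f t * g t).

Definition trunc {R : realType} (K : R) (f : R -> R) : R -> R :=
  fun t => if `|f t| <= K then f t else 0.

Definition duality_map {R : realType} (r : R) (f : R -> R) : R -> R :=
  fun t => spowR (r - 1) (f t).

Section integration.
Context {R : realType}.
Implicit Types (f g h : R -> R) (r s a c K : R).

Lemma measurable_I01 : measurable (@I01 R).
Proof. exact: measurable_itv. Qed.
Hint Extern 0 (measurable (@I01 _)) => exact: measurable_I01 : core.

Lemma lebesgue_measure_I01 : mu (@I01 R) = 1%E.
Proof. by rewrite /I01 lebesgue_measure_itv /= lte_fin ltr01 oppr0 adde0. Qed.

Lemma measurable01_normr f : measurable01 f -> measurable01 (fun t => `|f t|).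
Proof. by move=> mf; apply: (measurableT_comp (@normr_measurable R setT) mf). Qed.

Lemma measurable01_powR_normr r f : measurable01 f -> measurable01 (fun t => `|f t| `^ r).
Proof. by move=> mf; apply: (measurableT_comp (measurable_powR r)); exact: measurable01_normr. Qed.

Lemma measurable01_sg f : measurable01 f -> measurable01 (fun t => Num.sg (f t)).
Proof.
move=> mf; rewrite (_ : (fun t => _) = (fun t => f t * `|f t| `^ (-1))).
  by apply: measurable_funM => //; exact: measurable01_powR_normr.
apply/funext => t; rewrite powR_inv1 //.
have [->|ft] := eqVneq (f t) 0; first by rewrite sgr0 mul0r.
by rewrite {2}(numEsg (f t)) mulfK // normr_eq0.
Qed.

Lemma measurable01_duality_map r f : measurable01 f -> measurable01 (duality_map r f).
Proof.
by move=> mf; apply: measurable_funM; [exact: measurable01_sg|exact: measurable01_powR_normr].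
Qed.

Lemma measurable01_trunc K f : measurable01 f -> measurable01 (trunc K f).
Proof.
move=> mf; apply: measurable_fun_if => //.
- by apply: measurable_fun_ler => //; exact: measurable01_normr.
- by apply: measurable_funS mf => //; exact: subIsetl.
Qed.

Lemma Lp_inLp r : @Lp R r = inLp r.
Proof. by rewrite inLp.unlock. Qed.

Lemma lpn_normLp r : @lpn R r = normLp r.
Proof. by rewrite normLp.unlock. Qed.

Lemma Lp1P f : inLp 1 f <-> mu.-integrable (@I01 R) (EFin \o f).
Proof.
have E : (\int[mu]_(t in @I01 R) (`|f t| `^ 1)%:E = \int[mu]_(t in @I01 R) `|(EFin \o f) t|)%E.
  by apply: eq_integral => t _ /=; rewrite powRr1.
rewrite inLp.unlock /Lp E; split=> [[mf h]|/integrableP[/measurable_EFinP mf h]]; last by [].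
by apply/integrableP; split=> //; exact/measurable_EFinP.
Qed.

Lemma LpP r f : inLp r f <-> measurable01 f /\ inLp 1 (fun t => `|f t| `^ r).
Proof.
have E : (\int[mu]_(t in @I01 R) (`|f t| `^ r)%:E =
    \int[mu]_(t in @I01 R) (`| `|f t| `^ r | `^ 1)%:E)%E.
  by apply: eq_integral => t _; rewrite (ger0_norm (powR_ge0 _ _)) powRr1 ?powR_ge0.
rewrite inLp.unlock; split=> [[mf h]|[mf [_ h]]]; last by split; [exact: mf|rewrite E].
by split; [exact: mf|split; [exact: (measurable01_powR_normr _ mf)|rewrite -E]].
Qed.

Lemma Lp_measurable r f : inLp r f -> measurable01 f.
Proof. by case/LpP. Qed.

Lemma eq_int01 f g : (forall t, I01 t -> f t = g t) -> int01 f = int01 g.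
Proof. by rewrite int01.unlock => fg; apply: eq_Rintegral => t /set_mem; exact: fg. Qed.

Lemma int01_linear : linear_on (@inLp R 1) int01.
Proof.
move=> a f g /Lp1P If /Lp1P Ig; rewrite int01.unlock.
rewrite RintegralD //; last exact: (integrableZl _ a If).
by rewrite RintegralZl.
Qed.

Lemma int01_cst c : int01 (fun=> c) = c.
Proof. by rewrite int01.unlock Rintegral_cst //= lebesgue_measure_I01 mulr1. Qed.

Lemma le_int01 f g : inLp 1 f -> inLp 1 g -> (forall t, f t <= g t) -> int01 f <= int01 g.
Proof. by move=> /Lp1P If /Lp1P Ig fg; rewrite int01.unlock; exact: le_Rintegral. Qed.

Lemma int01_ge0 f : (forall t, 0 <= f t) -> 0 <= int01 f.
Proof. by move=> f0; rewrite int01.unlock; exact: Rintegral_ge0. Qed.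

Lemma normLp1E f : normLp 1 f = int01 (fun t => `|f t|).
Proof.
rewrite normLp.unlock int01.unlock /lpn invr1 powRr1; last first.
  by apply: fine_ge0; apply: integral_ge0 => t _; exact: powR_ge0.
by congr fine; apply: eq_integral => t _; rewrite powRr1.
Qed.

Lemma le_normr_int01 f : inLp 1 f -> `|int01 f| <= normLp 1 f.
Proof. by rewrite normLp1E int01.unlock => /Lp1P If; exact: le_normr_Rintegral. Qed.

Lemma Lp1_le f g : measurable01 f -> (forall t, `|f t| <= g t) -> inLp 1 g -> inLp 1 f.
Proof.
move=> mf fg /Lp1P Ig; apply/Lp1P; apply: le_integrable Ig; first exact: measurable_I01.
  exact/measurable_EFinP.
by move=> t _; rewrite lee_fin (le_trans (fg t)) // ler_norm.
Qed.

Lemma dominated_cvg_int01 (F : nat -> R -> R) f g : (forall n, measurable01 (F n)) -> inLp 1 g ->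
  (forall n t, `|F n t| <= g t) -> (forall t, F ^~ t @ \oo --> f t) ->
  int01 (F n) @[n --> \oo] --> int01 f.
Proof.
move=> mF /Lp1P Ig Fg Ff.
have FfE t : I01 t -> (F n t)%:E @[n --> \oo] --> (f t)%:E.
  by move=> _; apply: cvg_EFin; [exact: nearW|exact: Ff].
have mFE n : measurable_fun (@I01 R) (EFin \o F n) by exact/measurable_EFinP.
have mf : measurable_fun (@I01 R) (EFin \o f) by exact: emeasurable_fun_cvg FfE.
have [//|//||||If _ cv] := @dominated_convergence _ _ R mu (@I01 R) measurable_I01
  (fun n => EFin \o F n) (EFin \o f) (EFin \o g).
- exact: aeW.
- by [].
- by apply: aeW => t n _; rewrite lee_fin; exact: Fg.
by rewrite int01.unlock /Rintegral; apply: fine_cvg; rewrite fineK //; exact: integrable_fin_num.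
Qed.

Lemma normLpE r f : normLp r f = int01 (fun t => `|f t| `^ r) `^ r^-1.
Proof. by rewrite normLp.unlock int01.unlock. Qed.

Lemma normLp_ge0 r f : 0 <= normLp r f.
Proof. by rewrite normLpE powR_ge0. Qed.

End integration.

#[global] Hint Extern 0 (measurable (@I01 _)) => exact: measurable_I01 : core.
#[global] Hint Extern 0 (is_true (0 <= normLp _ _)) => exact: normLp_ge0 : core.

(** * The spaces L^r *)

Section Lp_spaces.
Context {R : realType}.
Implicit Types (f g h : R -> R) (r s a c K : R).

Lemma normLp_powR r f : 0 < r -> normLp r f `^ r = int01 (fun t => `|f t| `^ r).
Proof. by move=> r0; rewrite normLpE powRVK // int01_ge0 // => t; exact: powR_ge0. Qed.

Lemma normLp_le_powR r f a : 0 < r -> 0 <= a ->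
  (normLp r f <= a) = (int01 (fun t => `|f t| `^ r) <= a `^ r).
Proof. by move=> r0 a0; rewrite -normLp_powR // ler_pPowR2r ?nnegrE. Qed.

Lemma Lp_powR r f : inLp r f -> inLp 1 (fun t => `|f t| `^ r).
Proof. by case/LpP. Qed.

Lemma Lp_le r f g : 0 <= r -> measurable01 f -> (forall t, `|f t| <= `|g t|) -> inLp r g ->
  inLp r f.
Proof.
move=> r0 mf fg Lg; apply/LpP; split=> //.
apply: Lp1_le (Lp_powR Lg); first exact: (measurable01_powR_normr _ mf).
by move=> t; rewrite (ger0_norm (powR_ge0 _ _)) ler_powR2r.
Qed.

Lemma Lp_cst r c : inLp r (fun=> c).
Proof.
apply/LpP; split=> //; apply/Lp1P/integrableP; split; first exact/measurable_EFinP.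
by rewrite /= (@integral_cst _ _ _ mu _ measurable_I01) /= lebesgue_measure_I01 mule1 ltry.
Qed.

Lemma Lp_bounded r f K : 0 <= r -> measurable01 f -> (forall t, `|f t| <= K) -> inLp r f.
Proof.
move=> r0 mf fK; apply: (Lp_le r0 mf _ (Lp_cst r K)) => t.
by rewrite (le_trans (fK t)) // ler_norm.
Qed.

Lemma Lp1_subspace : subspace (@inLp R 1).
Proof.
split=> [|a f g /Lp1P If /Lp1P Ig]; first exact: Lp_cst.
have Iaf : mu.-integrable (@I01 R) (EFin \o (a *: f)) by have := integrableZl _ a If; exact.
by apply/Lp1P; exact: (integrableD _ Iaf Ig).
Qed.

Lemma Lp_subspace r : 0 <= r -> subspace (@inLp R r).
Proof.
move=> r0; split=> [|a f g Lf Lg]; first exact: Lp_cst.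
have maf : measurable01 (a *: f) by apply: measurable_funM => //; exact: Lp_measurable Lf.
have mag : measurable01 (a *: f + g) := measurable_funD maf (Lp_measurable Lg).
pose bound : R -> R := 2 `^ r *: (`|a| `^ r *: (fun t => `|f t| `^ r) + (fun t => `|g t| `^ r)).
apply/LpP; split=> //; apply: (@Lp1_le _ _ bound); first exact: measurable01_powR_normr.
  move=> t; rewrite ger0_norm ?powR_ge0 // (le_trans (normr_powR_add_le _ _ r0)) //.
  by rewrite normrM powRM.
by apply: subspaceZ Lp1_subspace _; apply: Lp1_subspace.2; exact: Lp_powR.
Qed.

Lemma LpD r f g : 0 <= r -> inLp r f -> inLp r g -> inLp r (f + g).
Proof. by move=> r0; apply: subspaceD; exact: Lp_subspace. Qed.

Lemma LpB r f g : 0 <= r -> inLp r f -> inLp r g -> inLp r (f - g).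
Proof. by move=> r0; apply: subspaceB; exact: Lp_subspace. Qed.

Lemma LpZ r a f : 0 <= r -> inLp r f -> inLp r (a *: f).
Proof. by move=> r0; apply: subspaceZ; exact: Lp_subspace. Qed.

Lemma Lp_trunc r K f : 0 <= r -> inLp r f -> inLp r (trunc K f).
Proof.
move=> r0 Lf; apply: (Lp_le r0 _ _ Lf); first exact: (measurable01_trunc _ (Lp_measurable Lf)).
by move=> t; rewrite /trunc; case: ifP => // _; rewrite normr0.
Qed.

Lemma Lp_exp_le r s f : 0 <= r -> r <= s -> inLp s f -> inLp r f.
Proof.
move=> r0 rs Lf; apply/LpP; split; first exact: Lp_measurable Lf.
apply: (@Lp1_le _ _ ((fun=> 1) + (fun t => `|f t| `^ s))).
- exact: (measurable01_powR_normr _ (Lp_measurable Lf)).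
- move=> t; rewrite ger0_norm ?powR_ge0 //; have [ft1|/ltW ft1] := leP `|f t| 1.
    by rewrite ler_wpDr ?powR_ge0 // (_ : 1 = 1 `^ r) ?ler_powR2r // powR1.
  by rewrite ler_wpDl // ler_powR.
- by apply: LpD => //; [exact: Lp_cst|exact: Lp_powR].
Qed.

Lemma Lp_Lp1 r f : 1 <= r -> inLp r f -> inLp 1 f.
Proof. exact: Lp_exp_le. Qed.

Lemma Lp1_normr f : inLp 1 f -> inLp 1 (fun t => `|f t|).
Proof.
move=> Lf; apply: (Lp_le ler01 _ _ Lf); first exact: measurable01_normr (Lp_measurable Lf).
by move=> t; rewrite normr_id.
Qed.

Lemma Lp_duality_map r s f : conj_exp r s -> inLp r f -> inLp s (duality_map r f).
Proof.
move=> rs /LpP[mf Lf]; apply/LpP; split; first exact: measurable01_duality_map.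
by under eq_fun do rewrite (spowR_conj _ rs).
Qed.

Lemma normLp_duality_map r s f : conj_exp r s -> normLp s (duality_map r f) = normLp r f `^ (r - 1).
Proof.
move=> rs; rewrite normLpE; under eq_fun do rewrite (spowR_conj _ rs).
by rewrite -normLp_powR // -powRrM (conj_expV rs).
Qed.

Lemma normLp_cst r c : 0 < r -> normLp r (fun=> c) = `|c|.
Proof. by move=> r0; rewrite normLpE int01_cst powRKV. Qed.

Lemma normLp0 r : 0 < r -> normLp r (0 : R -> R) = 0.
Proof. by move=> r0; rewrite normLp_cst // normr0. Qed.

Lemma normLpZ r a f : 0 < r -> inLp r f -> normLp r (a *: f) = `|a| * normLp r f.
Proof.
move=> r0 Lf; rewrite !normLpE -[X in X * _](powRKV r0) // -powRM ?powR_ge0 //; last first.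
  by apply: int01_ge0 => t; exact: powR_ge0.
rewrite -(linear_onZ Lp1_subspace int01_linear _ (Lp_powR Lf)); congr (int01 _ `^ _).
by apply/funext => t; rewrite normrM powRM.
Qed.

Lemma normLpN r f : normLp r (- f) = normLp r f.
Proof. by rewrite !normLpE; congr (int01 _ `^ _); apply/funext => t; rewrite normrN. Qed.

Lemma normLp_distC r f g : normLp r (f - g) = normLp r (g - f).
Proof. by rewrite -opprB normLpN. Qed.

Lemma normLp_mono r f g : 0 < r -> inLp r f -> inLp r g -> (forall t, `|f t| <= `|g t|) ->
  normLp r f <= normLp r g.
Proof.
move=> r0 Lf Lg fg; rewrite normLp_le_powR // normLp_powR //.
apply: le_int01; [exact: Lp_powR..|move=> t].
by apply: ler_powR2r; rewrite // ltW.
Qed.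

Lemma normLp_bounded_le r f K : 0 < r -> measurable01 f -> (forall t, `|f t| <= K) ->
  normLp r f <= K.
Proof.
move=> r0 mf fK; have K0 : 0 <= K by apply: le_trans (fK 0).
rewrite -(ger0_norm K0) -(normLp_cst K r0); apply: normLp_mono => //.
- exact: (Lp_bounded (ltW r0) mf fK).
- exact: Lp_cst.
- by move=> t; rewrite (ger0_norm K0).
Qed.

End Lp_spaces.

Section hoelder.
Context {R : realType}.
Implicit Types (f g h : R -> R) (r s a c K : R).

Lemma measurable_restrict_Lp r f : inLp r f -> measurable_fun setT (f \_ (@I01 R)).
Proof. by move=> /Lp_measurable mf; apply/(measurable_restrictT _ measurable_I01). Qed.

Lemma Lnorm_restrict r f : 0 < r -> inLp r f ->
  'N[mu]_r%:E[EFin \o (f \_ (@I01 R))]%E = (normLp r f)%:E.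
Proof.
move=> r0 Lf; rewrite unlock /=.
have -> : (\int[mu]_x (`|((f \_ (@I01 R)) x)%:E| `^ r) = \int[mu]_(t in @I01 R) (`|f t| `^ r)%:E)%E.
  rewrite [RHS]integral_mkcond; apply: eq_integral => t _; rewrite !patchE.
  by case: ifP => _ //=; rewrite normr0 powR0 // gt_eqF.
have fin : (\int[mu]_(t in @I01 R) (`|f t| `^ r)%:E)%E \is a fin_num.
  by move/Lp_powR/Lp1P : Lf; exact: integrable_fin_num.
by rewrite -(fineK fin) poweR_EFin normLpE int01.unlock.
Qed.

Lemma Lp1_pair r s f g : conj_exp r s -> inLp r f -> inLp s g -> inLp 1 (fun t => f t * g t).
Proof.
move=> rs Lf Lg; apply: Lp1_le (LpD ler01 (Lp_powR Lf) (Lp_powR Lg)).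
  exact: measurable_funM (Lp_measurable Lf) (Lp_measurable Lg).
by move=> t; exact: normrM_le_powR.
Qed.

Lemma normr_pairing_le r s f g : conj_exp r s -> inLp r f -> inLp s g ->
  `|pairing f g| <= normLp r f * normLp s g.
Proof.
move=> rs Lf Lg; have Lfg := Lp1_pair rs Lf Lg; have [_ _ rsV] := rs.
apply: (le_trans (le_normr_int01 Lfg)); rewrite -lee_fin EFinM -!Lnorm_restrict //.
have -> : (fun t => f t * g t) \_ (@I01 R) = (f \_ (@I01 R)) \* (g \_ (@I01 R)).
  by apply/funext => t; rewrite /= !patchE; case: ifP => // _; rewrite mul0r.
by apply: hoelder => //; [exact: measurable_restrict_Lp Lf|exact: measurable_restrict_Lp Lg].
Qed.

Lemma normLp_triangle r f g : 1 <= r -> inLp r f -> inLp r g ->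
  normLp r (f + g) <= normLp r f + normLp r g.
Proof.
move=> r1 Lf Lg; have r0 : 0 < r by exact: lt_le_trans r1.
have Lfg := LpD (ltW r0) Lf Lg.
rewrite -lee_fin EFinD -!Lnorm_restrict //.
have -> : (f + g) \_ (@I01 R) = (f \_ (@I01 R)) \+ (g \_ (@I01 R)).
  by apply/funext => t; rewrite /= !patchE; case: ifP => // _; rewrite addr0.
by apply: minkowski_EFin => //; [exact: measurable_restrict_Lp Lf|exact: measurable_restrict_Lp Lg].
Qed.

Lemma normLp_exp_le r s f : 0 < r -> r <= s -> inLp s f -> normLp r f <= normLp s f.
Proof.
move=> r0 rs Lf; have s0 : 0 < s by exact: lt_le_trans rs.
have [<-//|rneqs] := eqVneq r s.
have sr : 1 < s / r by rewrite ltr_pdivlMr // mul1r lt_neqAle rneqs.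
have Lfr : inLp (s / r) (fun t => `|f t| `^ r).
  apply/LpP; split; first exact: (measurable01_powR_normr _ (Lp_measurable Lf)).
  under eq_fun do rewrite ger0_norm ?powR_ge0 // -powRrM mulrCA mulfV ?gt_eqF // mulr1.
  exact: Lp_powR.
rewrite normLp_le_powR //.
have := normr_pairing_le (conj_exp_div sr) Lfr (Lp_cst _ 1).
rewrite normLp_cst ?normr1 ?mulr1 //; last first.
  by rewrite divr_gt0 ?subr_gt0 // (lt_trans _ sr).
move=> /(le_trans (ler_norm _)); rewrite /pairing; under eq_fun do rewrite mulr1.
move=> /le_trans; apply; rewrite normLpE.
under eq_fun do rewrite ger0_norm ?powR_ge0 // -powRrM mulrCA mulfV ?gt_eqF // mulr1.
by rewrite -normLp_powR // -powRrM invf_div mulrCA mulfV ?gt_eqF // mulr1.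
Qed.

End hoelder.

Section pairing.
Context {R : realType}.
Implicit Types (f g h : R -> R) (r s a c K : R).

Lemma pairingC f g : pairing f g = pairing g f.
Proof. by rewrite /pairing; under eq_fun do rewrite mulrC. Qed.

Lemma pairing_linear_l r s g : conj_exp r s -> inLp s g -> linear_on (inLp r) (pairing^~ g).
Proof.
move=> rs Lg a f h Lf Lh; rewrite /pairing.
have -> : (fun t => (a *: f + h) t * g t) = a *: (fun t => f t * g t) + (fun t => h t * g t).
  by apply/funext => t; rewrite mulrDl -mulrA.
by apply: int01_linear; exact: Lp1_pair rs _ Lg.
Qed.

Lemma pairing_linear_r r s f : conj_exp r s -> inLp r f -> linear_on (inLp s) (pairing f).
Proof.
move=> rs Lf a g h Lg Lh; rewrite pairingC (pairing_linear_l (conj_expC rs) Lf) //.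
by rewrite pairingC [in X in _ + X]pairingC.
Qed.

Lemma pairing_duality_map r f : 1 < r -> pairing f (duality_map r f) = normLp r f `^ r.
Proof.
move=> r1; rewrite normLp_powR // /pairing; congr int01; apply/funext => t.
by rewrite mulrC spowR_mul.
Qed.

Lemma pairing_eq0 r s f g : conj_exp r s -> inLp r f -> inLp s g -> normLp r f = 0 ->
  pairing f g = 0.
Proof.
move=> rs Lf Lg f0; apply/eqP; rewrite -normr_le0 (le_trans (normr_pairing_le rs Lf Lg)) //.
by rewrite f0 mul0r.
Qed.

Lemma normLp_le_dual r s f a : conj_exp r s -> inLp r f -> 0 <= a ->
  (forall g, inLp s g -> pairing f g <= a * normLp s g) -> normLp r f <= a.
Proof.
move=> rs Lf a0 f_le; have := f_le _ (Lp_duality_map rs Lf).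
rewrite pairing_duality_map // (normLp_duality_map _ rs) -powR_mulB1 // mulrC.
have [->//|f0] := eqVneq (normLp r f) 0.
by rewrite ler_pM2r // powR_gt0 // lt_neqAle eq_sym f0 /=.
Qed.

Lemma pairing_separates r s f : conj_exp r s -> inLp r f ->
  (forall g, inLp s g -> pairing f g = 0) -> normLp r f = 0.
Proof.
move=> rs Lf f0; apply/le_anti; rewrite normLp_ge0 andbT.
by apply: (normLp_le_dual rs Lf) => // g /f0 ->; rewrite mul0r.
Qed.

Lemma normr_int01_mul_bounded f g K : inLp 1 f -> measurable01 g -> (forall t, `|g t| <= K) ->
  inLp 1 (fun t => f t * g t) /\ `|int01 (fun t => f t * g t)| <= K * normLp 1 f.
Proof.
move=> Lf mg gK; have fg_le t : `|f t * g t| <= K * `|f t|.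
  by rewrite normrM mulrC ler_wpM2r.
have LKf : inLp 1 (K *: (fun t => `|f t|)) by apply: LpZ => //; exact: Lp1_normr.
have Lfg : inLp 1 (fun t => f t * g t).
  by apply: Lp1_le fg_le LKf; exact: measurable_funM (Lp_measurable Lf) mg.
split=> //; apply: (le_trans (le_normr_int01 Lfg)); rewrite !normLp1E.
rewrite -(linear_onZ Lp1_subspace int01_linear _ (Lp1_normr Lf)).
by apply: le_int01 => //; exact: Lp1_normr.
Qed.

Lemma normr_trunc_le_self K f t : `|trunc K f t| <= `|f t|.
Proof. by rewrite /trunc; case: ifP => // _; rewrite normr0. Qed.

Lemma normLp_trunc_le r K f : 0 < r -> inLp r f -> normLp r (trunc K f) <= normLp r f.
Proof.
move=> r0 Lf; apply: normLp_mono => //; first by apply: Lp_trunc => //; exact: ltW.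
by move=> t; exact: normr_trunc_le_self.
Qed.

Lemma normr_sub_trunc_le K f t : `|(f - trunc K f) t| <= `|f t|.
Proof. by rewrite !fctE /trunc; case: ifP => _; rewrite ?subrr ?subr0 ?normr0. Qed.

Lemma normLp_sub_trunc_le r K f : 0 < r -> inLp r f -> normLp r (f - trunc K f) <= normLp r f.
Proof.
move=> r0 Lf; apply: normLp_mono => // [|t]; last exact: normr_sub_trunc_le.
by apply: LpB => //; [exact: ltW|apply: Lp_trunc => //; exact: ltW].
Qed.

Lemma normr_trunc_le K f t : 0 <= K -> `|trunc K f t| <= K.
Proof. by rewrite /trunc; case: ifP => // _; rewrite normr0. Qed.

Lemma cvg0_powR (T : Type) (F : set_system T) {FF : Filter F} r (a : T -> R) : 0 < r ->
  (forall x, 0 <= a x) -> a x @[x --> F] --> 0 -> a x `^ r @[x --> F] --> 0.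
Proof.
move=> r0 a0 /cvgr0Pnorm_le a_cvg; apply/cvgr0Pnorm_le => e e0.
apply: filterS (a_cvg (e `^ r^-1) (powR_gt0 _ e0)) => x.
rewrite !ger0_norm ?powR_ge0 // => /(ler_powR2r (ltW r0) (a0 x)).
by rewrite powRVK // ltW.
Qed.

Lemma dominated_cvg_normLp r (F : nat -> R -> R) g : 0 < r -> (forall n, measurable01 (F n)) ->
  inLp r g -> (forall n t, `|F n t| <= `|g t|) -> (forall t, F n t @[n --> \oo] --> 0) ->
  normLp r (F n) @[n --> \oo] --> 0.
Proof.
move=> r0 mF Lg Fg F0; under eq_fun do rewrite normLpE.
have rV0 : 0 < r^-1 by rewrite invr_gt0.
apply: cvg0_powR => //; first by move=> n; apply: int01_ge0 => t; exact: powR_ge0.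
rewrite -[0](int01_cst (0 : R)); apply: dominated_cvg_int01 (Lp_powR Lg) _ _.
- by move=> n; exact: measurable01_powR_normr.
- by move=> n t; rewrite (ger0_norm (powR_ge0 _ _)) ler_powR2r // ltW.
- by move=> t; apply: cvg0_powR => //; exact/norm_cvg0P.
Qed.

Lemma cvg_normLp_sub_trunc r f : 0 < r -> inLp r f ->
  normLp r (f - trunc n%:R f) @[n --> \oo] --> 0.
Proof.
move=> r0 Lf; apply: (@dominated_cvg_normLp _ (fun n => f - trunc n%:R f) f) => //.
- move=> n; apply: measurable_funB; first exact: Lp_measurable Lf.
  exact: (measurable01_trunc _ (Lp_measurable Lf)).
- by move=> n t; exact: normr_sub_trunc_le.
- move=> t; apply: cvg_near_cst; near=> n.
  by rewrite !fctE /trunc ifT ?subrr //; near: n; exact: nbhs_infty_ger.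
Unshelve. all: by end_near. Qed.

End pairing.

(** * Riesz representation *)

Section bounded_functionals.
Context d (T : measurableType d) (R : realType).
Implicit Types (f : T -> R).

Definition bounded_mfun : set (T -> R) :=
  [set f : T -> R | measurable_fun setT f /\ exists K : R, forall t, `|f t| <= K].

Lemma bounded_mfun_subspace : subspace bounded_mfun.
Proof.
split=> [|a f g [mf [K fK]] [mg [M gM]]].
  by split; [exact: measurable_cst|exists 0 => t; rewrite normr0].
split; first by apply: measurable_funD => //; exact: measurable_funM.
exists (`|a| * K + M) => t; rewrite (le_trans (ler_normD _ _)) // lerD //.
by rewrite normrM ler_wpM2l.
Qed.

Lemma bounded_mfun_indic (A : set T) : measurable A -> bounded_mfun \1_A.
Proof.
move=> mA; split; first exact: measurable_indic.
by exists 1 => t; rewrite indicE; case: (_ \in _); rewrite ?normr0 ?normr1.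
Qed.

Lemma bounded_mfun01 f : measurable_fun setT f -> (forall t, 0 <= f t <= 1) -> bounded_mfun f.
Proof.
by move=> mf f01; split=> //; exists 1 => t; have /andP[? ?] := f01 t; rewrite ger0_norm.
Qed.

Section vanishing_on_indicators.
Variables (D : (T -> R) -> R) (B : R).
Hypothesis linD : linear_on bounded_mfun D.
Hypothesis D_indic : forall A, measurable A -> D \1_A = 0.
Hypothesis D_le : forall f, measurable_fun setT f -> (forall t, 0 <= f t <= 1) -> `|D f| <= B.

(* Writing [f = (f1 + 1_A) / 2] with [A = {f >= 1/2}] halves the bound on [D]
   while [f1] still takes its values in [0, 1]. *)
Lemma functional_le_halving n f : measurable_fun setT f -> (forall t, 0 <= f t <= 1) ->
  `|D f| <= B / 2 ^+ n.
Proof.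
elim: n f => [|n IH] f mf f01; first by rewrite expr0 divr1; exact: D_le.
pose A := f @^-1` `[2^-1, +oo[.
have mA : measurable A by rewrite -[A]setTI; apply: mf => //; exact: measurable_itv.
pose f1 := 2 *: f - \1_A.
have mf1 : measurable_fun setT f1.
  by apply: measurable_funB; [exact: measurable_funM|exact: measurable_indic].
have f1_01 t : 0 <= f1 t <= 1.
  rewrite /f1 !fctE indicE; have /andP[f0 f1'] := f01 t; rewrite -[_ *: _]/(_ * _).
  case: (boolP (t \in A)) => [|/negP]; rewrite inE /A /= in_itv /= andbT => tA.
    by apply/andP; split; lra.
  by move/negP: tA; rewrite -ltNge => tA; apply/andP; split; lra.
have -> : f = 2^-1 *: f1 + 2^-1 *: \1_A.
  by rewrite -scalerDr subrK scalerA mulVf ?scale1r.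
have bf1 := bounded_mfun01 mf1 f1_01; have bA := bounded_mfun_indic mA.
rewrite linD //; last exact: (subspaceZ _ bounded_mfun_subspace).
rewrite (linear_onZ bounded_mfun_subspace linD) // D_indic // mulr0 addr0.
rewrite normrM ger0_norm ?invr_ge0 // exprS invfM mulrCA ler_pM2l ?invr_gt0 //.
exact: IH.
Qed.

Lemma functional_eq0_on_unit_valued f : measurable_fun setT f -> (forall t, 0 <= f t <= 1) ->
  D f = 0.
Proof.
move=> mf f01; apply/eqP; rewrite -normr_le0.
have half0 : B / 2 ^+ n @[n --> \oo] --> 0.
  rewrite -(mulr0 B); apply: cvgMl_tmp; under eq_fun do rewrite -exprVn.
  by apply: cvg_expr; rewrite ger0_norm //; lra.
by apply: (cvgr_to_ge half0); apply: nearW => n; exact: functional_le_halving.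
Qed.

Lemma functional_eq0_on_indic f : bounded_mfun f -> D f = 0.
Proof.
move=> [mf [K fK]]; have K1 : 0 < `|K| + 1 by rewrite ltr_wpDl.
have fK1 t : `|f t / (`|K| + 1)| <= 1.
  rewrite normrM normfV (gtr0_norm K1) ler_pdivrMr // mul1r.
  by rewrite (le_trans (fK t)) // (le_trans (ler_norm K)) // lerDl.
pose f1 := 2^-1 *: ((`|K| + 1)^-1 *: f + cst 1).
have mf1 : measurable_fun setT f1.
  by apply: measurable_funM => //; apply: measurable_funD => //; exact: measurable_funM.
have f1_01 t : 0 <= f1 t <= 1.
  have := fK1 t; rewrite ler_norml /f1 !fctE -![_ *: _]/(_ * _) [_^-1 * _]mulrC.
  by move=> /andP[? ?]; apply/andP; split; lra.
have -> : f = (2 * (`|K| + 1)) *: f1 + (- (`|K| + 1)) *: cst 1.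
  apply/funext => t; rewrite /f1 !fctE -![_ *: _]/(_ * _); field; exact: lt0r_neq0.
have b1 : bounded_mfun (cst 1) by split=> //; exists 1 => t; rewrite normr1.
rewrite linD; [|exact: bounded_mfun01|exact: (subspaceZ _ bounded_mfun_subspace)].
have cst01 (t : T) : 0 <= cst (1 : R) t <= 1 by rewrite ler01 lexx.
rewrite functional_eq0_on_unit_valued // (linear_onZ bounded_mfun_subspace linD) //.
by rewrite functional_eq0_on_unit_valued // !mulr0 addr0.
Qed.

End vanishing_on_indicators.

End bounded_functionals.

Definition dual_functional {R : realType} (r : R) (phi : (R -> R) -> R) : Prop :=
  linear_on (inLp r) phi /\ exists C, forall f, inLp r f -> `|phi f| <= C * normLp r f.

Lemma LpDualP {R : realType} (r : R) phi : 0 <= r -> LpDual r phi <-> dual_functional r phi.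
Proof.
move=> r0; rewrite /dual_functional inLp.unlock normLp.unlock.
have subL : subspace (@Lp R r) by have := @Lp_subspace R r r0; rewrite inLp.unlock.
split=> [[phiD [phiZ phi_le]]|[lin phi_le]].
  split=> // a f g Lf Lg; have Laf : Lp r (a *: f) by exact: subspaceZ.
  by rewrite -faddE phiD // -fscaleE phiZ.
split=> [f g Lf Lg|]; first by rewrite faddE (linear_onD lin).
by split=> // a f Lf; rewrite fscaleE (linear_onZ subL lin).
Qed.

Lemma Lp_of_trunc {R : realType} (s B : R) (g : R -> R) : measurable01 g -> 0 <= B -> 0 < s ->
  (forall n, normLp s (trunc n%:R g) <= B) -> inLp s g.
Proof.
move=> mg B0 s0 trunc_le; rewrite inLp.unlock; split => //.
have : (\int[mu]_(t in @I01 R) (`|trunc n%:R g t| `^ s)%:E)%E @[n --> \oo] -->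
    (\int[mu]_(t in @I01 R) (`|g t| `^ s)%:E)%E.
  have := @cvg_monotone_convergence _ _ _ mu _ (@measurable_I01 R)
     (fun n t => (`|trunc n%:R g t| `^ s)%:E).
  rewrite (_ : (fun t => limn _) = (fun t => (`|g t| `^ s)%:E)); last first.
    apply/funext => t; apply/cvg_lim => //; apply: cvg_near_cst.
    by near=> n; rewrite /trunc ifT //; near: n; exact: nbhs_infty_ger.
  apply.
  - move=> n; apply/measurable_EFinP.
    exact: (measurable01_powR_normr _ (measurable01_trunc _ mg)).
  - by move=> n t _; rewrite lee_fin powR_ge0.
  - move=> t _ m n mn; rewrite lee_fin ler_powR2r ?(ltW s0) // /trunc.
    case: ifP => [gm|_]; last by rewrite normr0.
    by rewrite ifT // (le_trans gm) // ler_nat.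
move=> int_cvg; apply: (@le_lt_trans _ _ (B `^ s)%:E); last exact: ltry.
apply: (cvge_le _ int_cvg); apply: nearW => n; have := trunc_le n.
rewrite normLp_le_powR // -lee_fin int01.unlock /Rintegral fineK //.
have Ltrunc : inLp s (trunc n%:R g).
  by apply: (Lp_bounded (ltW s0) (measurable01_trunc _ mg)) => t; exact: normr_trunc_le.
by move/Lp_powR/Lp1P : Ltrunc; exact: integrable_fin_num.
Unshelve. all: by end_near. Qed.

Section riesz.
Context {R : realType}.
Variables (r s : R) (phi : (R -> R) -> R) (C : R).
Hypotheses (rs : conj_exp r s) (lin : linear_on (inLp r) phi).
Hypothesis phi_le : forall f, inLp r f -> `|phi f| <= C * normLp r f.
Implicit Types (f g : R -> R) (A : set R).

Let subL : subspace (@inLp R r).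
Proof. by apply: Lp_subspace. Qed.

Lemma functional_bound_ge0 : 0 <= C.
Proof. by have := phi_le (Lp_cst r 1); rewrite normLp_cst // normr1 mulr1; exact: le_trans. Qed.

Lemma functional_congr f g : inLp r f -> inLp r g -> (forall t, I01 t -> f t = g t) ->
  phi f = phi g.
Proof.
move=> Lf Lg fg; apply/eqP; rewrite -subr_eq0 -(linear_onB lin) // -normr_le0.
rewrite (le_trans (phi_le (subspaceB subL Lf Lg))) // normLpE (@eq_int01 _ _ (fun=> 0)).
  by rewrite int01_cst powR0 ?mulr0 // invr_eq0 gt_eqF.
by move=> t /fg; rewrite !fctE => ->; rewrite subrr normr0 powR0 // gt_eqF.
Qed.

Lemma functional_cvg (F : nat -> R -> R) f : inLp r f -> (forall n, inLp r (F n)) ->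
  normLp r (f - F n) @[n --> \oo] --> 0 -> phi (F n) @[n --> \oo] --> phi f.
Proof.
move=> Lf LF F_cvg; apply/subr_cvg0; apply/norm_cvg0P.
have CF0 : C * normLp r (f - F n) @[n --> \oo] --> 0 by rewrite -(mulr0 C); exact: cvgMl_tmp.
apply: squeeze_cvgr CF0; last exact: cvg_cst; apply: nearW => n.
by rewrite normr_ge0 -(linear_onB lin) // normLp_distC phi_le //; exact: subspaceB.
Qed.

Lemma measurable_indic01 A : measurable A -> measurable01 (\1_A : R -> R).
Proof. exact: measurable_indic. Qed.

Lemma Lp_indic A : measurable A -> inLp r (\1_A : R -> R).
Proof.
move=> mA; have := @Lp_bounded R r \1_A 1; apply; [by []|exact: measurable_indic01|].
by move=> t; rewrite indicE; case: (_ \in _); rewrite ?normr0 ?normr1.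
Qed.

Definition functional_charge (A : set (measurableTypeR R)) : \bar R := (phi (\1_A))%:E.

Let functional_charge0 : functional_charge set0 = 0%E.
Proof. by rewrite /functional_charge indic0 (linear_on0 subL lin). Qed.

Let functional_charge_fin A : measurable A -> functional_charge A \is a fin_num.
Proof. by []. Qed.

Let functional_charge_sigma_additive : semi_sigma_additive functional_charge.
Proof.
move=> F mF tF mUF; pose S n : R -> R := \sum_(0 <= i < n) \1_(F i).
have LS n : inLp r (S n) by apply: subspace_sum => // i; exact: Lp_indic (mF i).
have LU : inLp r (\1_(\bigcup_n F n) : R -> R) := Lp_indic mUF.
have -> : (fun n => \sum_(0 <= i < n) functional_charge (F i))%E = EFin \o (fun n => phi (S n)).
  apply/funext => n /=; rewrite sumEFin /S; congr EFin.
  have := linear_on_sum subL lin (index_iota 0 n) (fun=> 1) (fun i => Lp_indic (mF i)).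
  by under eq_bigr do rewrite scale1r; under [RHS]eq_bigr do rewrite mul1r.
have SE t n : (S n t)%:E = (\sum_(0 <= i < n) (\1_(F i) t)%:E)%E by rewrite /S fct_sumE sumEFin.
have indic_ge0 i t : (0 <= (\1_(F i) t)%:E :> \bar R)%E by rewrite lee_fin indicE.
have S_cvg t : S n t @[n --> \oo] --> (\1_(\bigcup_n F n) t : R).
  apply: (@fine_cvg _ _ _ _ (fun n => (S n t)%:E)); rewrite (funext (SE t)) indic_bigcup //.
  by apply: is_cvg_nneseries => i _ _.
have S_le t n : 0 <= S n t <= \1_(\bigcup_n F n) t.
  rewrite -!lee_fin SE indic_bigcup // sume_ge0 //=.
  exact: nneseries_lim_ge.
apply: cvg_EFin; first exact: nearW.
apply: functional_cvg => //; apply: (@dominated_cvg_normLp _ _ _ (fun=> 1)) => //.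
- by move=> n; apply: measurable_funB; [exact: measurable_indic01|exact: Lp_measurable (LS n)].
- exact: Lp_cst.
- move=> n t; have := S_le t n; rewrite !fctE normr1 indicE => /andP[S0 S1].
  rewrite ger0_norm ?subr_ge0 // lerBlDr (le_trans _ (ler_wpDr S0 (lexx 1))) //.
  by rewrite (ler_nat R _ 1) leq_b1.
- by move=> t; rewrite -(subrr (\1_(\bigcup_n F n) t)); apply: cvgB => //; exact: cvg_cst.
Qed.

HB.instance Definition _ := isCharge.Build _ _ _ functional_charge
  functional_charge0 functional_charge_fin functional_charge_sigma_additive.

Let functional_charge_dominated : functional_charge `<< mu.
Proof.
apply/null_content_dominatesP => A mA A0; rewrite /functional_charge; congr EFin.
have A0' : normLp r (\1_A : R -> R) = 0.
  rewrite normLpE (_ : (fun t => _) = \1_A); last first.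
    apply/funext => t; rewrite indicE; case: (_ \in _); rewrite ?normr0 ?normr1 ?powR1 //.
    by rewrite powR0 // gt_eqF.
  rewrite int01.unlock /Rintegral integral_indic // [X in fine X](_ : _ = 0%E) /=.
    by rewrite powR0 // invr_eq0 gt_eqF.
  by apply: (subset_measure0 _ _ _ A0) => //; exact: measurableI.
by apply/eqP; rewrite -normr_le0 (le_trans (phi_le (Lp_indic mA))) // A0' mulr0.
Qed.

Lemma functional_density : exists2 g : R -> R, inLp 1 g &
  forall A, measurable A -> phi (\1_A) = int01 (fun t => \1_A t * g t).
Proof.
pose nu : {charge set (measurableTypeR R) -> \bar R} := functional_charge.
have numu : nu `<< mu := functional_charge_dominated.
have int_density := Radon_Nikodym_integrable numu.
have fin_density t := Radon_Nikodym_fin_num t numu.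
set h := Radon_Nikodym _ _ in int_density fin_density; pose g t := fine (h t).
have gh : EFin \o g = h by apply/funext => t; rewrite /g /= fineK.
exists g => [|A mA]; first by apply/Lp1P; rewrite gh; exact: integrableS int_density.
have mA01 : measurable (A `&` @I01 R) by exact: measurableI.
rewrite (@functional_congr _ (\1_(A `&` @I01 R))); [|exact: Lp_indic|exact: Lp_indic|]; last first.
  by move=> t It; rewrite !indicE in_setI (mem_set It) andbT.
have := Radon_Nikodym_integral numu mA01; rewrite -/h => /(congr1 fine) /= ->.
rewrite int01.unlock /Rintegral setIC integral_mkcondr; congr fine.
apply: eq_integral => t _; rewrite patchE indicE -gh /=.
by case: (t \in A); rewrite ?mul1r ?mul0r.
Qed.

Section density.
Variable g : R -> R.
Hypothesis L1g : inLp 1 g.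
Hypothesis phi_indic : forall A, measurable A -> phi (\1_A) = int01 (fun t => \1_A t * g t).

Let mg : measurable01 g := Lp_measurable L1g.

Lemma functional_bounded_mfun f : bounded_mfun f -> phi f = int01 (fun t => f t * g t).
Proof.
have Lfg h : bounded_mfun h -> inLp r h /\ inLp 1 (fun t => h t * g t).
  move=> [mh [K hK]]; have mh01 : measurable01 h by exact: measurable_funS mh.
  split; first exact: Lp_bounded hK.
  have [+ _] := normr_int01_mul_bounded L1g mh01 hK.
  by congr (inLp 1 _); apply/funext => t; rewrite mulrC.
pose D h := phi h - int01 (fun t => h t * g t).
move=> bf; apply/eqP; rewrite -subr_eq0; apply/eqP.
apply: (@functional_eq0_on_indic _ _ _ D (C + normLp 1 g)) => //.
- move=> a h k /Lfg[Lh Lhg] /Lfg[Lk Lkg]; rewrite /D lin //.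
  have -> : (fun t => (a *: h + k) t * g t) = a *: (fun t => h t * g t) + (fun t => k t * g t).
    by apply/funext => t; rewrite mulrDl -mulrA.
  by rewrite int01_linear //; ring.
- by move=> A mA; rewrite /D phi_indic // subrr.
move=> h mh h01; have h1 t : `|h t| <= 1 by have /andP[? ?] := h01 t; rewrite ger0_norm.
have mh01 : measurable01 h by exact: measurable_funS mh.
have [Lh _] := Lfg _ (bounded_mfun01 mh h01).
apply: (le_trans (ler_normB _ _)); apply: lerD.
  rewrite (le_trans (phi_le Lh)) // ler_piMr ?functional_bound_ge0 //.
  exact: normLp_bounded_le.
have [_] := normr_int01_mul_bounded L1g mh01 h1; rewrite mul1r.
by under eq_fun do rewrite mulrC.
Qed.

Lemma functional_bounded f K : measurable01 f -> (forall t, `|f t| <= K) ->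
  phi f = int01 (fun t => f t * g t).
Proof.
move=> mf fK; pose f1 := f \_ (@I01 R).
have f1K t : `|f1 t| <= K.
  by rewrite /f1 patchE; case: ifP => // _; rewrite normr0 (le_trans _ (fK t)).
have mf1 : measurable_fun setT f1 by apply/(measurable_restrictT _ measurable_I01).
have ff1 t : I01 t -> f t = f1 t by move=> It; rewrite /f1 patchE mem_set.
rewrite (functional_congr _ _ ff1); [|exact: Lp_bounded fK|].
  rewrite functional_bounded_mfun; last by split=> //; exists K.
  by apply: eq_int01 => t /ff1 ->.
by apply: (Lp_bounded _ _ f1K) => //; exact: measurable_funS mf1.
Qed.

Lemma Lp_of_density : inLp s g.
Proof.
apply: (Lp_of_trunc mg functional_bound_ge0) => // n.
set h := trunc n%:R g; set f := duality_map s h; set N := normLp s h.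
have h_le t : `|h t| <= n%:R by exact: normr_trunc_le.
have mh : measurable01 h := measurable01_trunc _ mg.
have Lh : inLp s h by exact: Lp_bounded h_le.
have Lf : inLp r f := Lp_duality_map (conj_expC rs) Lh.
have phif : phi f = N `^ s.
  rewrite (@functional_bounded _ (n%:R `^ (s - 1))).
  - rewrite /N -pairing_duality_map // pairingC; congr int01; apply/funext => t.
    rewrite /f /duality_map /h /trunc; case: ifP => // _.
    by rewrite spowR0 !mul0r.
  - exact: measurable01_duality_map.
  - by move=> t; rewrite normr_spowR // ler_powR2r // subr_ge0.
have := phi_le Lf; rewrite phif (normLp_duality_map _ (conj_expC rs)) ger0_norm ?powR_ge0 //.
have [->//|N0] := eqVneq N 0; first by rewrite functional_bound_ge0.
rewrite -/N -(@powR_mulB1 _ s N) ?normLp_ge0 // [_ * N]mulrC.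
by rewrite ler_pM2r // powR_gt0 // lt_neqAle eq_sym N0 normLp_ge0.
Qed.

Lemma functional_pairing f : inLp r f -> phi f = pairing f g.
Proof.
move=> Lf; have Lt n : inLp r (trunc n%:R f) by exact: Lp_trunc.
have trunc_cvg := cvg_normLp_sub_trunc (lt_trans ltr01 (conj_exp_gt1 rs)) Lf.
have phi_cvg := functional_cvg Lf Lt trunc_cvg.
have pair_cvg : pairing (trunc n%:R f) g @[n --> \oo] --> pairing f g.
  apply/subr_cvg0/norm_cvg0P.
  have g0 : normLp r (f - trunc n%:R f) * normLp s g @[n --> \oo] --> 0.
    by rewrite -(mul0r (normLp s g)); exact: cvgMr_tmp.
  apply: squeeze_cvgr g0; last exact: cvg_cst; apply: nearW => n.
  have lin_pair := pairing_linear_l rs Lp_of_density.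
  rewrite normr_ge0 -(linear_onB lin_pair) // normLp_distC.
  by apply: normr_pairing_le Lp_of_density => //; exact: subspaceB.
have phi_trunc n : phi (trunc n%:R f) = pairing (trunc n%:R f) g.
  by apply: (functional_bounded (Lp_measurable (Lt n))) => t; exact: normr_trunc_le.
by rewrite (funext phi_trunc) in phi_cvg; exact: (cvg_unique _ phi_cvg pair_cvg).
Qed.

End density.
End riesz.

Theorem riesz_representation {R : realType} (r s : R) phi : conj_exp r s ->
  dual_functional r phi -> exists2 g, inLp s g & forall f, inLp r f -> phi f = pairing f g.
Proof.
move=> rs [lin [C phi_le]]; have [g L1g phi_indic] := functional_density rs lin phi_le.
exists g; first exact: (Lp_of_density rs lin phi_le L1g phi_indic).
by move=> f; exact: (functional_pairing rs lin phi_le L1g phi_indic).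
Qed.

(** * Limits along an ultrafilter *)

Existing Class ultrafilter_nat.

Lemma UltraFilter_of_setVsetC (T : Type) (F : set_system T) :
  ProperFilter F -> (forall A, F A \/ F (~` A)) -> UltraFilter F.
Proof.
move=> FF FC; split=> // G GF FG; apply/seteqP; split=> // A GA.
have [//|/FG GCA] := FC A.
by case: (filter_not_empty G); rewrite -(setICr A); exact: filterI.
Qed.

#[global] Instance UltraFilter_image (T T' : Type) (f : T -> T') (F : set_system T) :
  UltraFilter F -> UltraFilter (f @ F).
Proof.
by move=> FU; apply: UltraFilter_of_setVsetC => A; exact: in_ultra_setVsetC (f @^-1` A) FU.
Qed.

#[global] Instance ultrafilter_nat_UltraFilter (U : set_system nat) :
  ultrafilter_nat U -> UltraFilter U.
Proof.
move=> [U0 [UT [US [UI UC]]]]; apply: UltraFilter_of_setVsetC UC.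
by split=> //; split=> // P Q PQ UP; exact: US UP PQ.
Qed.

Lemma nonprincipal_near_ge (U : set_system nat) {UF : UltraFilter U} :
  nonprincipal U -> forall N, \forall n \near U, (N <= n)%N.
Proof.
move=> Unp; elim=> [|N IH]; first exact: nearW.
have [//|UN] := in_ultra_setVsetC [set N] UF; first by have := Unp N.
by apply: filterS2 IH UN => n Nn /= /eqP nN; rewrite ltn_neqAle eq_sym nN.
Qed.

Lemma cvg0_le {R : realType} (T : Type) (F : set_system T) {FF : Filter F} (a b : T -> R) :
  (\forall x \near F, `|a x| <= b x) -> b x @[x --> F] --> 0 -> a x @[x --> F] --> 0.
Proof.
move=> ab b0; apply/norm_cvg0P; apply: squeeze_cvgr b0; last exact: cvg_cst.
by apply: filterS ab => x ->; rewrite normr_ge0.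
Qed.

Lemma bounded_ultra_cvg {R : realType} (T : Type) (F : set_system T) {UF : UltraFilter F}
  (a : T -> R) (M : R) : (forall x, `|a x| <= M) -> cvg (a x @[x --> F]).
Proof.
move=> aM; have := @segment_compact R (- M) M; rewrite compact_ultra.
have aF : (a @ F) `[- M, M]%classic by apply: (@filterE _ F) => x; rewrite /= in_itv /= -ler_norml.
by move=> /(_ (a @ F) _ aF)[l [_ al]]; apply/cvg_ex; exists l.
Qed.

(** * Bounded sequences modulo null sequences *)

Definition bounded_seq {R : realType} (r : R) : set (useq R) :=
  [set x | (forall n, inLp r (x n)) /\ exists M : R, forall n, normLp r (x n) <= M].

Definition ultranorm {R : realType} (U : set_system nat) (r : R) (x : useq R) : R :=
  lim (normLp r (x n) @[n --> U]).

Definition ultrapair {R : realType} (U : set_system nat) (x y : useq R) : R :=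
  lim (pairing (x n) (y n) @[n --> U]).

Definition annihilator {R : realType} (U : set_system nat) (r : R) (N : set (useq R)) :
    set (useq R) :=
  [set x | bounded_seq r x /\ forall y, N y -> ultrapair U x y = 0].

Definition vanishing {R : realType} (U : set_system nat) (t r : R) : set (useq R) :=
  [set x | bounded_seq r x /\ normLp t (x n) @[n --> U] --> 0].

Local Notation null_seq U r := (vanishing U r r).

Definition constants {R : realType} (r : R) : set (useq R) := [set fun=> f | f in inLp r].

Definition weakly_null {R : realType} (U : set_system nat) (r s : R) : set (useq R) :=
  annihilator U r (constants s).

Section bounded_sequences.
Context {R : realType} (U : set_system nat) {UF : UltraFilter U}.
Implicit Types (x y z : useq R) (f g : R -> R) (c K M r s : R).

Lemma bounded_seq_bound r x : bounded_seq r x ->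
  exists2 M : R, 0 < M & forall n, normLp r (x n) <= M.
Proof.
move=> [_ [M xM]]; exists (`|M| + 1) => [|n]; first by rewrite ltr_wpDl.
by rewrite (le_trans (xM n)) // (le_trans (ler_norm M)) // lerDl.
Qed.

Lemma bounded_seq_subspace r : 1 <= r -> subspace (@bounded_seq R r).
Proof.
move=> r1; have r0 : 0 < r by exact: lt_le_trans r1.
have subLp := Lp_subspace (ltW r0).
split=> [|a x y [Lx [M xM]] [Ly [M' yM']]].
  by split=> [n|]; [exact: Lp_cst|exists 0 => n; rewrite normLp0].
split=> [n|]; first by apply: subLp.2.
exists (`|a| * M + M') => n; have Lax : inLp r (a *: x n) by exact: subspaceZ.
by rewrite (le_trans (normLp_triangle _ Lax (Ly n))) // lerD // normLpZ // ler_wpM2l.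
Qed.

Lemma bounded_seq_cst r f : inLp r f -> bounded_seq r (fun=> f).
Proof. by move=> Lf; split=> //; exists (normLp r f). Qed.

Lemma constants_bounded r : @constants R r `<=` bounded_seq r.
Proof. by move=> _ [f Lf <-]; exact: bounded_seq_cst. Qed.

Lemma bounded_seq_le r x y : 0 < r -> bounded_seq r y -> (forall n, measurable01 (x n)) ->
  (forall n t, `|x n t| <= `|y n t|) -> bounded_seq r x.
Proof.
move=> r0 [Ly [M yM]] mx xy.
have Lx n : inLp r (x n) by exact: (Lp_le (ltW r0) (mx n) (xy n) (Ly n)).
by split=> //; exists M => n; apply: le_trans (yM n); exact: normLp_mono.
Qed.

Lemma bounded_seq_trunc r x (K : nat -> R) : 0 < r -> bounded_seq r x ->
  bounded_seq r (fun n => trunc (K n) (x n)).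
Proof.
move=> r0 bx; apply: (bounded_seq_le _ bx) => // [n|n t]; last exact: normr_trunc_le_self.
by apply: measurable01_trunc; exact: Lp_measurable (bx.1 n).
Qed.

Lemma bounded_seq_exp_le r s x : 0 < r -> r <= s -> bounded_seq s x -> bounded_seq r x.
Proof.
move=> r0 rs [Lx [M xM]]; split=> [n|]; first exact: (Lp_exp_le (ltW r0) rs).
by exists M => n; apply: le_trans (xM n); exact: normLp_exp_le.
Qed.

Lemma bounded_seq_of_bound r x K : 0 < r -> (forall n, measurable01 (x n)) ->
  (forall n t, `|x n t| <= K) -> bounded_seq r x.
Proof.
move=> r0 mx xK; split=> [n|]; first exact: (Lp_bounded (ltW r0) (mx n) (xK n)).
by exists K => n; exact: normLp_bounded_le.
Qed.

Lemma ultranorm_cvg r x : bounded_seq r x -> normLp r (x n) @[n --> U] --> ultranorm U r x.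
Proof.
move=> [_ [M xM]]; apply: (@bounded_ultra_cvg _ _ _ _ _ M) => n.
by rewrite ger0_norm.
Qed.

Lemma ultranormE r x l : normLp r (x n) @[n --> U] --> l -> ultranorm U r x = l.
Proof. by move=> xl; exact/cvg_lim. Qed.

Lemma ultranorm_cst r f : ultranorm U r (fun=> f) = normLp r f.
Proof. by apply: ultranormE; exact: cvg_cst. Qed.

Lemma ultranorm_ge0 r x : bounded_seq r x -> 0 <= ultranorm U r x.
Proof. by move=> bx; apply: (cvgr_to_ge (ultranorm_cvg bx)); exact: nearW. Qed.

Lemma ultranorm_le r x M : bounded_seq r x -> (\forall n \near U, normLp r (x n) <= M) ->
  ultranorm U r x <= M.
Proof. by move=> bx; exact: cvgr_to_le (ultranorm_cvg bx). Qed.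

Lemma ultranormD r x y : 1 <= r -> bounded_seq r x -> bounded_seq r y ->
  ultranorm U r (x + y) <= ultranorm U r x + ultranorm U r y.
Proof.
move=> r1 bx by_; have bxy := subspaceD (bounded_seq_subspace r1) bx by_.
apply: (ler_cvg_to (ultranorm_cvg bxy) (cvgD (ultranorm_cvg bx) (ultranorm_cvg by_))).
by apply: nearW => n; apply: normLp_triangle => //; [exact: bx.1|exact: by_.1].
Qed.

Lemma ultranormZ r a x : 0 < r -> bounded_seq r x ->
  ultranorm U r (a *: x) = `|a| * ultranorm U r x.
Proof.
move=> r0 bx; apply: ultranormE.
rewrite (_ : (fun n => _) = (fun n => `|a| * normLp r (x n))).
  by apply: cvgMl_tmp; exact: ultranorm_cvg.
by apply/funext => n; rewrite -normLpZ //; exact: bx.1.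
Qed.

Lemma null_seqP r x : bounded_seq r x -> null_seq U r x <-> ultranorm U r x = 0.
Proof.
move=> bx; split=> [[_]|x0]; first exact: ultranormE.
by split=> //; rewrite -x0; exact: ultranorm_cvg.
Qed.

Lemma vanishing_subspace t r : 1 <= t -> t <= r -> subspace (@vanishing R U t r).
Proof.
move=> t1 tr; have t0 : 0 < t by exact: lt_le_trans t1.
have [b0 bP] := bounded_seq_subspace (le_trans t1 tr).
have bt x : bounded_seq r x -> bounded_seq t x by exact: bounded_seq_exp_le.
split=> [|a x y [bx x0] [by_ y0]].
  by split=> //; under eq_fun do rewrite normLp0 //; exact: cvg_cst.
split; first exact: bP.
have Lax n : inLp t (a *: x n) by apply: (LpZ _ (ltW t0)); exact: (bt _ bx).1.
apply: (@cvg0_le _ _ _ _ _ (fun n => `|a| * normLp t (x n) + normLp t (y n))).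
  apply: nearW => n; rewrite ger0_norm // (le_trans (normLp_triangle t1 (Lax n) _)) //.
    exact: (bt _ by_).1.
  by rewrite normLpZ //; exact: (bt _ bx).1.
by rewrite -(addr0 0) -{1}(mulr0 `|a|); apply: cvgD => //; exact: cvgMl_tmp.
Qed.

Lemma vanishing_exp_le t t' r : 0 < t -> t <= t' -> t' <= r ->
  vanishing U t' r `<=` vanishing U t r.
Proof.
move=> t0 tt' t'r x [bx x0]; split=> //; apply: cvg0_le x0; apply: nearW => n.
rewrite ger0_norm //; apply: normLp_exp_le => //.
by apply: Lp_exp_le (bx.1 n) => //; exact: le_trans (ltW t0) tt'.
Qed.

Lemma ultrapairC x y : ultrapair U x y = ultrapair U y x.
Proof. by rewrite /ultrapair; under eq_fun do rewrite pairingC. Qed.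

Lemma ultrapairE x y l : pairing (x n) (y n) @[n --> U] --> l -> ultrapair U x y = l.
Proof. by move=> xyl; exact/cvg_lim. Qed.

Lemma ultrapair_cst f g : ultrapair U (fun=> f) (fun=> g) = pairing f g.
Proof. by apply: ultrapairE; exact: cvg_cst. Qed.

Section duality.
Variables r s : R.
Hypothesis rs : conj_exp r s.
Let bounded_r := bounded_seq_subspace (ltW (conj_exp_gt1 rs)).

Lemma ultrapair_cvg x y : bounded_seq r x -> bounded_seq s y ->
  pairing (x n) (y n) @[n --> U] --> ultrapair U x y.
Proof.
move=> [Lx [M xM]] [Ly [M' yM']]; apply: (@bounded_ultra_cvg _ _ _ _ _ (M * M')) => n.
by rewrite (le_trans (normr_pairing_le rs (Lx n) (Ly n))) // ler_pM.
Qed.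

Lemma ultrapair_linear_l z : bounded_seq s z ->
  linear_on (@bounded_seq R r) (ultrapair U ^~ z).
Proof.
move=> bz a x y bx by_; apply: ultrapairE.
under eq_fun do rewrite (pairing_linear_l rs (bz.1 _) a (bx.1 _) (by_.1 _)).
by apply: cvgD; [apply: cvgMl_tmp|]; exact: ultrapair_cvg.
Qed.

Lemma ultrapair_linear_r x : bounded_seq r x -> linear_on (@bounded_seq R s) (ultrapair U x).
Proof.
move=> bx a y z by_ bz; apply: ultrapairE.
under eq_fun do rewrite (pairing_linear_r rs (bx.1 _) a (by_.1 _) (bz.1 _)).
by apply: cvgD; [apply: cvgMl_tmp|]; exact: ultrapair_cvg.
Qed.

Lemma normr_ultrapair_le x y : bounded_seq r x -> bounded_seq s y ->
  `|ultrapair U x y| <= ultranorm U r x * ultranorm U s y.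
Proof.
move=> bx by_.
apply: (ler_cvg_to (cvg_norm (ultrapair_cvg bx by_)) (cvgM (ultranorm_cvg bx) (ultranorm_cvg by_))).
apply: nearW => n.
exact: normr_pairing_le rs (bx.1 n) (by_.1 n).
Qed.

Lemma ultrapair_eq0_of_approx x y : bounded_seq r x -> bounded_seq s y ->
  (forall e : R, 0 < e -> exists z,
     [/\ bounded_seq r z, ultranorm U r (x - z) <= e & ultrapair U z y = 0]) ->
  ultrapair U x y = 0.
Proof.
move=> bx by_ x_approx; apply/normr0_eq0/le_anti; rewrite normr_ge0 andbT.
apply/ler_addgt0Pr => e e0; rewrite add0r; set M := ultranorm U s y.
have M1 : 0 < M + 1 by rewrite ltr_wpDl // ultranorm_ge0.
have [z [bz xz zy]] := x_approx _ (divr_gt0 e0 M1).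
have bxz := subspaceB bounded_r bx bz.
have lin := ultrapair_linear_l by_.
have -> : ultrapair U x y = ultrapair U (x - z) y by rewrite (linear_onB lin) // zy subr0.
apply: (le_trans (normr_ultrapair_le bxz by_)).
apply: (@le_trans _ _ (e / (M + 1) * (M + 1))); last by rewrite divfK // gt_eqF.
by apply: ler_pM; rewrite ?ultranorm_ge0 // lerDl.
Qed.

Lemma null_seq_ultrapair x y : null_seq U r x -> bounded_seq s y -> ultrapair U x y = 0.
Proof.
move=> nx by_; have bx := nx.1; apply/normr0_eq0/le_anti; rewrite normr_ge0 andbT.
by apply: (le_trans (normr_ultrapair_le bx by_)); rewrite (null_seqP bx).1 // mul0r.
Qed.

Lemma annihilator_subspace N : N `<=` bounded_seq s -> subspace (annihilator U r N).
Proof.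
move=> bN; have [b0 bP] := bounded_r.
split=> [|a x y [bx xN] [by_ yN]]; first split=> // z /bN bz.
  exact: (linear_on0 bounded_r (ultrapair_linear_l bz)).
split=> [|z Nz]; first exact: bP.
by rewrite (ultrapair_linear_l (bN _ Nz)) // xN // yN // mulr0 addr0.
Qed.

Lemma weakly_null_subspace : subspace (weakly_null U r s).
Proof. exact: annihilator_subspace (@constants_bounded s). Qed.

Lemma annihilator_closed N x : N `<=` bounded_seq s -> bounded_seq r x ->
  (forall e : R, 0 < e -> exists2 y, annihilator U r N y & ultranorm U r (x - y) <= e) ->
  annihilator U r N x.
Proof.
move=> bN bx x_approx; split=> // z Nz; apply: ultrapair_eq0_of_approx => //; first exact: bN.
by move=> e /x_approx[y [by_ yN] xy]; exists y; split=> //; exact: yN.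
Qed.

Lemma null_seq_annihilator N : N `<=` bounded_seq s -> null_seq U r `<=` annihilator U r N.
Proof.
move=> bN x nx; split=> [|z Nz]; first exact: nx.1.
by apply: null_seq_ultrapair => //; exact: bN.
Qed.

Lemma bounded_seq_duality_map x : bounded_seq r x -> bounded_seq s (fun n => duality_map r (x n)).
Proof.
move=> bx; have [M M0 xM] := bounded_seq_bound bx.
split=> [n|]; first exact: (Lp_duality_map rs (bx.1 n)).
exists (M `^ (r - 1)) => n; rewrite (normLp_duality_map _ rs).
by rewrite ler_powR2r // ltW.
Qed.

Lemma null_seq_of_duality_map x : bounded_seq r x ->
  ultrapair U x (fun n => duality_map r (x n)) = 0 -> null_seq U r x.
Proof.
move=> bx x0; split=> //.
have xr0 : normLp r (x n) `^ r @[n --> U] --> 0.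
  rewrite -x0 (_ : (fun n => _) = (fun n => pairing (x n) (duality_map r (x n)))).
    exact: ultrapair_cvg (bounded_seq_duality_map bx).
  by apply/funext => n; rewrite pairing_duality_map.
rewrite (_ : (fun n => _) = (fun n => (normLp r (x n) `^ r) `^ r^-1)).
  by apply: cvg0_powR xr0; rewrite ?invr_gt0 // => n; exact: powR_ge0.
by apply/funext => n; rewrite powRKV.
Qed.

(* Reflexivity: the functional [y |-> lim <x_n, y>] on L^s is represented in L^r. *)
Lemma weak_limit x : bounded_seq r x ->
  exists2 f, inLp r f & weakly_null U r s (x - (fun=> f)).
Proof.
move=> bx; pose phi (y : R -> R) := ultrapair U x (fun=> y).
have const := @bounded_seq_cst s.
have dual_phi : dual_functional s phi.
  split=> [a f g Lf Lg|].
    exact: (ultrapair_linear_r bx a (const _ Lf) (const _ Lg)).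
  exists (ultranorm U r x) => f Lf; apply: (le_trans (normr_ultrapair_le bx (const _ Lf))).
  by rewrite ultranorm_cst.
have [f Lf phiE] := riesz_representation (conj_expC rs) dual_phi.
have bf := bounded_seq_cst Lf.
exists f => //; split=> [|_ [y Ly <-]]; first exact: (subspaceB bounded_r).
rewrite (linear_onB (ultrapair_linear_l (const _ Ly))) // -/(phi y) phiE //.
by rewrite ultrapair_cst pairingC subrr.
Qed.

Lemma ultrapair_const x f : weakly_null U r s x -> inLp s f -> ultrapair U x (fun=> f) = 0.
Proof. by move=> [_ x0] Lf; apply: x0; exists f. Qed.

End duality.

Lemma weakly_null_separated r s x : conj_exp r s -> weakly_null U r s x ->
  (forall psi, weakly_null U s r psi -> ultrapair U x psi = 0) -> null_seq U r x.
Proof.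
move=> rs wx x_psi; have bx := wx.1; have sr := conj_expC rs.
apply: (null_seq_of_duality_map rs) => //; have bd := bounded_seq_duality_map rs bx.
have [g Lg wg] := weak_limit sr bd; have bg := bounded_seq_cst Lg.
have := x_psi _ wg; rewrite (linear_onB (ultrapair_linear_r rs bx)) //.
by rewrite (ultrapair_const wx Lg) subr0.
Qed.

End bounded_sequences.

(** * Concentrating and equi-integrable sequences *)

(* Up to a null sequence, these are the bounded sequences that live on sets of
   measure tending to zero. *)
Local Notation concentrating U r := (vanishing U 1 r).

(* Equivalently, the r-th powers are uniformly integrable along [U]. *)
Definition equiintegrable {R : realType} (U : set_system nat) (r s : R) : set (useq R) :=
  annihilator U r (concentrating U s).

Lemma near_diagonal (U : set_system nat) {UF : UltraFilter U} (S : nat -> set nat) :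
  nonprincipal U -> (forall k, \forall n \near U, S k n) ->
  exists K : nat -> nat, (forall k, \forall n \near U, (k <= K n)%N) /\
    \forall n \near U, S (K n) n.
Proof.
move=> Unp US; pose K n := \max_(k < n.+1 | `[< S k n >]) (k : nat).
exists K; split=> [k|].
  apply: filterS2 (US k) (nonprincipal_near_ge Unp k) => n Sk kn.
  by apply: (@leq_bigmax_cond _ _ (@nat_of_ord n.+1) (Ordinal (kn : k < n.+1)%N)); exact/asboolP.
apply: filterS (US 0%N) => n S0; rewrite /K.
have [|i /asboolP Si ->] := @eq_bigmax_cond _ [pred i : 'I_n.+1 | `[< S i n >]] (@nat_of_ord n.+1).
  by apply/card_gt0P; exists ord0; exact/asboolP.
exact: Si.
Qed.

Lemma bounded_diagonal {R : realType} (U : set_system nat) {UF : UltraFilter U}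
    (a : nat -> nat -> R) (M : R) : nonprincipal U -> (forall k n, `|a k n| <= M) ->
  exists K : nat -> nat, (forall k, \forall n \near U, (k <= K n)%N) /\
    forall e : R, 0 < e -> exists k, \forall n \near U, a (K n) n <= a k n + e.
Proof.
move=> Unp aM; pose phi k := lim (a k n @[n --> U]).
have a_phi k : a k n @[n --> U] --> phi k by exact: (@bounded_ultra_cvg _ _ _ _ _ M).
have a_near k d : 0 < d -> \forall n \near U, `|phi k - a k n| <= d.
  by have /cvgrPdist_le := a_phi k; exact.
have phiM k : phi k <= M.
  by apply: (cvgr_to_le (a_phi k)); apply: nearW => n; exact: le_trans (ler_norm _) (aM k n).
have sup_phi : has_sup (range phi) by split; [exists (phi 0%N), 0%N|exists M => _ [k _ <-]].
have phi_le_sup k : phi k <= sup (range phi) by apply: (sup_ubound sup_phi.2); exists k.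
have [k|K [K_ge aK]] := @near_diagonal U _ (fun k n => a k n <= phi k + k.+1%:R^-1) Unp.
  have k0 : 0 < k.+1%:R^-1 :> R by rewrite invr_gt0 ltr0Sn.
  by apply: filterS (a_near k _ k0) => n; rewrite distrC -lerBlDl; exact: le_trans (ler_norm _).
exists K; split=> // e e0; have e3 : 0 < e / 3 by rewrite divr_gt0.
have [_ [k _ <-] phi_k] := sup_adherent e3 sup_phi; exists k.
apply: filterS3 aK (K_ge (Num.truncn (e / 3)^-1)) (a_near k _ e3) => n aKn Kn.
rewrite ler_norml => /andP[_ akn].
have Ke : (K n).+1%:R^-1 <= e / 3.
  rewrite -[leRHS]invrK lef_pV2 ?posrE ?invr_gt0 ?ltr0Sn //.
  by apply: ltW; apply: lt_le_trans (truncnS_gt _) _; rewrite ler_nat.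
by move: (_^-1) aKn Ke (phi_le_sup (K n)) => w; lra.
Qed.

Lemma ultrapair_concentrating_bounded {R : realType} (U : set_system nat) {UF : UltraFilter U}
    (r : R) (x y : useq R) (K : R) : 1 <= r -> concentrating U r x ->
  (forall n, measurable01 (y n)) -> (forall n t, `|y n t| <= K) -> ultrapair U x y = 0.
Proof.
move=> r1 [bx x0] my yK; apply: ultrapairE.
apply: (@cvg0_le _ _ _ _ _ (fun n => K * normLp 1 (x n))); last first.
  by rewrite -(mulr0 K); exact: cvgMl_tmp.
apply: nearW => n; have Lx : inLp 1 (x n) by apply: Lp_Lp1 (bx.1 n).
exact: (normr_int01_mul_bounded Lx (my n) (yK n)).2.
Qed.

Section concentration.
Context {R : realType} (U : set_system nat) {UF : UltraFilter U}.
Variables r s : R.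
Hypothesis rs : conj_exp r s.
Implicit Types (x y z : useq R) (f g : R -> R) (c e K M : R).

Lemma concentrating_subspace : subspace (concentrating U r).
Proof. exact: vanishing_subspace. Qed.

Lemma null_seq_concentrating : null_seq U r `<=` concentrating U r.
Proof. exact: vanishing_exp_le. Qed.

Lemma concentrating_bounded : concentrating U r `<=` bounded_seq r.
Proof. by move=> x []. Qed.

Lemma equiintegrable_of_approx x : bounded_seq r x ->
  (forall e, 0 < e -> exists z, [/\ forall n, measurable01 (z n),
     exists K, forall n t, `|z n t| <= K & ultranorm U r (x - z) <= e]) ->
  equiintegrable U r s x.
Proof.
move=> bx x_approx; split=> // y cy; apply: (ultrapair_eq0_of_approx rs) => //; first exact: cy.1.
move=> e /x_approx[z [mz [K zK] xz]]; exists z; split=> //.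
  exact: (bounded_seq_of_bound _ mz zK).
by rewrite ultrapairC; apply: (ultrapair_concentrating_bounded _ cy mz zK).
Qed.

Lemma constants_equiintegrable : constants r `<=` equiintegrable U r s.
Proof.
move=> _ [f Lf <-]; apply: equiintegrable_of_approx; first exact: bounded_seq_cst.
move=> e e0; have r0 : 0 < r by [].
have /cvgr0Pnorm_le/(_ _ e0)/filter_ex[K fK] := cvg_normLp_sub_trunc r0 Lf.
exists (fun=> trunc K%:R f); split=> [_||].
- exact: (measurable01_trunc _ (Lp_measurable Lf)).
- by exists K%:R => _ t; exact: normr_trunc_le.
rewrite (ultranorm_cst r (f - trunc K%:R f)).
exact: le_trans (ler_norm _) fK.
Qed.

Lemma normLp1_duality_map f : normLp 1 (duality_map r f) = int01 (fun t => `|f t| `^ (r - 1)).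
Proof. by rewrite normLp1E; apply: eq_int01 => t _; rewrite normr_spowR. Qed.

Lemma normLp1_duality_map_le f : r <= 2 -> inLp r f ->
  normLp 1 (duality_map r f) <= normLp 1 f `^ (r - 1).
Proof.
move=> r2 Lf; rewrite normLp1_duality_map -normLp_powR //.
apply: ler_powR2r => //; first exact: ltW.
by apply: normLp_exp_le => //; [lra|exact: Lp_Lp1 Lf].
Qed.

Lemma normLp1_duality_map_trunc_le f K : 2 <= r -> 0 < K -> inLp r f ->
  normLp 1 (duality_map r f) <= K `^ (r - 2) * normLp 1 f + K^-1 * normLp r f `^ r.
Proof.
move=> r2 K0 Lf; rewrite normLp1_duality_map normLp_powR // normLp1E.
have L1f := Lp1_normr (Lp_Lp1 (ltW (conj_exp_gt1 rs)) Lf).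
have [sub1 lin] := (@Lp1_subspace R, @int01_linear R); have Lfr := Lp_powR Lf.
rewrite -(linear_onZ sub1 lin K^-1 Lfr) -lin //; last exact: subspaceZ.
apply: le_int01 => [||t].
- have L1d := Lp1_normr (Lp_Lp1 (ltW (conj_exp_gt1 (conj_expC rs))) (Lp_duality_map rs Lf)).
  rewrite (_ : (fun t => _) = (fun t => `|duality_map r f t|)) //.
  by apply/funext => t; rewrite normr_spowR.
- by apply: sub1.2 => //; exact: subspaceZ.
exact: powR_interpolation.
Qed.

Lemma concentrating_duality_map x : concentrating U r x ->
  concentrating U s (fun n => duality_map r (x n)).
Proof.
move=> [bx x0]; split; first exact: (bounded_seq_duality_map rs).
have [r2|r2] := leP r 2.
  have r10 : 0 < r - 1 by [].
  apply: cvg0_le (cvg0_powR r10 _ x0) => //.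
  apply: nearW => n; rewrite ger0_norm //; exact: normLp1_duality_map_le (bx.1 n).
have [M M0 xM] := bounded_seq_bound bx; have Mr0 := powR_gt0 r M0.
apply/cvgr0Pnorm_le => e e0; pose K := 2 * M `^ r / e.
have K0 : 0 < K by rewrite divr_gt0 // mulr_gt0.
have /cvgr0Pnorm_le Kx0 : K `^ (r - 2) * normLp 1 (x n) @[n --> U] --> 0.
  by rewrite -(mulr0 (K `^ (r - 2))); exact: cvgMl_tmp.
have e2 : 0 < e / 2 by rewrite divr_gt0.
apply: filterS (Kx0 _ e2) => n xn; rewrite ger0_norm //.
apply: (le_trans (normLp1_duality_map_trunc_le (ltW r2) K0 (bx.1 n))).
rewrite (splitr e); apply: lerD; first exact: le_trans (ler_norm _) xn.
rewrite invf_div mulrAC ler_pdivrMr ?mulr_gt0 // -mulrA ler_pM2l //.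
by rewrite mulKf // ler_powR2r.
Qed.

Lemma concentrating_equiintegrable_null :
  concentrating U r `&` equiintegrable U r s `<=` null_seq U r.
Proof.
move=> x [cx [bx x0]]; apply: (null_seq_of_duality_map rs) => //.
by apply: x0; exact: concentrating_duality_map.
Qed.

Lemma normLp_trunc_sub f k l : inLp r f -> k <= l ->
  normLp r (trunc l f - trunc k f) `^ r = normLp r (trunc l f) `^ r - normLp r (trunc k f) `^ r.
Proof.
move=> Lf kl; rewrite !normLp_powR //.
have Lt K : inLp 1 (fun t => `|trunc K f t| `^ r) by apply: Lp_powR; exact: Lp_trunc.
rewrite -(linear_onB (@int01_linear R)) //; congr int01; apply/funext => t.
rewrite !fctE /trunc; have [fk|fk] := leP `|f t| k.
  by rewrite (le_trans fk kl) !subrr normr0 powR0 ?gt_eqF.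
by case: ifP => _; rewrite ?subr0 ?normr0 // powR0 ?subr0 ?gt_eqF.
Qed.

Lemma normLp_sub_trunc_exp_le t u f K : 0 < t -> t <= u -> 0 < K -> inLp u f ->
  K `^ (u - t) * normLp t (f - trunc K f) `^ t <= normLp u f `^ u.
Proof.
move=> t0 tu K0 Lf; have u0 : 0 < u by exact: lt_le_trans tu.
have Lft : inLp t f by apply: Lp_exp_le Lf => //; exact: ltW.
have Ld : inLp t (f - trunc K f).
  by apply: LpB => //; [exact: ltW|apply: Lp_trunc => //; exact: ltW].
rewrite !normLp_powR // -(linear_onZ (@Lp1_subspace R) (@int01_linear R)); last exact: Lp_powR.
apply: le_int01 => [||v]; first by apply: LpZ => //; exact: Lp_powR.
  exact: Lp_powR.
rewrite !fctE -![_ *: _]/(_ * _) /trunc; have [_|Kf] := leP `|f v| K.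
  by rewrite subrr normr0 powR0 ?gt_eqF // mulr0 powR_ge0.
rewrite subr0 -[X in _ <= _ `^ X](subrK t u) (@powRD _ `|f v|); last first.
  by rewrite (gt_eqF (lt_trans K0 Kf)) implybT.
by rewrite ler_wpM2r ?powR_ge0 // ler_powR2r ?subr_ge0 // ltW.
Qed.

Lemma bounded_seq_equiintegrable t x : r < t -> bounded_seq t x -> equiintegrable U r s x.
Proof.
move=> rt bx; have r0 : 0 < r by []; have rt0 : 0 < t - r by rewrite subr_gt0.
apply: equiintegrable_of_approx => [|e e0]; first exact: bounded_seq_exp_le (ltW rt) bx.
have [M M0 xM] := bounded_seq_bound bx; pose K := (M `^ t / e `^ r) `^ (t - r)^-1.
have KE : K `^ (t - r) = M `^ t / e `^ r by rewrite powRVK // divr_ge0 ?powR_ge0.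
have K0 : 0 < K by rewrite powR_gt0 // divr_gt0 // powR_gt0.
have bxr := bounded_seq_exp_le r0 (ltW rt) bx; have bt := bounded_seq_trunc (fun=> K) r0 bxr.
exists (fun n => trunc K (x n)); split=> [n||].
- by apply: measurable01_trunc; exact: Lp_measurable (bx.1 n).
- by exists K => n v; apply: normr_trunc_le; exact: ltW.
apply: ultranorm_le; first exact: (subspaceB (bounded_seq_subspace _)).
apply: nearW => n; rewrite -(ler_pPowR2r r0) ?nnegrE ?(ltW e0) //.
have := normLp_sub_trunc_exp_le r0 (ltW rt) K0 (bx.1 n); rewrite KE mulrAC ler_pdivrMr ?powR_gt0 //.
have xMt : normLp t (x n) `^ t <= M `^ t.
  by apply: ler_powR2r; rewrite // (le_trans (ltW r0)) // ltW.
move=> /le_trans/(_ (ler_wpM2r (powR_ge0 _ _) xMt)).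
by rewrite ler_pM2l // powR_gt0.
Qed.

Section splitting.
Variable x : useq R.
Hypothesis bx : bounded_seq r x.
Variable K : nat -> nat.
Hypothesis K_ge : forall k, \forall n \near U, (k <= K n)%N.

Lemma concentrating_sub_trunc : concentrating U r (fun n => x n - trunc (K n)%:R (x n)).
Proof.
have Lt n k : inLp r (trunc k (x n)) by apply: Lp_trunc => //; exact: bx.1.
have [M M0 xM] := bounded_seq_bound bx.
split; first split=> [n|]; first by apply: LpB => //; exact: bx.1.
  by exists M => n; apply: le_trans (xM n); apply: normLp_sub_trunc_le => //; exact: bx.1.
apply/cvgr0Pnorm_le => e e0; pose K0 := (M `^ r / e) `^ (r - 1)^-1.
have K0E : K0 `^ (r - 1) = M `^ r / e by rewrite powRVK // divr_ge0 ?powR_ge0 ?ltW.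
have K00 : 0 < K0 by rewrite powR_gt0 // divr_gt0 // powR_gt0.
apply: filterS (K_ge (Num.truncn K0).+1) => n Kn; rewrite ger0_norm //.
have K0K : K0 < (K n)%:R by apply: lt_le_trans (truncnS_gt _) _; rewrite ler_nat.
have Kn0 := lt_trans K00 K0K.
have KnM : M `^ r / e <= (K n)%:R `^ (r - 1).
  by rewrite -K0E; apply: ler_powR2r; exact: ltW.
rewrite -(ler_pM2l (powR_gt0 (r - 1) Kn0)).
have := normLp_sub_trunc_exp_le ltr01 (ltW (conj_exp_gt1 rs)) Kn0 (bx.1 n).
rewrite powRr1 // => /le_trans; apply.
apply: (@le_trans _ _ (M `^ r)); first by apply: ler_powR2r.
by rewrite -ler_pdivrMr.
Qed.

Hypothesis K_approx : forall e, 0 < e -> exists k, \forall n \near U,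
  normLp r (trunc (K n)%:R (x n)) `^ r <= normLp r (trunc k%:R (x n)) `^ r + e.

Lemma ultranorm_trunc_sub_le e : 0 < e -> exists k : nat,
  ultranorm U r ((fun n => trunc (K n)%:R (x n)) - (fun n => trunc k%:R (x n))) <= e.
Proof.
move=> e0; have r0 : 0 < r by []; have [k xk] := K_approx (powR_gt0 r e0); exists k.
have bt := bounded_seq_trunc _ r0 bx.
apply: ultranorm_le; first exact: (subspaceB (bounded_seq_subspace _)).
apply: filterS2 xk (K_ge k) => n xk kK.
have : normLp r (trunc (K n)%:R (x n) - trunc k%:R (x n)) `^ r <= e `^ r.
  by rewrite normLp_trunc_sub ?ler_nat //; [rewrite lerBlDl|exact: bx.1].
by rewrite ler_pPowR2r // nnegrE // ltW.
Qed.

End splitting.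

Lemma concentrating_splitting x : nonprincipal U -> bounded_seq r x ->
  exists K : nat -> nat, let b n := trunc (K n)%:R (x n) in
  [/\ concentrating U r (x - b), equiintegrable U r s b &
    forall e, 0 < e -> exists k : nat, ultranorm U r (b - (fun n => trunc k%:R (x n))) <= e].
Proof.
move=> Unp bx; have [M M0 xM] := bounded_seq_bound bx.
have tM k n : `|normLp r (trunc k%:R (x n)) `^ r| <= M `^ r.
  rewrite (ger0_norm (powR_ge0 _ _)); apply: ler_powR2r => //.
  by apply: le_trans (xM n); apply: normLp_trunc_le => //; exact: bx.1.
have [K [K_ge K_approx]] := bounded_diagonal Unp tM.
exists K => b; have b_approx := ultranorm_trunc_sub_le bx K_ge K_approx.
split=> //; first exact: concentrating_sub_trunc.
apply: equiintegrable_of_approx => [|e /b_approx[k bk]]; first exact: bounded_seq_trunc.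
exists (fun n => trunc k%:R (x n)); split=> // [n|].
  by apply: measurable01_trunc; exact: Lp_measurable (bx.1 n).
by exists k%:R => n t; exact: normr_trunc_le.
Qed.

End concentration.

(** * Norm increments *)

(* Iterating this inequality along a selected subset yields an upper t-estimate. *)
Definition small_increments {R : realType} (U : set_system nat) (r t : R) (x : useq R) : Prop :=
  exists2 C : R, 0 <= C & forall a, inLp r a -> forall e : R, 0 < e ->
    \forall n \near U, forall c : R, `|c| <= 1 ->
      normLp r (a + c *: x n) `^ r <=
        normLp r a `^ r + C * `|c| `^ t * (1 + normLp r a `^ r) + e.

Section increments.
Context {R : realType} (U : set_system nat) {UF : UltraFilter U}.
Variables r s : R.
Hypothesis rs : conj_exp r s.
Implicit Types (x y z : useq R) (f g : R -> R) (c e K M : R).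

Lemma concentrating_weakly_null : concentrating U r `<=` weakly_null U r s.
Proof.
move=> x cx; split=> [|y /(constants_equiintegrable (conj_expC rs)) [_ yc]]; first exact: cx.1.
by rewrite ultrapairC; exact: yc.
Qed.

Lemma weakly_null_cvg x f : weakly_null U r s x -> inLp s f -> pairing (x n) f @[n --> U] --> 0.
Proof.
move=> wx Lf; rewrite -(ultrapair_const wx Lf).
exact: (ultrapair_cvg rs wx.1 (bounded_seq_cst Lf)).
Qed.

Lemma Lp1_cross f g : inLp r f -> inLp r g -> inLp 1 (fun t => `|f t| `^ (r - 1) * `|g t|).
Proof.
move=> Lf Lg; have L1fg := Lp1_normr (Lp1_pair (conj_expC rs) (Lp_duality_map rs Lf) Lg).
rewrite (_ : (fun t => _) = (fun t => `|duality_map r f t * g t|)) //.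
by apply/funext => t; rewrite normrM normr_spowR.
Qed.

Lemma normLp_powR_add_cross f g : inLp r f -> inLp r g ->
  normLp r (f + g) `^ r <= normLp r f `^ r +
    r * 2 `^ r * int01 (fun t => `|f t| `^ (r - 1) * `|g t|) + r * 2 `^ r * normLp r g `^ r.
Proof.
move=> Lf Lg; rewrite !normLp_powR //.
have [sub1 lin] := (@Lp1_subspace R, @int01_linear R).
have [[L1f L1g] L1c] := (Lp_powR Lf, Lp_powR Lg, Lp1_cross Lf Lg).
rewrite [leRHS]addrC [X in _ <= _ + X]addrC -lin // -lin //; last exact: sub1.2.
apply: le_int01 => [||t]; [exact/Lp_powR/LpD|by do 2![apply: sub1.2 => //]|].
by rewrite !fctE [leRHS]addrC [X in _ <= X + _]addrC; exact: normr_powR_add_cross.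
Qed.

Lemma concentrating_cross_cvg x f : concentrating U r x -> inLp r f ->
  int01 (fun t => `|f t| `^ (r - 1) * `|x n t|) @[n --> U] --> 0.
Proof.
move=> [bx x0] Lf; have Ld := Lp_duality_map rs Lf.
have cx : concentrating U r (fun n t => `|x n t|).
  split; last first.
    rewrite (_ : (fun n => _) = (fun n => normLp 1 (x n))) //; apply/funext => n.
    by rewrite !normLp1E; apply: eq_int01 => t _; rewrite normr_id.
  apply: (bounded_seq_le _ bx) => // [n|n t]; last by rewrite normr_id.
  by apply: measurable01_normr; exact: Lp_measurable (bx.1 n).
have Lnd : inLp s (fun t => `|duality_map r f t|).
  apply: (Lp_le _ _ _ Ld) => // [|t]; last by rewrite normr_id.
  by apply: measurable01_normr; exact: Lp_measurable Ld.
have := weakly_null_cvg (concentrating_weakly_null cx) Lnd.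
rewrite (_ : (fun n => pairing _ _) = (fun n => int01 (fun t => `|f t| `^ (r - 1) * `|x n t|))) //.
apply/funext => n; rewrite pairingC; apply: eq_int01 => t _.
by rewrite normr_spowR.
Qed.

(* The terms of a concentrating sequence are eventually almost disjoint from a given function. *)
Lemma concentrating_increment x : concentrating U r x -> exists2 C, 0 <= C &
  forall a, inLp r a -> forall e, 0 < e -> \forall n \near U, forall c, `|c| <= 1 ->
    normLp r (a + c *: x n) `^ r <= normLp r a `^ r + C * `|c| `^ r + e.
Proof.
move=> cx; have bx := cx.1; have [M M0 xM] := bounded_seq_bound bx; have r0 : 0 < r by [].
pose A := r * 2 `^ r; have A0 : 0 < A by rewrite mulr_gt0 ?powR_gt0.
exists (A * M `^ r) => [|a La e e0]; first by rewrite mulr_ge0 ?powR_ge0 // ltW.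
have /cvgr0Pnorm_le cross0 := concentrating_cross_cvg cx La.
apply: filterS (cross0 _ (divr_gt0 e0 A0)) => n an c c1.
have Lcx := LpZ c (ltW r0) (bx.1 n).
apply: (le_trans (normLp_powR_add_cross La Lcx)); rewrite -/A -!addrA lerD2l addrC.
apply: lerD.
  rewrite normLpZ ?powRM //; last exact: bx.1.
  by rewrite -[leRHS]mulrA ler_pM2l // mulrC ler_wpM2r ?powR_ge0 // ler_powR2r.
rewrite mulrC -ler_pdivlMr //; apply: le_trans an; apply: le_trans (ler_norm _).
apply: le_int01 => [||t]; [exact: Lp1_cross|exact: (Lp1_cross La (bx.1 n))|].
rewrite !fctE -![_ *: _]/(_ * _) normrM ler_wpM2l ?powR_ge0 //.
by rewrite ler_piMl.
Qed.

Lemma normLp_powR_expand : exists2 C, 0 <= C & forall f g c, inLp r f -> inLp r g -> `|c| <= 1 ->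
  normLp r (f + c *: g) `^ r <= normLp r f `^ r + r * (c * pairing g (duality_map r f)) +
    C * `|c| `^ Num.min r 2 * (normLp r f `^ r + normLp r g `^ r).
Proof.
have [C C0 expand] := normr_powR_expand (conj_exp_gt1 rs).
exists C => // f g c Lf Lg c1; rewrite !normLp_powR // pairingC.
have [sub1 lin] := (@Lp1_subspace R, @int01_linear R).
have [L1f L1g] := (Lp_powR Lf, Lp_powR Lg).
have L1d : inLp 1 (fun t => duality_map r f t * g t).
  by apply: Lp1_pair (Lp_duality_map rs Lf) Lg; exact: conj_expC.
rewrite mulrA [leRHS]addrC [X in _ <= _ + X]addrC.
rewrite -lin // -(linear_onD lin) // -lin //; last 2 first.
- exact: subspaceD.
- exact: sub1.2.
apply: le_int01 => [||t]; first by apply: Lp_powR; apply: LpD => //; exact: LpZ.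
  by apply: (sub1.2) => //; [exact: subspaceD|exact: sub1.2].
rewrite !fctE -![_ *: _]/(_ * _); have := expand (f t) (g t) c c1; rewrite /duality_map; lra.
Qed.

Lemma concentrating_small_increments x : concentrating U r x -> small_increments U r r x.
Proof.
move=> /concentrating_increment[C C0 incr]; exists C => // a La e e0.
apply: filterS (incr a La e e0) => n xn c /xn /le_trans; apply; rewrite lerD2r lerD2l.
by rewrite ler_peMr ?mulr_ge0 ?powR_ge0 // lerDl powR_ge0.
Qed.

Lemma weakly_null_small_increments x : weakly_null U r s x ->
  small_increments U r (Num.min r 2) x.
Proof.
move=> wx; have bx := wx.1; have [M M0 xM] := bounded_seq_bound bx; have r0 : 0 < r by [].
have [C C0 expand] := normLp_powR_expand; have M1 : 0 <= 1 + M `^ r by rewrite addr_ge0 ?powR_ge0.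
exists (C * (1 + M `^ r)) => [|a La e e0]; first exact: mulr_ge0.
have /cvgr0Pnorm_le xa0 := weakly_null_cvg wx (Lp_duality_map rs La).
apply: filterS (xa0 _ (divr_gt0 e0 r0)) => n xa c c1.
apply: (le_trans (expand a (x n) c La (bx.1 n) c1)); rewrite -!addrA lerD2l addrC.
apply: lerD; last first.
  rewrite mulrC -ler_pdivlMr // (le_trans (ler_norm _)) // normrM.
  by apply: le_trans xa; rewrite ler_piMl.
rewrite [C * (1 + _) * _]mulrAC -[leRHS]mulrA ler_wpM2l ?mulr_ge0 ?powR_ge0 //.
have : normLp r (x n) `^ r <= M `^ r by rewrite ler_powR2r.
have := powR_ge0 M r; have := powR_ge0 (normLp r a) r.
by move: (_ `^ r) (_ `^ r) (_ `^ r) => A B D; nra.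
Qed.

End increments.

(** * Bounded operators *)

(* Two functions are identified when they have the same pairing with every element of L^s. *)
Definition bounded_operator {R : realType} (r s : R) (T : (R -> R) -> (R -> R)) : Prop :=
  [/\ forall f, inLp r f -> inLp r (T f),
      forall y, inLp s y -> linear_on (inLp r) (fun f => pairing (T f) y) &
      exists C : R, forall f, inLp r f -> normLp r (T f) <= C * normLp r f].

Section bounded_operators.
Context {R : realType}.
Variables r s : R.
Hypothesis rs : conj_exp r s.
Implicit Types (f g y : R -> R) (c a : R) (T : (R -> R) -> (R -> R)).

Let subLr : subspace (@inLp R r) := Lp_subspace (gt1_ge0 (conj_exp_gt1 rs)).

Lemma pairing_congr f g y : inLp r f -> inLp r g -> inLp s y -> normLp r (f - g) = 0 ->
  pairing f y = pairing g y.
Proof.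
move=> Lf Lg Ly fg; apply/eqP; rewrite -subr_eq0 -(linear_onB (pairing_linear_l rs Ly)) //.
by rewrite (pairing_eq0 rs) //; exact: subspaceB.
Qed.

Lemma normLp_sub_eq0 f g : inLp r f -> inLp r g ->
  (forall y, inLp s y -> pairing f y = pairing g y) -> normLp r (f - g) = 0.
Proof.
move=> Lf Lg fg; apply: (pairing_separates rs) => [|y Ly]; first exact: subspaceB.
by rewrite (linear_onB (pairing_linear_l rs Ly)) // fg // subrr.
Qed.

Lemma LpOpP T : LpOp r T <-> bounded_operator r s T.
Proof.
rewrite /LpOp Lp_inLp lpn_normLp; split=> [[LT [_ [TD [TZ TC]]]]|[LT lin [C TC]]].
  split=> // y Ly a f g Lf Lg; have Laf : inLp r (a *: f) by exact: subspaceZ.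
  have linp := pairing_linear_l rs Ly; have [LTf LTg LTaf] := And3 (LT _ Lf) (LT _ Lg) (LT _ Laf).
  rewrite -(linear_onZ subLr linp) // -(pairing_congr LTaf _ Ly (TZ a f Lf)); last first.
    exact: (subspaceZ a subLr LTf).
  rewrite -(linear_onD linp) //; apply: pairing_congr (TD _ _ Laf Lg) => //.
    by apply: LT; exact: subLr.2.
  exact: (subspaceD subLr LTaf LTg).
have T_eq f g : inLp r f -> inLp r g -> (forall y, inLp s y -> pairing (T f) y = pairing g y) ->
  normLp r (T f - g) = 0 by move=> /LT; exact: normLp_sub_eq0.
do !split=> //; last by exists C.
- move=> f g Lf Lg fg; apply: T_eq => // [|y Ly]; first exact: LT.
  have linT := lin _ Ly; apply/eqP; rewrite -subr_eq0 -(linear_onB linT) //.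
  have Lfg := subspaceB subLr Lf Lg; rewrite (pairing_eq0 rs (LT _ Lfg)) //.
  by apply/le_anti; rewrite normLp_ge0 andbT (le_trans (TC _ Lfg)) // fg mulr0.
- move=> f g Lf Lg; have [LTf LTg] := (LT _ Lf, LT _ Lg).
  apply: T_eq => [||y Ly]; [exact: (subspaceD subLr Lf Lg)|exact: (subspaceD subLr LTf LTg)|].
  by rewrite (linear_onD (lin _ Ly)) // (linear_onD (pairing_linear_l rs Ly)).
- move=> a f Lf; have LTf := LT _ Lf; apply: T_eq => [||y Ly].
  + exact: (subspaceZ a subLr Lf).
  + exact: (subspaceZ a subLr LTf).
  by rewrite (linear_onZ subLr (lin _ Ly)) // (linear_onZ subLr (pairing_linear_l rs Ly)).
Qed.

Lemma bounded_operator_bound T : bounded_operator r s T ->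
  exists2 C, 0 < C & forall f, inLp r f -> normLp r (T f) <= C * normLp r f.
Proof.
move=> [_ _ [C TC]]; exists (`|C| + 1) => [|f Lf]; first by rewrite ltr_wpDl.
by rewrite (le_trans (TC f Lf)) // ler_wpM2r // (le_trans (ler_norm C)) // lerDl.
Qed.

Lemma bounded_seq_operator T x : bounded_operator r s T -> bounded_seq r x ->
  bounded_seq r (fun n => T (x n)).
Proof.
move=> bT bx; have [LT _ _] := bT; have [C C0 TC] := bounded_operator_bound bT.
have [M M0 xM] := bounded_seq_bound bx.
split=> [n|]; first by apply: LT; exact: bx.1.
by exists (C * M) => n; rewrite (le_trans (TC _ (bx.1 n))) // ler_wpM2l // ltW.
Qed.

Lemma bounded_operator_lin T a f g : bounded_operator r s T -> inLp r f -> inLp r g ->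
  normLp r (T (a *: f + g) - (a *: T f + T g)) = 0.
Proof.
move=> [LT lin _] Lf Lg; have [LTf LTg] := (LT _ Lf, LT _ Lg).
apply: normLp_sub_eq0 => [||y Ly]; [by apply: LT; exact: subLr.2|exact: subLr.2|].
by rewrite lin // (pairing_linear_l rs Ly).
Qed.

Lemma bounded_operator_comb a T1 T2 : bounded_operator r s T1 -> bounded_operator r s T2 ->
  bounded_operator r s (fun f => a *: T1 f + T2 f).
Proof.
move=> bT1 bT2; have [[LT1 lin1 _] [LT2 lin2 _]] := (bT1, bT2).
split=> [f Lf|y Ly b f g Lf Lg|]; first by apply: subLr.2; [exact: LT1|exact: LT2].
  have [L1f L1g] := (LT1 _ Lf, LT1 _ Lg); have [L2f L2g] := (LT2 _ Lf, LT2 _ Lg).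
  have linp := pairing_linear_l rs Ly.
  rewrite /= !linp ?lin1 ?lin2 //; try exact: LT1; try exact: LT2.
  - ring.
  - by apply: LT1; exact: subLr.2.
  - by apply: LT2; exact: subLr.2.
have [C1 C10 TC1] := bounded_operator_bound bT1; have [C2 C20 TC2] := bounded_operator_bound bT2.
exists (`|a| * C1 + C2) => f Lf; have [LT1f LT2f] := (LT1 _ Lf, LT2 _ Lf).
have LaT := subspaceZ a subLr LT1f.
rewrite mulrDl (le_trans (normLp_triangle _ LaT LT2f)) // lerD ?TC2 //.
by rewrite normLpZ // -mulrA ler_wpM2l // TC1.
Qed.

Lemma rank_one_operator f y : inLp r f -> inLp s y ->
  bounded_operator r s (fun g => pairing g y *: f).
Proof.
move=> Lf Ly; have linp := pairing_linear_l rs Ly.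
split=> [g Lg|h Lh a g g' Lg Lg'|]; first exact: subspaceZ.
  by rewrite linp // !(linear_onZ subLr (pairing_linear_l rs Lh)) // mulrDl mulrA.
exists (normLp s y * normLp r f) => g Lg; rewrite normLpZ // mulrAC mulrC [leRHS]mulrC.
by rewrite ler_wpM2l // mulrC; exact: normr_pairing_le.
Qed.

Lemma zero_operator : bounded_operator r s (fun=> 0).
Proof.
split=> [_ _|y Ly a f g _ _|]; first by case: subLr.
  by rewrite (linear_on0 subLr (pairing_linear_l rs Ly)) mulr0 addr0.
by exists 0 => f _; rewrite normLp0 // mul0r.
Qed.

Lemma finite_rank_operator k (f y : 'I_k -> R -> R) : (forall i, inLp r (f i)) ->
  (forall i, inLp s (y i)) -> bounded_operator r s (fun g => \sum_i pairing g (y i) *: f i).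
Proof.
elim: k f y => [|k IH] f y Lf Ly.
  rewrite (_ : (fun g => _) = fun=> 0); first exact: zero_operator.
  by apply/funext => g; rewrite big_ord0.
have bT := IH _ _ (fun i => Lf (lift ord0 i)) (fun i => Ly (lift ord0 i)).
have := bounded_operator_comb 1 (rank_one_operator (Lf ord0) (Ly ord0)) bT.
congr bounded_operator; apply/funext => g; by rewrite big_ord_recl scale1r.
Qed.

End bounded_operators.

Lemma adjoint_operator {R : realType} (r s : R) T : conj_exp r s -> bounded_operator r s T ->
  exists2 T', bounded_operator s r T' &
    forall f y, inLp r f -> inLp s y -> pairing (T f) y = pairing f (T' y).
Proof.
move=> rs bT; have [LT lin _] := bT; have [C C0 TC] := bounded_operator_bound bT.
have T_le f y : inLp r f -> inLp s y -> `|pairing (T f) y| <= C * normLp s y * normLp r f.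
  move=> Lf Ly; rewrite (le_trans (normr_pairing_le rs (LT _ Lf) Ly)) // mulrAC.
  by rewrite ler_wpM2r // TC.
have /choice[T' T'P] (y : R -> R) : exists g : R -> R, inLp s y -> inLp s g /\
    forall f, inLp r f -> pairing (T f) y = pairing f g.
  have [Ly|nLy] := pselect (inLp s y); last by exists y.
  have [|g Lg Tg] := riesz_representation rs (phi := fun f => pairing (T f) y); last by exists g.
  by split; [exact: lin|exists (C * normLp s y) => f Lf; exact: T_le].
have LT' y : inLp s y -> inLp s (T' y) by move=> /T'P[].
have T'E f y : inLp r f -> inLp s y -> pairing (T' y) f = pairing (T f) y.
  by move=> Lf /T'P[_ ->] //; rewrite pairingC.
exists T'; last by move=> f y Lf Ly; rewrite [RHS]pairingC T'E.
split=> // [f Lf a y z Ly Lz|].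
  rewrite !T'E //; last by apply: (Lp_subspace _).2.
  exact: (pairing_linear_r rs (LT _ Lf)).
exists C => y Ly; apply: (normLp_le_dual (conj_expC rs)) => [||f Lf]; first exact: LT'.
  by rewrite mulr_ge0 // ltW.
by rewrite T'E // (le_trans (ler_norm _)) // T_le.
Qed.

Section concentration_preservation.
Context {R : realType} (U : set_system nat) {UF : UltraFilter U}.
Implicit Types (x : useq R) (f g : R -> R) (a c d e B C th : R).

Lemma normLp2_sqr f : normLp 2 f ^+ 2 = pairing f f.
Proof.
rewrite -powR_mulrn // normLp_powR //; apply: eq_int01 => t _.
by rewrite powR_mulrn // -normrX ger0_norm ?sqr_ge0 // expr2.
Qed.

Lemma normLp2_sqrD f g : inLp 2 f -> inLp 2 g ->
  normLp 2 (f + g) ^+ 2 = normLp 2 f ^+ 2 + 2 * pairing f g + normLp 2 g ^+ 2.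
Proof.
move=> Lf Lg; have c2 := @conj_exp2 R; have Lfg := LpD (ler0n R 2) Lf Lg.
rewrite !normLp2_sqr (linear_onD (pairing_linear_l c2 Lfg)) //.
rewrite !(linear_onD (pairing_linear_r c2 _)) // (pairingC g f); ring.
Qed.

Lemma exists_sign_normLp2 f g : inLp 2 f -> inLp 2 g -> exists2 e, `|e| = 1 &
  normLp 2 f ^+ 2 + normLp 2 g ^+ 2 <= normLp 2 (f + e *: g) ^+ 2.
Proof.
move=> Lf Lg; have c2 := @conj_exp2 R; have sub2 := @Lp_subspace R 2 (ler0n R 2).
have [e e1 e_ge0] : exists2 e, `|e| = 1 & 0 <= e * pairing f g.
  have [fg|fg] := leP 0 (pairing f g); first by exists 1; rewrite ?normr1 ?mul1r.
  by exists (-1); rewrite ?normrN1 // mulN1r oppr_ge0 ltW.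
exists e => //; rewrite normLp2_sqrD //; last exact: subspaceZ.
rewrite (linear_onZ sub2 (pairing_linear_r c2 Lf)) // normLpZ // e1 mul1r.
by rewrite lerD2r lerDl mulr_ge0.
Qed.

Lemma linear_not_le_sublinear a B th : 0 < a -> 0 <= B -> th < 1 ->
  ~ (forall N : nat, a * N%:R <= B * N%:R `^ th).
Proof.
move=> a0 B0 th1 lin_le; pose D := B / a; have th0 : 0 < 1 - th by rewrite subr_gt0.
pose N := (Num.truncn (D `^ (1 - th)^-1)).+1.
have N0 : 0 < N%:R :> R by rewrite ltr0Sn.
have : D < N%:R `^ (1 - th).
  rewrite -{1}(@powRVK _ (1 - th) D) //; last by rewrite divr_ge0 // ltW.
  by apply: gt0_ltr_powR => //; rewrite ?nnegrE ?powR_ge0 //; exact: truncnS_gt.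
apply/negP; rewrite -leNgt ler_pdivlMr // mulrC -(ler_pM2r (powR_gt0 th N0)) -mulrA -powRD.
  by rewrite subrK powRr1 ?lin_le // ltW.
by rewrite (gt_eqF N0) implybT.
Qed.

Section signed_sums.
Variables (r s : R) (T : (R -> R) -> (R -> R)) (x : useq R) (d : R).
Hypotheses (rs : conj_exp r s) (r2 : 2 < r) (bT : bounded_operator r s T).
Hypotheses (cx : concentrating U r x) (d0 : 0 < d).
Hypothesis Tx_large : \forall n \near U, d < normLp 1 (T (x n)).

Let Lp2 f : inLp r f -> inLp 2 f.
Proof. by apply: Lp_exp_le; rewrite ?ltW. Qed.

Lemma normLp2_operator_lin a f g : inLp r f -> inLp r g ->
  normLp 2 (T (a *: f + g)) ^+ 2 = normLp 2 (a *: T f + T g) ^+ 2.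
Proof.
move=> Lf Lg; have [LT _ _] := bT; have subL := Lp_subspace (gt1_ge0 (conj_exp_gt1 rs)).
have LT1 : inLp r (T (a *: f + g)) by apply: LT; exact: subL.2.
have LT2 : inLp r (a *: T f + T g) by apply: subL.2; exact: LT.
have T0 : normLp 2 (T (a *: f + g) - (a *: T f + T g)) = 0.
  apply/le_anti; rewrite normLp_ge0 andbT -(bounded_operator_lin rs a bT Lf Lg).
  by apply: normLp_exp_le => //; [exact: ltW|exact: subspaceB].
have c2 := @conj_exp2 R; have congr := pairing_congr c2 (Lp2 LT1) (Lp2 LT2) _ T0.
by rewrite !normLp2_sqr congr; [rewrite pairingC congr|]; try exact: Lp2.
Qed.

(* Sums of [N] almost disjoint signed terms have r-norm of order [N^(1/r)], whereas
   their images, if not null in L^1, have 2-norm at least of order [N^(1/2)]. *)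
Lemma exists_signed_sum : exists2 B, 0 < B & forall N : nat, exists u,
  [/\ inLp r u, normLp r u `^ r <= B * N%:R & d ^+ 2 * N%:R <= normLp 2 (T u) ^+ 2].
Proof.
have [C C0 incr] := concentrating_increment rs cx.
exists (C + 1) => [|N]; first by rewrite ltr_wpDl.
elim: N => [|N [u [Lu u_le Tu_ge]]].
  exists 0; split; first exact: Lp_cst.
    by rewrite mulr0 normLp0 // powR0 // gt_eqF.
  by rewrite mulr0 sqr_ge0.
have [n [Txn xn]] := filter_ex (filterI Tx_large (incr u Lu 1 ltr01)).
have Lx := cx.1.1 n; have [LT _ _] := bT; have [LTu LTx] := (LT _ Lu, LT _ Lx).
have [e e1 Te] := exists_sign_normLp2 (Lp2 LTu) (Lp2 LTx).
exists (u + e *: x n); split; first by apply: LpD => //; exact: LpZ.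
  apply: (le_trans (xn e _)); rewrite e1 // powR1 mulr1 -natr1 mulrDr mulr1.
  by rewrite addrA !lerD2r.
rewrite addrC normLp2_operator_lin // [_ *: _ + _]addrC; apply: le_trans Te.
rewrite -natr1 mulrDr mulr1 lerD // lerXn2r ?nnegrE ?(ltW d0) //.
apply: (le_trans (ltW Txn)); apply: normLp_exp_le => //; last exact: Lp2.
by rewrite ler1n.
Qed.

Lemma concentrating_images_false : False.
Proof.
have [B B0 sums] := exists_signed_sum.
have [C C0 TC] := bounded_operator_bound bT; have d20 : 0 < d ^+ 2 by rewrite exprn_gt0.
apply: (@linear_not_le_sublinear (d ^+ 2) (C ^+ 2 * B `^ (2 / r)) (2 / r)) => //.
- by rewrite mulr_ge0 ?sqr_ge0 ?powR_ge0.
- by rewrite ltr_pdivrMr // mul1r.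
move=> N; have [u [Lu u_le Tu_ge]] := sums N; apply: (le_trans Tu_ge).
have [LT _ _] := bT; have Tu_le : normLp 2 (T u) <= C * normLp r u.
  apply: le_trans (TC _ Lu); apply: normLp_exp_le => //; [exact: ltW|exact: LT].
rewrite -mulrA -powRM ?ler0n ?(ltW B0) //.
apply: (@le_trans _ _ ((C * normLp r u) ^+ 2)); first by rewrite lerXn2r ?nnegrE // mulr_ge0 // ltW.
rewrite exprMn ler_pM2l ?exprn_gt0 // -powR_mulrn //.
have -> : normLp r u `^ 2 = (normLp r u `^ r) `^ (2 / r).
  by rewrite -powRrM mulrC divfK // gt_eqF.
by apply: ler_powR2r u_le; rewrite ?powR_ge0 // divr_ge0 // ltW.
Qed.

End signed_sums.

Theorem concentrating_operator r s T x : conj_exp r s -> 2 < r -> bounded_operator r s T ->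
  concentrating U r x -> concentrating U r (fun n => T (x n)).
Proof.
move=> rs r2 bT cx; split; first exact: (bounded_seq_operator bT cx.1).
apply/cvgr0Pnorm_le => d d0.
have [//|large] := in_ultra_setVsetC [set n | `|normLp 1 (T (x n))| <= d] UF.
case: (concentrating_images_false rs r2 bT cx d0); apply: filterS large => n /= /negP.
by rewrite -ltNge ger0_norm.
Qed.

End concentration_preservation.

(** * Selective ultrafilters *)

(* One plus the largest element of [D] below [n], or [0] if there is none. *)
Definition last_before (D : set nat) (n : nat) : nat := (\max_(m < n | (m : nat) \in D) m.+1)%N.

Definition adapted (A : nat -> set nat) (D : set nat) : Prop :=
  forall n, D n -> A (last_before D n) n.

Section last_before.
Variable D : set nat.
Local Open Scope nat_scope.

Lemma last_before_gt m n : D m -> m < n -> m < last_before D n.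
Proof.
move=> Dm mn; apply: (@leq_bigmax_cond _ _ (fun i : 'I_n => i.+1) (Ordinal mn)).
exact/mem_set.
Qed.

Lemma last_before_le n : last_before D n <= n.
Proof. by apply/bigmax_leqP => i _. Qed.

Lemma last_before_attained n : 0 < last_before D n ->
  exists m, [/\ D m, m < n & last_before D n = m.+1].
Proof.
rewrite /last_before; elim/big_ind: _ => // [a b IHa IHb|i /set_mem Di _]; last by exists i.
by rewrite /maxn; case: ifP.
Qed.

Lemma last_beforeS n : last_before D n.+1 = if n \in D then n.+1 else last_before D n.
Proof.
rewrite /last_before big_mkcond big_ord_recr /= -big_mkcond /=.
case: ifP => _; last by rewrite maxn0.
by apply/maxn_idPr; rewrite (leq_trans (last_before_le n)).
Qed.

End last_before.

Section selection.
Context (U : set_system nat) {UF : UltraFilter U}.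
Hypothesis Usel : selective U.
Local Open Scope nat_scope.

Lemma finite_nat_bound (S : set nat) : finite_set S -> exists N, forall n, S n -> n < N.
Proof.
move=> /finite_seqP[s ->]; exists (\max_(i <- s) i).+1 => n /= ns.
by rewrite ltnS; exact: leq_bigmax_seq.
Qed.

Lemma selective_diagonal (A : nat -> set nat) : (forall k, U (A k)) ->
  exists2 B, U B & exists f : nat -> nat, forall k n, B n -> f k <= n -> A k n.
Proof.
move=> UA; have [B [UB Bfin]] := Usel.1 A UA; exists B => //.
have [f fP] := choice (fun k => finite_nat_bound (Bfin k)).
exists f => k n Bn fn; apply: contrapT => nA.
by have := fP k n (conj Bn nA); rewrite ltnNge fn.
Qed.

Lemma interval_index (e : nat -> nat) : e 0 = 0 -> {homo e : i j / i < j} ->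
  exists idx : nat -> nat, forall n, e (idx n) <= n < e (idx n).+1.
Proof.
move=> e0 e_incr.
suff /choice[idx idxP] : forall n, exists k, e k <= n < e k.+1 by exists idx.
elim=> [|n [k /andP[kn nk]]]; first by exists 0; have := e_incr 0 1 isT; rewrite e0.
have [->|nk'] := eqVneq n.+1 (e k.+1); first by exists k.+1; rewrite leqnn e_incr.
by exists k; rewrite (leq_trans kn) //= ltn_neqAle nk'.
Qed.

Lemma selective_transversal (e : nat -> nat) : e 0 = 0 -> {homo e : i j / i < j} ->
  exists idx : nat -> nat, (forall n, e (idx n) <= n < e (idx n).+1) /\
    exists2 C, U C & forall m n, C m -> C n -> m < n -> idx m < idx n.
Proof.
move=> e0 e_incr; have e_mono : {homo e : i j / i <= j} by exact: ltnW_homo.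
have [idx idxP] := interval_index e0 e_incr; exists idx; split=> //.
have [e_le lt_e] : (forall n, e (idx n) <= n) /\ forall n, n < e (idx n).+1.
  by split=> n; case/andP: (idxP n).
have idx_mono m n : m <= n -> idx m <= idx n.
  move=> mn; rewrite -ltnS ltnNge; apply/negP => /e_mono.
  by rewrite leqNgt (leq_ltn_trans (e_le m)) // (leq_ltn_trans mn).
have idx_e k : idx (e k) = k.
  apply/eqP; rewrite eqn_leq -[X in X <= _]/(idx _) leqNgt; apply/andP; split.
    by apply/negP => /e_incr; rewrite ltnNge e_le.
  by rewrite leqNgt; apply/negP => /e_mono; rewrite leqNgt lt_e.
have [||k l kl||C [UC CP]] := Usel.2 (fun k => idx @^-1` [set k]).
- move=> k; apply: (@sub_finite_set _ _ `I_(e k.+1)) => // n /= <-; exact: lt_e.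
- by move=> k; exists (e k); rewrite /= idx_e.
- by apply/seteqP; split=> // n [/= nk nl]; apply: kl; rewrite -nk.
- by apply/seteqP; split=> // n _; exists (idx n).
exists C => // m n Cm Cn mn; rewrite ltn_neqAle idx_mono ?andbT; last exact: ltnW.
apply/eqP => mn_eq; have [l Cl] := CP (idx n).
have [lm ln] : [set l] m /\ [set l] n by rewrite -Cl.
by rewrite lm ln ltnn in mn.
Qed.

(* Pick one point in each interval [e k, e k.+1), where [e] grows fast, and
   keep every other interval. *)
Lemma selective_sparse (F : nat -> nat) :
  exists2 D, U D & forall m n, D m -> D n -> m < n -> F m <= n.
Proof.
pose e := fix e i := if i is i'.+1 then (maxn (e i') (\max_(m < e i') F m)).+1 else 0.
have e_step i : e i < e i.+1 by rewrite /= ltnS leq_maxl.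
have F_e i m : m < e i -> F m <= e i.+1.
  move=> mi; rewrite /= leqW // leq_max; apply/orP; right.
  exact: (@leq_bigmax _ (fun m : 'I_(e i) => F m) (Ordinal mi)).
have e_incr : {homo e : i j / i < j} by apply: homo_ltn e_step => i j k; exact: ltn_trans.
have e_mono : {homo e : i j / i <= j} by exact: ltnW_homo.
have [idx [idxP [C UC C_incr]]] := selective_transversal (erefl : e 0 = 0) e_incr.
have [b Ub] : exists b, U [set n | odd (idx n) = b].
  have [Uo|Uo] := in_ultra_setVsetC [set n | odd (idx n)] UF; first by exists true.
  by exists false; apply: filterS Uo => n /= /negP/negbTE.
exists (C `&` [set n | odd (idx n) = b]); first exact: filterI.
move=> m n [Cm mb] [Cn nb] mn; have /andP[e_le _] := idxP n; have /andP[_ lt_e] := idxP m.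
have mn_idx2 : (idx m).+2 <= idx n.
  rewrite ltn_neqAle (C_incr m n) // andbT; apply/eqP => mn_eq.
  by move: mb nb => /= mb; rewrite -mn_eq /= mb; case: (b).
by apply: leq_trans e_le; apply: leq_trans (e_mono _ _ mn_idx2); exact: F_e.
Qed.

Lemma selective_adapted (A : nat -> set nat) : (forall m, U (A m)) -> exists2 D, U D & adapted A D.
Proof.
move=> UA; have [B UB [f fP]] := selective_diagonal UA.
have [D UD sparse] := selective_sparse (fun m => f m.+1).
pose E := D `&` B `&` A 0; exists E; first by apply: filterI => //; exact: filterI.
move=> n En; have [[Dn Bn] A0n] := En.
have [->//|] := posnP (last_before E n).
case/last_before_attained=> m [[[Dm _] _] mn ->].
by apply: fP => //; exact: sparse.
Qed.

End selection.

Lemma last_before_cvg (U : set_system nat) {UF : UltraFilter U} (D : set nat) :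
  nonprincipal U -> U D -> last_before D n @[n --> U] --> \oo.
Proof.
move=> Unp UD P [N _ NP]; have [m [Dm Nm]] := filter_ex (filterI UD (nonprincipal_near_ge Unp N)).
apply: filterS (nonprincipal_near_ge Unp m.+1) => n mn; apply: NP => /=.
by apply: leq_trans Nm (ltnW _); exact: last_before_gt.
Qed.

(** * Upper estimates *)

Definition upper_estimate {R : realType} (U : set_system nat) (r t : R) (x : useq R) : Prop :=
  exists2 A : nat -> set nat, (forall m, U (A m)) & forall D, adapted A D ->
    exists2 K : R, 0 <= K & forall (c : nat -> R) N, (forall i, ~ D i -> c i = 0) ->
      normLp r (\sum_(i < N) c i *: x i) <= K * (\sum_(i < N) `|c i| `^ t) `^ t^-1.

Section geometric_sums.
Context {R : realType}.
Implicit Types (D : set nat) (m n N : nat).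

Lemma half_expS n : 2^-1 ^+ n = 2 * 2^-1 ^+ n.+1 :> R.
Proof. by rewrite exprS mulrA mulfV ?mul1r. Qed.

Lemma half_exp_ge0 n : 0 <= 2^-1 ^+ n :> R.
Proof. by rewrite exprn_ge0. Qed.

Lemma half_exp_last_before D n : 2^-1 ^+ n <= 2^-1 ^+ last_before D n :> R.
Proof. by apply: ler_wiXn2l (last_before_le D n); lra. Qed.

Lemma sum_half_exp_last_before D n N : (n <= N)%N ->
  \sum_(n <= i < N | i \in D) 2^-1 ^+ last_before D i <=
  2 * 2^-1 ^+ last_before D n - 2 * 2^-1 ^+ last_before D N :> R.
Proof.
rewrite big_mkcond; elim: N => [|N IH]; first by rewrite leqn0 => /eqP ->; rewrite big_geq // subrr.
rewrite leq_eqVlt => /predU1P[->|]; first by rewrite big_geq // subrr.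
rewrite ltnS => nN; rewrite big_nat_recr //= last_beforeS; have {}IH := IH nN.
case: ifP => _; last by rewrite addr0.
by have := half_exp_last_before D N; rewrite (half_expS N); lra.
Qed.

Lemma sum_half_exp_le N : \sum_(i < N) 2^-1 ^+ i <= 2 :> R.
Proof.
suff : \sum_(i < N) 2^-1 ^+ i = 2 - 2 * 2^-1 ^+ N :> R by have := half_exp_ge0 N; lra.
elim: N => [|N IH]; first by rewrite big_ord0 expr0; lra.
by rewrite big_ord_recr /= IH (half_expS N); lra.
Qed.

End geometric_sums.

Lemma near_all_seq (U : set_system nat) {UF : Filter U} (T : eqType) (s : seq T)
  (P : T -> set nat) :
  (forall x, x \in s -> U (P x)) -> \forall n \near U, forall x, x \in s -> P x n.
Proof.
elim: s => [|y s IH] UP; first by apply: filterS filterT.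
have UPs : \forall n \near U, forall x, x \in s -> P x n.
  by apply: IH => x xs; apply: UP; rewrite in_cons xs orbT.
apply: filterS2 (UP y (mem_head _ _)) UPs => n Py Ps x.
by rewrite in_cons => /predU1P[->|/Ps].
Qed.

Lemma finite_rounding {R : realType} (i : nat) : exists s : seq R, exists rho : R -> R,
  forall c : R, `|c| <= 1 -> [/\ rho c \in s, `|rho c| <= `|c| & `|c - rho c| <= 2^-1 ^+ i].
Proof.
pose k (c : R) := Num.truncn (`|c| * 2 ^+ i).
pose rho (c : R) : R := Num.sg c * ((k c)%:R / 2 ^+ i).
exists [seq u * (j%:R / 2 ^+ i) | u <- [:: -1; 0; 1], j <- iota 0 (2 ^ i).+1], rho => c c1.
have k_le : (k c)%:R / 2 ^+ i <= `|c| by rewrite ler_pdivrMr // truncn_le mulr_ge0 // ltW.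
have k_gt : `|c| - (k c)%:R / 2 ^+ i <= 2^-1 ^+ i.
  rewrite lerBlDl exprVn -[X in _ + X]mul1r -mulrDl ler_pdivlMr // natr1.
  by rewrite ltW // truncnS_gt.
split.
- apply/allpairsP; exists (Num.sg c, k c); split=> //.
    by rewrite !inE; case: sgrP; rewrite eqxx ?orbT.
  rewrite [_.2]/(k c) mem_iota leq0n add0n ltnS -(ler_nat R) natrX.
  apply: (@le_trans _ _ (`|c| * 2 ^+ i)); first by rewrite truncn_le mulr_ge0 // ltW.
  by rewrite ler_piMl // ltW.
- by apply: le_trans k_le; rewrite /rho normrM normr_sg ger0_norm // ler_piMl // lern1 leq_b1.
have [->|c0] := eqVneq c 0; first by rewrite /rho sgr0 mul0r subr0 normr0 half_exp_ge0.
by rewrite /rho {1}(numEsg c) -mulrBr normrM normr_sg c0 mul1r ger0_norm // subr_ge0.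
Qed.

Section small_increments.
Context {R : realType} (U : set_system nat) {UF : UltraFilter U}.
Variables (r t : R) (x : useq R).
Hypotheses (r1 : 1 < r) (t0 : 0 < t) (bx : bounded_seq r x).
Implicit Types (c d : nat -> R) (D : set nat) (m n N : nat).

Let r0 : 0 < r. Proof. exact: lt_trans r1. Qed.
Let subLr : subspace (@inLp R r) := Lp_subspace (ltW r0).

Lemma Lp_sum c N : inLp r (\sum_(i < N) c i *: x i).
Proof. by apply: subspace_sum => // i; apply: subspaceZ => //; exact: bx.1. Qed.

Lemma normLp_sum_le c N M : (forall n, normLp r (x n) <= M) ->
  normLp r (\sum_(i < N) c i *: x i) <= \sum_(i < N) `|c i| * M.
Proof.
move=> xM; elim: N => [|N IH]; first by rewrite !big_ord0 normLp0.
have Lcx : inLp r (c N *: x N) by apply: subspaceZ => //; exact: bx.1.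
rewrite !big_ord_recr /= (le_trans (normLp_triangle (ltW r1) (Lp_sum _ _) Lcx)) // lerD //.
by rewrite normLpZ ?ler_wpM2l //; exact: bx.1.
Qed.

Lemma sum_supported D c m n : (forall i, ~ D i -> c i = 0) -> (last_before D n <= m <= n)%N ->
  \sum_(i < n) c i *: x i = \sum_(i < m) c i *: x i.
Proof.
move=> cD /andP[Dm mn]; rewrite -!(big_mkord xpredT (fun i => c i *: x i)).
rewrite (@big_cat_nat _ _ _ m) //= [X in _ + X]big_nat_cond [X in _ + X]big1 ?addr0 //.
move=> i /andP[/andP[mi iN] _]; rewrite cD ?scale0r // => Di.
by have := last_before_gt Di iN; rewrite ltnNge (leq_trans Dm).
Qed.

(* [s i] is a finite set of coefficients allowed for [x i]. *)
Variables (C : R) (s : nat -> seq R).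
Hypothesis C0 : 0 <= C.

Definition increment_bound (e : R) (a : R -> R) (n : nat) : Prop := forall c : R, `|c| <= 1 ->
  normLp r (a + c *: x n) `^ r <=
    normLp r a `^ r + C * `|c| `^ t * (1 + normLp r a `^ r) + e.

Definition controlled_increments (m : nat) : set nat :=
  [set n | forall c, (forall i, c i \in s i) ->
    increment_bound (2^-1 ^+ m) (\sum_(i < m) c i *: x i) n].

Hypothesis incr : forall a, inLp r a -> forall e : R, 0 < e ->
  \forall n \near U, increment_bound e a n.

Lemma near_controlled_increments m : \forall n \near U, controlled_increments m n.
Proof.
suff near_sum a e : inLp r a -> 0 < e -> \forall n \near U, forall c,
    (forall i, c i \in s i) -> increment_bound e (a + \sum_(i < m) c i *: x i) n.
  have := near_sum 0 (2^-1 ^+ m) (Lp_cst _ _); rewrite exprn_gt0 // => /(_ isT).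
  by apply: filterS => n xn c /xn; rewrite add0r.
elim: m a => [|m IH] a La e0.
  by apply: filterS (incr La e0) => n xn c _; rewrite big_ord0 addr0.
have : \forall n \near U, forall g, g \in s m -> forall c, (forall i, c i \in s i) ->
    increment_bound e (a + g *: x m + \sum_(i < m) c i *: x i) n.
  apply: near_all_seq => g _; apply: IH => //; apply: subspaceD => //.
  by apply: subspaceZ => //; exact: bx.1.
apply: filterS => n xn c cs; rewrite big_ord_recr /= [X in a + X]addrC addrA.
exact: xn (cs m) c cs.
Qed.

(* The quantity [1 + ||sum||^r] is multiplied at each index [i] of [D] by at most
   [1 + C |c i|^t + 2^-(last_before D i)], and the last terms are summable over [D]. *)
Lemma normLp_sum_le_expR D c N : adapted controlled_increments D -> (forall i, ~ D i -> c i = 0) ->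
  (forall i, c i \in s i) -> (forall i, `|c i| <= 1) ->
  1 + normLp r (\sum_(i < N) c i *: x i) `^ r <=
    expR (C * \sum_(i < N) `|c i| `^ t + (2 - 2 * 2^-1 ^+ last_before D N)).
Proof.
move=> aD cD cs c1; elim: N => [|N IH].
  rewrite !big_ord0 normLp0 // powR0 ?gt_eqF // mulr0 addr0 /last_before big_ord0 expr0.
  by rewrite add0r mulr1 subrr expR0.
rewrite !big_ord_recr /= last_beforeS; case: ifPn => [/set_mem DN|/negP ND]; last first.
  by rewrite cD ?normr0 ?powR0 ?gt_eqF // ?scale0r ?addr0 // => /mem_set.
have := aD N DN c cs (c N) (c1 N); have lN : (last_before D N <= last_before D N <= N)%N.
  by rewrite leqnn last_before_le.
rewrite -(sum_supported cD lN); move: IH.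
set W := normLp r (\sum_(i < N) _) `^ r; set W' := normLp r _ `^ r.
set S := \sum_(i < N) _; set w := `|c N| `^ t; set h := 2^-1 ^+ last_before D N => IH step.
have [W0 w0 h0] : [/\ 0 <= W, 0 <= w & 0 <= h] by split; rewrite ?powR_ge0 ?half_exp_ge0.
have exponent : C * S + (2 - 2 * h) + (C * w + h) <= C * (S + w) + (2 - 2 * 2^-1 ^+ N.+1).
  by have := @half_exp_last_before R D N; rewrite (half_expS N) -/h; lra.
rewrite -ler_expR in exponent; apply: le_trans exponent; rewrite expRD.
apply: (@le_trans _ _ ((1 + W) * (1 + (C * w + h)))).
  have := mulr_ge0 h0 W0; lra.
by apply: ler_pM IH (expR_ge1Dx _); rewrite addr_ge0 // addr_ge0 // mulr_ge0.
Qed.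

Hypothesis s_dense : forall i, exists rho : R -> R, forall c : R, `|c| <= 1 ->
  [/\ rho c \in s i, `|rho c| <= `|c| & `|c - rho c| <= 2^-1 ^+ i].

Lemma normLp_sum_bounded_coefficients D M c N : (forall n, normLp r (x n) <= M) ->
  adapted controlled_increments D -> (forall i, ~ D i -> c i = 0) -> (forall i, `|c i| <= 1) ->
  \sum_(i < N) `|c i| `^ t <= 1 ->
  normLp r (\sum_(i < N) c i *: x i) <= expR (C + 2) `^ r^-1 + 2 * M.
Proof.
move=> xM aD cD c1 c_sum; have [rho rhoP] := choice s_dense; pose d i := rho i (c i).
have d_c i : `|d i| <= `|c i| by have [] := rhoP i _ (c1 i).
have dD i : ~ D i -> d i = 0.
  move=> /cD ci; apply/normr0_eq0/le_anti.
  by rewrite normr_ge0 andbT (le_trans (d_c i)) // ci normr0.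
have -> : \sum_(i < N) c i *: x i = \sum_(i < N) d i *: x i + \sum_(i < N) (c i - d i) *: x i.
  by rewrite -big_split; apply: eq_bigr => i _ /=; rewrite -scalerDl addrC subrK.
have Lcd := Lp_sum (fun i => c i - d i) N.
apply: (le_trans (normLp_triangle (ltW r1) (Lp_sum d N) Lcd)); apply: lerD.
  rewrite -(powRKV r0 (normLp_ge0 _ _)) ler_powR2r ?powR_ge0 ?invr_ge0 ?(ltW r0) //.
  have d1 i : `|d i| <= 1 by apply: le_trans (c1 i).
  have := normLp_sum_le_expR N aD dD (fun i => let: And3 ds _ _ := rhoP i _ (c1 i) in ds) d1.
  have : expR (C * \sum_(i < N) `|d i| `^ t + (2 - 2 * 2^-1 ^+ last_before D N)) <= expR (C + 2).
    rewrite ler_expR lerD ?gerBl ?mulr_ge0 ?half_exp_ge0 // ler_piMr //.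
    by apply: le_trans c_sum; apply: ler_sum => i _; apply: ler_powR2r => //; exact: ltW.
  by have := powR_ge0 (normLp r (\sum_(i < N) d i *: x i)) r; lra.
have M0 : 0 <= M := le_trans (normLp_ge0 _ _) (xM 0%N).
apply: (le_trans (normLp_sum_le (fun i => c i - d i) N xM)); rewrite -mulr_suml ler_wpM2r //.
apply: le_trans (sum_half_exp_le N); apply: ler_sum => i _.
by have [] := rhoP i _ (c1 i).
Qed.

End small_increments.

Section upper_estimates.
Context {R : realType} (U : set_system nat) {UF : UltraFilter U}.
Implicit Types (x : useq R) (c : nat -> R) (K : R) (D : set nat) (N : nat).

Lemma upper_estimate_homogeneous (r t : R) x D K : 1 < r -> 0 < t -> bounded_seq r x -> 0 <= K ->
  (forall c N, (forall i, ~ D i -> c i = 0) -> (forall i, `|c i| <= 1) ->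
    \sum_(i < N) `|c i| `^ t <= 1 -> normLp r (\sum_(i < N) c i *: x i) <= K) ->
  forall c N, (forall i, ~ D i -> c i = 0) ->
    normLp r (\sum_(i < N) c i *: x i) <= K * (\sum_(i < N) `|c i| `^ t) `^ t^-1.
Proof.
move=> r1 t0 bx K0 bound c N cD.
set S := \sum_(i < N) `|c i| `^ t; have S0 : 0 <= S by apply: sumr_ge0 => i _; exact: powR_ge0.
pose l := S `^ t^-1; have lt : l `^ t = S by rewrite powRVK.
have c_le i : (i < N)%N -> `|c i| <= l.
  move=> iN; rewrite -(ler_pPowR2r t0) ?nnegrE ?powR_ge0 // lt /S (bigD1 (Ordinal iN)) //= lerDl.
  by apply: sumr_ge0 => j _; exact: powR_ge0.
have [l0|l0] := eqVneq l 0.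
  rewrite -/l l0 mulr0 big1 ?normLp0 // => i _; have := c_le i (ltn_ord i).
  by rewrite l0 normr_le0 => /eqP ->; rewrite scale0r.
have lp : 0 < l by rewrite lt_neqAle eq_sym l0 powR_ge0.
pose d i := if (i < N)%N then l^-1 * c i else 0.
have dE i : (i < N)%N -> `|d i| `^ t = S^-1 * `|c i| `^ t.
  by move=> iN; rewrite /d iN normrM powRM // gtr0_norm ?invr_gt0 // powRV ?ltW // lt.
have Sp : 0 < S by rewrite -lt powR_gt0.
have -> : \sum_(i < N) c i *: x i = l *: \sum_(i < N) d i *: x i.
  rewrite scaler_sumr; apply: eq_bigr => i _.
  by rewrite /d ltn_ord scalerA mulrA divff // mul1r.
rewrite normLpZ //; last exact: Lp_sum.
rewrite gtr0_norm // mulrC ler_pM2r //; apply: bound => [i /cD ci|i|].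
- by rewrite /d ci mulr0 if_same.
- case: (ltnP i N) => iN; last by rewrite /d ltnNge iN normr0.
  by rewrite /d iN normrM gtr0_norm ?invr_gt0 // ler_pdivrMl // mulr1 c_le.
rewrite (eq_bigr (fun i : 'I_N => S^-1 * `|c i| `^ t)) => [|i _]; last exact: dE.
by rewrite -mulr_sumr mulVf // gt_eqF.
Qed.

Lemma small_increments_upper_estimate (r t : R) x : 1 < r -> 0 < t -> bounded_seq r x ->
  small_increments U r t x -> upper_estimate U r t x.
Proof.
move=> r1 t0 bx [C C0 incr]; have [s s_dense] := choice (@finite_rounding R).
exists (controlled_increments r t x C s) => [m|D aD]; first exact: near_controlled_increments.
have [M M0 xM] := bounded_seq_bound bx; have K0 : 0 <= expR (C + 2) `^ r^-1 + 2 * M.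
  by rewrite addr_ge0 ?powR_ge0 // mulr_ge0 // ltW.
exists (expR (C + 2) `^ r^-1 + 2 * M) => //; apply: upper_estimate_homogeneous => // c N.
exact: (normLp_sum_bounded_coefficients r1 t0 bx C0 s_dense xM aD).
Qed.

Lemma weakly_null_upper_estimate (r s : R) x : conj_exp r s -> weakly_null U r s x ->
  upper_estimate U r (Num.min r 2) x.
Proof.
move=> rs wx; apply: small_increments_upper_estimate (wx.1) _ => //.
  by rewrite lt_min ltr0n andbT.
exact: (weakly_null_small_increments rs).
Qed.

Lemma concentrating_upper_estimate (r s : R) x : conj_exp r s -> concentrating U r x ->
  upper_estimate U r r x.
Proof.
move=> rs cx; apply: small_increments_upper_estimate (cx.1) _ => //.
exact: (concentrating_small_increments rs).
Qed.

Lemma upper_estimate_exp_le (r r' t : R) x : 1 < r -> r <= r' -> bounded_seq r' x ->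
  upper_estimate U r' t x -> upper_estimate U r t x.
Proof.
move=> r1 rr' bx [A UA HA]; exists A => // D /HA[K K0 HK]; exists K => // c N cD.
apply: le_trans (HK c N cD).
apply: normLp_exp_le => //; exact: (Lp_sum (lt_le_trans r1 rr') bx).
Qed.

End upper_estimates.

(** * Operators acting as rank one operators on the ultrapower *)

Lemma sum_off_diagonal_le {R : realType} (D : set nat) (a : nat -> R) n N : D n -> (n < N)%N ->
  (forall i, D i -> (i < n)%N -> a i <= 2^-1 ^+ last_before D n / (last_before D n).+1%:R) ->
  (forall i, D i -> (n < i)%N -> a i <= 2^-1 ^+ last_before D i) ->
  \sum_(i < N | ((i : nat) \in D) && ((i : nat) != n)) a i <= 2^-1 ^+ last_before D n + 2^-1 ^+ n.
Proof.
move=> Dn nN a_small a_large; set l := last_before D n.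
rewrite -(big_mkord (fun i => (i \in D) && (i != n)) a) (@big_cat_nat _ _ _ n) ?(ltnW nN) //=.
apply: lerD; last first.
  rewrite big_ltn_cond // eqxx andbF.
  apply: (@le_trans _ _ (\sum_(n.+1 <= i < N | i \in D) 2^-1 ^+ last_before D i)).
    rewrite [leLHS]big_nat_cond [leRHS]big_nat_cond [leLHS]big_mkcond [leRHS]big_mkcond.
    apply: ler_sum => i _; case: ifP => [/andP[/andP[ni iN] /andP[Di _]]|_].
      by rewrite ni iN Di a_large //; exact/set_mem.
    by case: ifP => _; rewrite ?half_exp_ge0.
  apply: (le_trans (sum_half_exp_last_before _ _)) => //.
  by rewrite last_beforeS mem_set // -half_expS gerBl mulr_ge0 ?half_exp_ge0.
apply: (@le_trans _ _ (\sum_(0 <= i < l) 2^-1 ^+ l / l.+1%:R)); last first.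
  rewrite sumr_const_nat subn0 -[leLHS]mulr_natr -mulrA ler_piMr ?half_exp_ge0 //.
  by rewrite ler_pdivrMl // mulr1 ler_nat.
rewrite (@big_cat_nat _ _ _ l) //=; last exact: last_before_le.
rewrite [X in _ + X]big_nat_cond [X in _ + X]big1 ?addr0; last first.
  move=> i /andP[/andP[li iN] /andP[/set_mem Di _]].
  by have := last_before_gt Di iN; rewrite ltnNge li.
rewrite [leLHS]big_nat_cond [leRHS]big_nat_cond [leLHS]big_mkcond [leRHS]big_mkcond.
apply: ler_sum => i _; case: ifP => [/andP[/andP[_ il] /andP[/set_mem Di _]]|_].
  by rewrite il a_small // (leq_trans il) // last_before_le.
by case: ifP => _ //; rewrite divr_ge0 ?half_exp_ge0 // ltW.
Qed.

Lemma normLp_weak_limit_le {R : realType} (U : set_system nat) {UF : UltraFilter U} (r s : R)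
    (x : useq R) f : conj_exp r s -> bounded_seq r x ->
  inLp r f -> (forall y, inLp s y -> pairing f y = ultrapair U x (fun=> y)) ->
  normLp r f <= ultranorm U r x.
Proof.
move=> rs bx Lf fE; apply: (normLp_le_dual rs) => // [|y Ly]; first exact: ultranorm_ge0.
rewrite fE // (le_trans (ler_norm _)) // -(ultranorm_cst (U := U)).
exact: (normr_ultrapair_le rs bx (bounded_seq_cst Ly)).
Qed.

Section block_operator.
Context {R : realType} (U : set_system nat) {UF : UltraFilter U}.
Hypothesis Unp : nonprincipal U.
Variables p q s s' : R.
Hypotheses (pq : conj_exp p q) (ss' : conj_exp s s').
Variables (g psi : useq R) (D : set nat) (K K' : R).
Hypotheses (bg : bounded_seq p g) (bpsi : bounded_seq q psi) (K0 : 0 <= K) (K'0 : 0 <= K').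
Hypothesis g_le : forall (c : nat -> R) N, (forall i, ~ D i -> c i = 0) ->
  normLp p (\sum_(i < N) c i *: g i) <= K * (\sum_(i < N) `|c i| `^ s) `^ s^-1.
Hypothesis psi_le : forall (c : nat -> R) N, (forall i, ~ D i -> c i = 0) ->
  normLp q (\sum_(i < N) c i *: psi i) <= K' * (\sum_(i < N) `|c i| `^ s') `^ s'^-1.
Implicit Types (f h x y : R -> R) (N n : nat).

Definition block_coef x (i : nat) : R := if i \in D then pairing x (psi i) else 0.

Definition block_sum x : useq R := fun N => \sum_(i < N) block_coef x i *: g i.

Let subLp : subspace (@inLp R p) := Lp_subspace (gt1_ge0 (conj_exp_gt1 pq)).
Let subLq : subspace (@inLp R q) := Lp_subspace (gt1_ge0 (conj_exp_gt1 (conj_expC pq))).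

Lemma block_coef_out x i : ~ D i -> block_coef x i = 0.
Proof. by rewrite /block_coef; case: ifP => // /set_mem. Qed.

Lemma block_sum_linear a f h : inLp p f -> inLp p h ->
  block_sum (a *: f + h) = a *: block_sum f + block_sum h.
Proof.
move=> Lf Lh; apply/funext => N; rewrite /block_sum.
rewrite -![(_ + _) N]/(_ + _) -![(_ *: _) N]/(_ *: _).
rewrite scaler_sumr -big_split; apply: eq_bigr => i _ /=; rewrite scalerA -scalerDl; congr (_ *: _).
rewrite /block_coef; case: ifP => _; last by rewrite mulr0 addr0.
by rewrite (pairing_linear_l pq (bpsi.1 i)).
Qed.

Lemma Lp_block_sum x N : inLp p (block_sum x N).
Proof. exact: (Lp_sum (conj_exp_gt1 pq) bg). Qed.

(* Hoelder duality between the coefficients in l^s and the upper s'-estimate of [psi]. *)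
Lemma block_coef_le x N : inLp p x ->
  (\sum_(i < N) `|block_coef x i| `^ s) `^ s^-1 <= K' * normLp p x.
Proof.
move=> Lx; set S := \sum_(i < N) _.
have S0 : 0 <= S by apply: sumr_ge0 => i _; exact: powR_ge0.
have [->|Sn0] := eqVneq S 0; first by rewrite powR0 ?invr_eq0 ?gt_eqF // mulr_ge0.
pose c i := spowR (s - 1) (block_coef x i).
have cD i : ~ D i -> c i = 0 by move=> nDi; rewrite /c block_coef_out // spowR0.
have cS : \sum_(i < N) `|c i| `^ s' = S by apply: eq_bigr => i _; exact: spowR_conj.
have SE : S = pairing x (\sum_(i < N) c i *: psi i).
  rewrite (linear_on_sum subLq (pairing_linear_r pq Lx)) => [|i]; last exact: bpsi.1.
  apply: eq_bigr => i _; rewrite -spowR_mul // -/(c i).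
  have [Di|/cD ->] := pselect (D i); last by rewrite !mul0r.
  by rewrite /block_coef mem_set.
have Sp : 0 < S `^ s'^-1 by rewrite powR_gt0 // lt_neqAle eq_sym Sn0.
rewrite -(ler_pM2r Sp) (powR_conj_exp ss') // {1}SE (le_trans (ler_norm _)) //.
have Lsum : inLp q (\sum_(i < N) c i *: psi i) by exact: (Lp_sum (conj_exp_gt1 (conj_expC pq))).
apply: (le_trans (normr_pairing_le pq Lx Lsum)); rewrite mulrC mulrAC ler_wpM2r //.
by rewrite -cS; exact: psi_le.
Qed.

Lemma normLp_block_sum_le x N : inLp p x -> normLp p (block_sum x N) <= K * K' * normLp p x.
Proof.
move=> Lx; apply: (le_trans (g_le _ (@block_coef_out x))).
by rewrite -mulrA ler_wpM2l // block_coef_le.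
Qed.

Lemma block_sum_bounded x : inLp p x -> bounded_seq p (block_sum x).
Proof.
move=> Lx; split=> [N|]; first exact: Lp_block_sum.
by exists (K * K' * normLp p x) => N; exact: normLp_block_sum_le.
Qed.

Lemma block_operator : exists2 T, bounded_operator p q T &
  forall x y, inLp p x -> inLp q y -> pairing (T x) y = ultrapair U (block_sum x) (fun=> y).
Proof.
have /choice[T TP] (x : R -> R) : exists f : R -> R, inLp p x -> inLp p f /\
    forall y, inLp q y -> pairing f y = ultrapair U (block_sum x) (fun=> y).
  have [Lx|nLx] := pselect (inLp p x); last by exists x.
  have [f Lf wf] := weak_limit pq (block_sum_bounded Lx); exists f => _; split=> // y Ly.
  have by_ := bounded_seq_cst Ly.
  have bf := bounded_seq_cst Lf.
  apply/esym/eqP; rewrite -subr_eq0 -(ultrapair_const wf Ly).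
  rewrite (linear_onB (ultrapair_linear_l pq by_)) //; last exact: block_sum_bounded.
  by rewrite ultrapair_cst.
have LT x : inLp p x -> inLp p (T x) by move=> /TP[].
have TE x y : inLp p x -> inLp q y -> pairing (T x) y = ultrapair U (block_sum x) (fun=> y).
  by move=> /TP[_]; exact.
exists T => //; split=> // [y Ly a f h Lf Lh|].
  have by_ := bounded_seq_cst Ly.
  rewrite !TE //; last exact: subLp.2.
  by rewrite block_sum_linear // (ultrapair_linear_l pq by_) //; exact: block_sum_bounded.
exists (K * K') => x Lx.
have bS := block_sum_bounded Lx.
apply: (le_trans (normLp_weak_limit_le pq bS (LT x Lx) (fun y => TE x y Lx))).
by apply: ultranorm_le => //; apply: nearW => N; exact: normLp_block_sum_le.
Qed.

Lemma block_operator_diagonal T h n G e : bounded_operator p q T ->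
  (forall x y, inLp p x -> inLp q y -> pairing (T x) y = ultrapair U (block_sum x) (fun=> y)) ->
  inLp p h -> D n -> (forall i, normLp p (g i) <= G) ->
  (forall N, (n < N)%N ->
    \sum_(i < N | ((i : nat) \in D) && ((i : nat) != n)) `|pairing h (psi i)| <= e) ->
  normLp p (T h - pairing h (psi n) *: g n) <= e * G.
Proof.
move=> [LT _ _] TE Lh Dn gG off_small; have bS := block_sum_bounded Lh.
pose d := pairing h (psi n) *: g n; have Ld : inLp p d by apply: subspaceZ => //; exact: bg.1.
have bd := bounded_seq_cst Ld.
have bounded_p := bounded_seq_subspace (ltW (conj_exp_gt1 pq)).
have bSd := subspaceB bounded_p bS bd.
apply: (le_trans (normLp_weak_limit_le pq bSd _ _)) => [|y Ly|].
- by apply: subspaceB => //; exact: LT.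
- have by_ := bounded_seq_cst Ly.
  rewrite (linear_onB (ultrapair_linear_l pq by_)) // -TE //.
  rewrite (linear_onB (pairing_linear_l pq Ly)) //; last exact: LT.
  by rewrite ultrapair_cst.
apply: ultranorm_le => //; apply: filterS (nonprincipal_near_ge Unp n.+1) => N nN.
pose c i := if (i \in D) && (i != n) then pairing h (psi i) else 0.
have -> : (block_sum h - (fun=> d)) N = \sum_(i < N) c i *: g i.
  have split_sum : block_sum h N = d + \sum_(i < N | i != Ordinal nN) block_coef h i *: g i.
    by rewrite /block_sum (bigD1 (Ordinal nN)) //= {1}/block_coef mem_set.
  rewrite -[LHS]/(block_sum h N - d) split_sum addrC addKr big_mkcond; apply: eq_bigr => i _.
  rewrite -val_eqE /c /=; case: (_ != n); last by rewrite andbF scale0r.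
  by rewrite andbT.
apply: (le_trans (normLp_sum_le (conj_exp_gt1 pq) bg c N gG)).
have G0 : 0 <= G := le_trans (normLp_ge0 _ _) (gG 0%N).
rewrite -mulr_suml ler_wpM2r // (le_trans _ (off_small N nN)) // [leRHS]big_mkcond.
by apply: ler_sum => i _; rewrite /c; case: ifP => // _; rewrite normr0.
Qed.

End block_operator.

Section rank_one.
Context {R : realType} (U : set_system nat) {UF : UltraFilter U}.
Hypotheses (Unp : nonprincipal U) (Usel : selective U).
Variables p q s s' : R.
Hypotheses (pq : conj_exp p q) (ss' : conj_exp s s').
Variables (k : nat) (hs : 'I_k -> useq R) (g psi : useq R).
Hypotheses (bg : bounded_seq p g) (g_upper : upper_estimate U p s g).
Hypotheses (wpsi : weakly_null U q p psi) (psi_upper : upper_estimate U q s' psi).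
Hypothesis whs : forall j, weakly_null U p q (hs j).

Definition almost_biorthogonal (m : nat) : set nat :=
  [set n | forall (j : 'I_k) (i : 'I_m),
    `|pairing (hs j n) (psi i)| <= 2^-1 ^+ m / m.+1%:R /\
    `|pairing (hs j i) (psi n)| <= 2^-1 ^+ m].

Lemma near_almost_biorthogonal m : \forall n \near U, almost_biorthogonal m n.
Proof.
apply: filter_forall => j; apply: filter_forall => i.
have e0 : 0 < 2^-1 ^+ m / m.+1%:R :> R by rewrite divr_gt0 // exprn_gt0.
have e'0 : 0 < 2^-1 ^+ m :> R by rewrite exprn_gt0.
have /cvgr0Pnorm_le/(_ _ e0) h0 := weakly_null_cvg (UF := UF) pq (whs j) (wpsi.1.1 i).
have /cvgr0Pnorm_le/(_ _ e'0) psi0 := weakly_null_cvg (UF := UF) (conj_expC pq) wpsi ((whs j).1.1 i).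
by apply: filterS2 h0 psi0 => n hn psin; rewrite [pairing (hs j i) _]pairingC.
Qed.

Lemma cvg_half_exp_last_before D : U D ->
  2^-1 ^+ last_before D n + 2^-1 ^+ n @[n --> U] --> (0 : R).
Proof.
move=> UD; have half0 : (fun n => 2^-1 ^+ n : R) @ \oo --> 0.
  by apply: cvg_expr; rewrite ger0_norm //; lra.
rewrite -(addr0 0); apply: cvgD; first exact: cvg_comp (last_before_cvg Unp UD) half0.
apply: cvg_comp half0 => P [N _ NP].
by apply: filterS (nonprincipal_near_ge Unp N) => n; exact: NP.
Qed.

Theorem exists_rank_one_operator : exists2 T, bounded_operator p q T & forall j,
  null_seq U p ((fun n => T (hs j n)) - ultrapair U (hs j) psi *: g).
Proof.
have [A UA g_le] := g_upper; have [B UB psi_le] := psi_upper.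
have UABC m : U (A m `&` B m `&` almost_biorthogonal m).
  by apply: filterI; [exact: filterI|exact: near_almost_biorthogonal].
have [D UD aD] := selective_adapted Usel UABC.
have [aA aB aC] : [/\ adapted A D, adapted B D & adapted almost_biorthogonal D].
  by split=> n /aD[[]].
have [K K0 gK] := g_le D aA; have [K' K'0 psiK'] := psi_le D aB.
have [T bT TE] := block_operator pq ss' bg wpsi.1 K0 K'0 gK psiK'.
exists T => // j; have bh := (whs j).1; have [G G0 gG] := bounded_seq_bound bg.
have bounded_p := bounded_seq_subspace (ltW (conj_exp_gt1 pq)).
set l := ultrapair U (hs j) psi; split.
  by apply: subspaceB => //; [exact: (bounded_seq_operator bT bh)|exact: subspaceZ].
pose err n : R := 2^-1 ^+ last_before D n + 2^-1 ^+ n.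
apply: (@cvg0_le _ _ _ _ _ (fun n => (err n + `|pairing (hs j n) (psi n) - l|) * G)); last first.
  rewrite -(mul0r G) -(addr0 0); apply: cvgMr_tmp; apply: cvgD; first exact: cvg_half_exp_last_before.
  by apply/norm_cvg0P/subr_cvg0; exact: (ultrapair_cvg pq bh wpsi.1).
apply: filterS UD => n Dn; rewrite ger0_norm //.
have [LT _ _] := bT; have LTh := LT _ (bh.1 n); have Lg := bg.1 n.
have Z c := LpZ c (gt1_ge0 (conj_exp_gt1 pq)) Lg.
have -> : ((fun n => T (hs j n)) - l *: g) n = T (hs j n) - pairing (hs j n) (psi n) *: g n +
    (pairing (hs j n) (psi n) - l) *: g n by rewrite scalerBl addrA subrK.
rewrite mulrDl (le_trans (normLp_triangle _ (LpB _ LTh (Z _)) (Z _))) // lerD //.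
  apply: (block_operator_diagonal Unp pq ss' bg wpsi.1 K0 K'0 gK psiK' bT TE) => // [|N nN].
    exact: bh.1.
  apply: (sum_off_diagonal_le (a := fun i => `|pairing (hs j n) (psi i)|)) => // i Di ni.
    exact: (aC n Dn j (Ordinal (last_before_gt Di ni))).1.
  exact: (aC i Di j (Ordinal (last_before_gt Dn ni))).2.
by rewrite normLpZ // ler_wpM2l.
Qed.

End rank_one.

(** * Duality of finite families *)

Section finite_families.
Context {K : fieldType} {V : lmodType K}.
Implicit Types (W : set V) (u v : V).

(* The functionals [e i] separate the points [w i] up to linear dependence: the matrix
   [e j (w i)] acts as the identity on all the vectors [e j u]. *)
Lemma dual_family k (e : 'I_k -> V -> K) W : subspace W -> (forall j, linear_on W (e j)) ->
  exists w : 'I_k -> V, (forall i, W (w i)) /\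
    forall j u, W u -> e j u = \sum_i e i u * e j (w i).
Proof.
move=> subW; elim: k e => [|k IH] e lin; first by exists (fun=> 0); split=> [i|[]//]; case: subW.
have [w [Ww wE]] := IH (fun i => e (lift ord0 i)) (fun i => lin (lift ord0 i)).
pose ext v (w' : 'I_k -> V) i := if unlift ord0 i is Some i' then w' i' else v.
have ext0 v w' : ext v w' ord0 = v by rewrite /ext unlift_none.
have extL v w' i : ext v w' (lift ord0 i) = w' i by rewrite /ext liftK.
have W_ext v w' : W v -> (forall i, W (w' i)) -> forall i, W (ext v w' i).
  by move=> Wv Ww' i; rewrite /ext; case: unlift.
pose tail u := \sum_i e (lift ord0 i) u *: w i.
have Wtail u : W (tail u) by apply: subspace_sum => // i; exact: subspaceZ.
have e_tail j u : e j (tail u) = \sum_i e (lift ord0 i) u * e j (w i).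
  exact: (linear_on_sum subW (lin j)).
have [dep|/existsNP[u /not_implyP[Wu /eqP u_free]]] :=
    pselect (forall u, W u -> e ord0 u = e ord0 (tail u)).
  exists (ext 0 w); split=> [|j u Wu]; first by apply: W_ext => //; case: subW.
  rewrite big_ord_recl ext0 (linear_on0 subW (lin j)) mulr0 add0r.
  under eq_bigr do rewrite extL; rewrite -e_tail.
  case: (unliftP ord0 j) => [i|] ->; last exact: dep.
  by rewrite e_tail; exact: wE.
pose c := e ord0 (u - tail u); pose v := c^-1 *: (u - tail u).
have Wut : W (u - tail u) by exact: subspaceB.
have Wv : W v by exact: subspaceZ.
have c0 : c != 0 by rewrite /c (linear_onB (lin _)) // subr_eq0.
have ev0 : e ord0 v = 1 by rewrite (linear_onZ subW (lin _)) // mulVf.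
have evL i : e (lift ord0 i) v = 0.
  by rewrite (linear_onZ subW (lin _)) // (linear_onB (lin _)) // e_tail -wE // subrr mulr0.
pose w' i := w i - e ord0 (w i) *: v; have Zv a : W (a *: v) by exact: subspaceZ.
have ew' j i : e j (w' i) = e j (w i) - e ord0 (w i) * e j v.
  by rewrite (linear_onB (lin j)) // (linear_onZ subW (lin j)).
exists (ext v w'); split=> [|j z Wz]; first by apply: W_ext => // i; exact: subspaceB.
rewrite big_ord_recl ext0; under eq_bigr do rewrite extL ew'.
case: (unliftP ord0 j) => [i|] ->.
  by rewrite evL mulr0 add0r wE //; apply: eq_bigr => i' _; rewrite mulr0 subr0.
by rewrite ev0 mulr1 big1 ?addr0 // => i _; rewrite mulr1 subrr mulr0.
Qed.

End finite_families.

Lemma subspace_bipolar {R : realType} k (W : set ('I_k -> R)) (v : 'I_k -> R) : subspace W ->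
  (forall a : 'I_k -> R, (forall u, W u -> \sum_i a i * u i = 0) -> \sum_i a i * v i = 0) -> W v.
Proof.
move=> subW v_polar; pose e (j : 'I_k) (u : 'I_k -> R) := u j.
have [|w [Ww wE]] := @dual_family _ _ _ e W subW; first by move=> j a u u' _ _.
suff -> : v = \sum_i v i *: w i by apply: subspace_sum => // i; exact: subspaceZ.
apply/funext => j; rewrite fct_sumE; apply/eqP; rewrite -subr_eq0; apply/eqP.
have := v_polar (fun i => (i == j)%:R - w i j).
have delta_sum (u : 'I_k -> R) : \sum_i ((i == j)%:R - w i j) * u i = u j - \sum_i u i * w i j.
  under eq_bigr do rewrite mulrBl; rewrite sumrB; congr (_ - _).
    by rewrite (bigD1 j) //= eqxx mul1r big1 ?addr0 // => i /negPf->; rewrite mul0r.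
  by apply: eq_bigr => i _; rewrite mulrC.
rewrite delta_sum; apply=> u Wu; rewrite delta_sum; apply/eqP; rewrite subr_eq0; apply/eqP.
exact: wE.
Qed.

(** * Functionals and operators on the ultrapower *)

Definition ultra_functional {R : realType} (U : set_system nat) (p : R) (phi : useq R -> R) :
    Prop :=
  linear_on (@bounded_seq R p) phi /\
  exists2 C : R, 0 <= C & forall x, bounded_seq p x -> `|phi x| <= C * ultranorm U p x.

Section ultrapower.
Context {R : realType} (U : set_system nat) {UF : UltraFilter U}.
Variables p q : R.
Hypothesis pq : conj_exp p q.
Implicit Types (x y z psi : useq R) (phi : useq R -> R) (S : useq R -> useq R).

Let bounded_p := bounded_seq_subspace (ltW (conj_exp_gt1 pq)).

Lemma UP_bounded_seq : @UP R p = bounded_seq p.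
Proof. by rewrite /UP Lp_inLp lpn_normLp. Qed.

Lemma ulimP (a : nat -> R) l : ulim U a l <-> a n @[n --> U] --> l.
Proof.
split=> [al|/cvgrPdist_lt al e e0].
  by apply/cvgrPdist_lt => e e0; apply: filterS (al e e0) => n; rewrite distrC.
by apply: filterS (al e e0) => n; rewrite /= distrC.
Qed.

Lemma unormP x l : unorm p U x l <-> normLp p (x n) @[n --> U] --> l.
Proof. by rewrite /unorm lpn_normLp; exact: ulimP. Qed.

Lemma unorm_ultranorm x l : bounded_seq p x -> unorm p U x l <-> ultranorm U p x = l.
Proof.
by move=> bx; split=> [/unormP/ultranormE//|<-]; apply/unormP; exact: ultranorm_cvg.
Qed.

Lemma ueqP x y : bounded_seq p x -> bounded_seq p y -> ueq p U x y <-> null_seq U p (x - y).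
Proof.
move=> bx by_; have bxy := subspaceB bounded_p bx by_.
by rewrite /ueq usubE; apply: iff_trans (unorm_ultranorm _ bxy) (iff_sym (null_seqP bxy)).
Qed.

Lemma Lhat_weakly_null : Lhat p U = weakly_null U p q.
Proof.
rewrite /Lhat UP_bounded_seq; apply/seteqP; split=> x [bx x0]; split=> //.
  move=> _ [y Ly <-]; apply/ultrapairE/ulimP; apply: (x0 (pairing^~ y)).
  apply/(LpDualP _ (gt1_ge0 (conj_exp_gt1 pq))); split; first exact: (pairing_linear_l pq).
  by exists (normLp q y) => f Lf; rewrite mulrC; exact: (normr_pairing_le pq).
move=> phi /(LpDualP _ (gt1_ge0 (conj_exp_gt1 pq))) /(riesz_representation pq)[g Lg phiE].
apply/ulimP; rewrite (_ : (fun n => phi (x n)) = fun n => pairing (x n) g).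
  by rewrite -(x0 (fun=> g)); [exact: (ultrapair_cvg pq bx (bounded_seq_cst Lg))|exists g].
by apply/funext => n; rewrite phiE //; exact: bx.1.
Qed.

Lemma Lconst_annihilator : Lconst p U = annihilator U p (weakly_null U q p).
Proof.
rewrite /Lconst UP_bounded_seq Lp_inLp; apply/seteqP; split=> x [bx].
  move=> [f [Lf /(ueqP bx (bounded_seq_cst Lf)) nxf]]; split=> // psi wpsi.
  rewrite -(null_seq_ultrapair (UF := UF) pq nxf wpsi.1).
  rewrite (linear_onB (ultrapair_linear_l pq wpsi.1)) //; last exact: bounded_seq_cst.
  by rewrite [X in _ - X]ultrapairC (ultrapair_const wpsi Lf) subr0.
move=> x0; have [f Lf wxf] := weak_limit (UF := UF) pq bx; split=> //; exists f; split=> //.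
apply/(ueqP bx (bounded_seq_cst Lf)); apply: (weakly_null_separated pq wxf) => psi wpsi.
rewrite (linear_onB (ultrapair_linear_l pq wpsi.1)) ?x0 //; last exact: bounded_seq_cst.
by rewrite ultrapairC (ultrapair_const wpsi Lf) subr0.
Qed.

Lemma ultra_functional_null phi x : ultra_functional U p phi -> null_seq U p x -> phi x = 0.
Proof.
move=> [_ [C _ phi_le]] nx; have bx := nx.1; apply/normr0_eq0/le_anti; rewrite normr_ge0 andbT.
by rewrite (le_trans (phi_le x bx)) // (null_seqP bx).1 // mulr0.
Qed.

Lemma ultra_functional_congr phi x y : ultra_functional U p phi -> bounded_seq p x ->
  bounded_seq p y -> null_seq U p (x - y) -> phi x = phi y.
Proof.
move=> Fphi bx by_ nxy; apply/eqP; rewrite -subr_eq0 -(linear_onB Fphi.1) //.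
by rewrite (ultra_functional_null Fphi nxy).
Qed.

Lemma UDualP phi : UDual p U phi <-> ultra_functional U p phi.
Proof.
rewrite /UDual UP_bounded_seq; split=> [[_ [phiD [phiZ [C phi_le]]]]|Fphi].
  split=> [a x y bx by_|].
    by rewrite -uaddE phiD -?uscaleE ?phiZ //; exact: (subspaceZ a bounded_p bx).
  exists `|C| => // x bx; apply: (@le_trans _ _ (C * ultranorm U p x)).
    by apply: phi_le => //; exact/unorm_ultranorm.
  by rewrite ler_wpM2r ?ultranorm_ge0 // ler_norm.
have [lin [C _ phi_le]] := Fphi; do !split.
- by move=> x y bx by_ /(ueqP bx by_); exact: ultra_functional_congr.
- by move=> x y bx by_; rewrite uaddE (linear_onD lin).
- by move=> a x bx; rewrite uscaleE (linear_onZ bounded_p lin).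
- by exists C => x a bx /(unorm_ultranorm _ bx) <-; exact: phi_le.
Qed.

Lemma ultra_functional_ultrapair psi : bounded_seq q psi ->
  ultra_functional U p (ultrapair U ^~ psi).
Proof.
move=> bpsi; split; first exact: (ultrapair_linear_l pq).
exists (ultranorm U q psi) => [|x bx]; first exact: ultranorm_ge0.
by rewrite mulrC; exact: (normr_ultrapair_le pq).
Qed.

Lemma ultra_functional_sum (k : nat) (a : 'I_k -> R) (phi : 'I_k -> useq R -> R) :
  (forall j, ultra_functional U p (phi j)) -> ultra_functional U p (fun x => \sum_j a j * phi j x).
Proof.
move=> Fphi; split=> [b x y bx by_|].
  rewrite mulr_sumr -big_split; apply: eq_bigr => j _ /=.
  by rewrite (Fphi j).1 // mulrDr mulrCA.
have /choice[C C_le] j : exists C, 0 <= C /\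
    forall x, bounded_seq p x -> `|phi j x| <= C * ultranorm U p x.
  by have [_ [C C0 phi_le]] := Fphi j; exists C.
exists (\sum_j `|a j| * C j) => [|x bx].
  by apply: sumr_ge0 => j _; rewrite mulr_ge0 //; exact: (C_le j).1.
rewrite mulr_suml (le_trans (ler_norm_sum _ _ _)) //; apply: ler_sum => j _.
by rewrite normrM -mulrA ler_wpM2l //; exact: (C_le j).2.
Qed.

Lemma ultra_functional_eq0_of_dense phi (G : set (useq R)) x : ultra_functional U p phi ->
  G `<=` bounded_seq p -> bounded_seq p x -> (forall g, G g -> phi g = 0) ->
  (forall d, 0 < d -> exists2 g, G g & ultranorm U p (x - g) <= d) -> phi x = 0.
Proof.
move=> [lin [C C0 phi_le]] bG bx phiG x_dense; apply/normr0_eq0/le_anti; rewrite normr_ge0 andbT.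
apply/ler_addgt0Pr => e e0; rewrite add0r; have C1 : 0 < C + 1 by rewrite ltr_wpDl.
have [g Gg xg] := x_dense _ (divr_gt0 e0 C1); have bxg := subspaceB bounded_p bx (bG _ Gg).
have -> : phi x = phi (x - g) by rewrite (linear_onB lin) ?(phiG g Gg) ?subr0 //; exact: bG.
apply: (le_trans (phi_le _ bxg)); apply: (@le_trans _ _ ((C + 1) * (e / (C + 1)))).
  by apply: ler_pM; rewrite ?ultranorm_ge0 // lerDl.
by rewrite mulrC divfK // gt_eqF.
Qed.

Definition ultra_operator S : Prop :=
  (forall x, bounded_seq p x -> bounded_seq p (S x)) /\
  forall phi, ultra_functional U p phi -> ultra_functional U p (phi \o S).

Lemma ultra_operator_of_congr S C : (forall x, bounded_seq p x -> bounded_seq p (S x)) ->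
  (forall a x y, bounded_seq p x -> bounded_seq p y ->
    null_seq U p (S (a *: x + y) - (a *: S x + S y))) ->
  (forall x, bounded_seq p x -> ultranorm U p (S x) <= C * ultranorm U p x) -> ultra_operator S.
Proof.
move=> bS S_lin S_le; split=> // phi Fphi; have [lin [C' C'0 phi_le]] := Fphi.
split=> [a x y bx by_ /=|].
  have [bSx bSy] := (bS _ bx, bS _ by_).
  rewrite -lin //; apply: (ultra_functional_congr Fphi) (S_lin a x y bx by_).
    by apply: bS; exact: bounded_p.2.
  exact: bounded_p.2.
exists (C' * `|C|) => [|x bx /=]; first exact: mulr_ge0.
rewrite -mulrA (le_trans (phi_le _ (bS _ bx))) // ler_wpM2l // (le_trans (S_le x bx)) //.
by rewrite ler_wpM2r ?ultranorm_ge0 // ler_norm.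
Qed.

Lemma UOp_ultra_operator S : UOp p U S -> ultra_operator S.
Proof.
rewrite /UOp UP_bounded_seq => -[bS [_ [SD [SZ [C S_le]]]]].
apply: (@ultra_operator_of_congr _ C) => // [a x y bx by_|x bx]; last first.
  by apply: (S_le x) => //; apply/unorm_ultranorm => //; exact: bS.
have bax : bounded_seq p (a *: x) by exact: subspaceZ.
have [bSx bSy bSax] := And3 (bS _ bx) (bS _ by_) (bS _ bax).
have baSx : bounded_seq p (a *: S x) by exact: subspaceZ.
have sumS := bounded_p.2 1 _ _ bSax bSy; rewrite scale1r in sumS.
have /(ueqP (bS _ (bounded_p.2 a _ _ bx by_)) sumS) := SD _ _ bax by_.
have /(ueqP bSax baSx) := SZ a x bx; move=> nZ nD.
have -> : S (a *: x + y) - (a *: S x + S y) =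
    S (a *: x + y) - (S (a *: x) + S y) + (S (a *: x) - a *: S x).
  by rewrite -addrA; congr (_ + _); rewrite !opprD addrACA addNr add0r addrC.
by apply: subspaceD => //; exact: vanishing_subspace.
Qed.

Lemma ultraop_ultra_operator T : bounded_operator p q T -> ultra_operator (ultraop T).
Proof.
move=> bT; have [C C0 T_le] := bounded_operator_bound bT; have [LT _ _] := bT.
have bTx x : bounded_seq p x -> bounded_seq p (ultraop T x) := bounded_seq_operator bT.
apply: (@ultra_operator_of_congr _ C) => // [a x y bx by_|x bx]; last first.
  apply: (ler_cvg_to (ultranorm_cvg (bTx x bx)) (cvgMl_tmp (ultranorm_cvg bx))).
  by apply: nearW => n; exact: T_le (bx.1 n).
split.
  apply: subspaceB => //; first by apply: bTx; exact: bounded_p.2.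
  by apply: bounded_p.2; exact: bTx.
rewrite (_ : (fun n => _) = fun=> 0); first exact: cvg_cst.
apply/funext => n; exact: (bounded_operator_lin pq a bT (bx.1 n) (by_.1 n)).
Qed.

Lemma ultraop_annihilator T N x : bounded_operator p q T -> N `<=` bounded_seq q ->
  (forall T' psi, bounded_operator q p T' -> N psi -> N (ultraop T' psi)) ->
  annihilator U p N x -> annihilator U p N (ultraop T x).
Proof.
move=> bT bN NT [bx xN]; split=> [|psi Npsi]; first exact: (bounded_seq_operator bT bx).
have [T' bT' TT'] := adjoint_operator pq bT; rewrite -(xN _ (NT T' psi bT' Npsi)) /ultrapair.
by congr (lim (_ @ U)); apply/funext => n; apply: TT' (bx.1 n) ((bN _ Npsi).1 n).
Qed.

Lemma ultraop_weakly_null T x : bounded_operator p q T -> weakly_null U p q x ->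
  weakly_null U p q (ultraop T x).
Proof.
move=> bT; apply: (ultraop_annihilator bT (@constants_bounded R q)) => T' _ [LT' _ _] [y Ly <-].
by exists (T' y); first exact: LT'.
Qed.

End ultrapower.

(** * Invariance under the closure *)

Definition determines_WOT_closure {R : realType} (p : R) (U : set_system nat) (M : set (useq R)) :
    Prop := forall S, UOp p U S -> (WOT_closure_ultraops p U S <->
  uinvariant S (Lconst p U) /\ uinvariant S (Lhat p U) /\ uinvariant S M).

Section closure.
Context {R : realType} (U : set_system nat) {UF : UltraFilter U}.
Variables p q : R.
Hypothesis pq : conj_exp p q.
Implicit Types (x y psi : useq R) (S : useq R -> useq R) (T : (R -> R) -> R -> R).
Implicit Types (M N : set (useq R)).

Let bounded_p := bounded_seq_subspace (ltW (conj_exp_gt1 pq)).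

Lemma WOT_closure_annihilator S N : UOp p U S -> WOT_closure_ultraops p U S ->
  N `<=` bounded_seq q ->
  (forall T x, bounded_operator p q T -> annihilator U p N x -> annihilator U p N (ultraop T x)) ->
  uinvariant S (annihilator U p N).
Proof.
move=> oS wS bN TN x Nx; have [bS _] := UOp_ultra_operator (UF := UF) pq oS.
split=> [|psi Npsi]; first exact: bS Nx.1.
apply/normr0_eq0/le_anti; rewrite normr_ge0 andbT; apply/ler_addgt0Pr => e e0; rewrite add0r.
have [|_|T [/(LpOpP pq) bT T_near]] := wS 1%N (fun=> x) (fun=> ultrapair U ^~ psi) e e0.
- by rewrite UP_bounded_seq => _; exact: Nx.1.
- by apply/(UDualP pq)/(ultra_functional_ultrapair pq); exact: bN.
by have := T_near ord0; rewrite (TN T x bT Nx).2 // subr0 => /ltW.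
Qed.

Lemma annihilator_usubspace N : N `<=` bounded_seq q -> usubspace p U (annihilator U p N).
Proof.
move=> bN; have subN := annihilator_subspace (UF := UF) pq bN; rewrite /usubspace UP_bounded_seq.
split; first by move=> x [].
split; last first.
  by split; [case: subN|split=> [x y|a x]; [exact: subspaceD|exact: subspaceZ]].
move=> x y Nx by_ /(ueqP pq Nx.1 by_) nxy; rewrite -[y](subKr x); apply: subspaceB => //.
exact: (null_seq_annihilator pq bN) nxy.
Qed.

Lemma annihilator_uclosed N : N `<=` bounded_seq q -> uclosed p U (annihilator U p N).
Proof.
move=> bN x; rewrite UP_bounded_seq => bx x_approx; apply: (annihilator_closed pq) => // e.
move=> /x_approx[y [r [Ny [xyr re]]]]; exists y => //.
have bxy : bounded_seq p (x - y) by apply: subspaceB => //; exact: Ny.1.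
by rewrite ((unorm_ultranorm _ bxy).1 xyr) ltW.
Qed.

Lemma annihilatorU r N N' : annihilator U r (N `|` N') = annihilator U r N `&` annihilator U r N'.
Proof.
apply/seteqP; split=> [x [bx x0]|x [[bx xN] [_ xN']]].
  by split; split=> // y Ny; apply: x0; [left|right].
by split=> // y []; [exact: xN|exact: xN'].
Qed.

(* The projection exists pointwise; it is well defined modulo null sequences because
   [M] and its complement meet in null sequences only. *)
Lemma complemented_of_splitting (M C : set (useq R)) : subspace M -> subspace C ->
  M `<=` weakly_null U p q -> null_seq U p `<=` C -> M `&` C `<=` null_seq U p ->
  (forall x, weakly_null U p q x -> exists y,
     [/\ M y, C (x - y) & ultranorm U p y <= ultranorm U p x]) ->
  complemented_in p U (Lhat p U) M.
Proof.
move=> subM subC Mw nullC MC splits; have subw := weakly_null_subspace (UF := UF) pq.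
have bM x : M x -> bounded_seq p x by move=> /Mw[].
have uniq x u v : M u -> M v -> C (x - u) -> C (x - v) -> ueq p U u v.
  move=> Mu Mv Cu Cv; apply/(ueqP pq (bM _ Mu) (bM _ Mv)); apply: MC; split; first exact: subspaceB.
  have -> : u - v = (x - v) - (x - u) by rewrite opprB [RHS]addrC addrA subrK.
  exact: subspaceB.
have /choice[P PP] x : exists y, weakly_null U p q x ->
    [/\ M y, C (x - y) & ultranorm U p y <= ultranorm U p x].
  have [/splits[y yP]|nwx] := pselect (weakly_null U p q x); first by exists y.
  by exists x.
rewrite /complemented_in (Lhat_weakly_null pq); exists P.
split; last split; last split; last split; last split.
- by move=> x /PP[].
- move=> x y wx wy /(ueqP pq wx.1 wy.1) nxy; have [Px Cx _] := PP x wx; have [Py Cy _] := PP y wy.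
  apply: (uniq x) => //; rewrite -(subrK y x) -addrA; apply: subspaceD => //; exact: nullC.
- move=> x y wx wy; have [Px Cx _] := PP x wx; have [Py Cy _] := PP y wy.
  have [Pxy Cxy _] := PP _ (subspaceD subw wx wy).
  apply: (uniq (x + y)) => //; first exact: (subspaceD subM Px Py).
  by rewrite uaddE opprD addrACA; exact: subspaceD.
- move=> a x wx; have [Px Cx _] := PP x wx; have [Pax Cax _] := PP _ (subspaceZ a subw wx).
  apply: (uniq (a *: x)) => //; first exact: (subspaceZ a subM Px).
  by rewrite uscaleE -scalerBr; exact: subspaceZ.
- exists 1 => x a b wx /(unorm_ultranorm _ wx.1) <-; have [Px _ Px_le] := PP x wx.
  by move=> /(unorm_ultranorm _ (bM _ Px)) <-; rewrite mul1r.
- move=> m Mm; have [Pm Cm _] := PP m (Mw _ Mm).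
  by apply: (uniq m) => //; rewrite subrr; case: subC.
Qed.

End closure.

(** * Operators in the weak operator closure *)

Definition compatible_estimates {R : realType} (U : set_system nat) (p q : R) (g psi : useq R) :
    Prop :=
  exists s s', [/\ conj_exp s s', upper_estimate U p s g & upper_estimate U q s' psi].

Section density.
Context {R : realType} (U : set_system nat) {UF : UltraFilter U}.
Hypotheses (Unp : nonprincipal U) (Usel : selective U).
Variables p q : R.
Hypothesis pq : conj_exp p q.
Implicit Types (x y z g psi : useq R) (A S : useq R -> useq R) (T : (R -> R) -> R -> R).

Let bounded_p := bounded_seq_subspace (ltW (conj_exp_gt1 pq)).
Let subLp : subspace (@inLp R p) := Lp_subspace (gt1_ge0 (conj_exp_gt1 pq)).
Let subLq : subspace (@inLp R q) := Lp_subspace (gt1_ge0 (conj_exp_gt1 (conj_expC pq))).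
Let null_p : subspace (null_seq U p) := vanishing_subspace (ltW (conj_exp_gt1 pq)) (lexx p).

Lemma null_seq_cst (f : R -> R) : inLp p f -> normLp p f = 0 -> null_seq U p (fun=> f).
Proof. by move=> Lf f0; split; [exact: bounded_seq_cst|rewrite f0; exact: cvg_cst]. Qed.

Lemma rank_one_constant x (f g : R -> R) : bounded_seq p x -> inLp q f -> inLp p g ->
  null_seq U p ((fun n => pairing (x n) f *: g) - ultrapair U x (fun=> f) *: (fun=> g)).
Proof.
move=> bx Lf Lg; have bg := bounded_seq_cst Lg; set l := ultrapair U x _.
have bT := bounded_seq_operator (rank_one_operator pq Lg Lf) bx.
split; first by apply: subspaceB => //; exact: subspaceZ.
rewrite (_ : (fun n => _) = fun n => `|pairing (x n) f - l| * normLp p g).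
  rewrite -(mul0r (normLp p g)); apply: cvgMr_tmp.
  by apply/norm_cvg0P/subr_cvg0; exact: (ultrapair_cvg pq bx (bounded_seq_cst Lf)).
by apply/funext => n; rewrite -normLpZ // scalerBl.
Qed.

Lemma finite_rank_constants k (f g : 'I_k -> R -> R) x : bounded_seq p x ->
  (forall i, inLp q (f i)) -> (forall i, inLp p (g i)) ->
  null_seq U p (ultraop (fun h => \sum_i pairing h (f i) *: g i) x -
    \sum_i ultrapair U x (fun=> f i) *: (fun=> g i)).
Proof.
move=> bx Lf Lg; rewrite (_ : _ - _ = \sum_i ((fun n => pairing (x n) (f i) *: g i) -
    ultrapair U x (fun=> f i) *: (fun=> g i))).
  by apply: subspace_sum => // i; exact: rank_one_constant.
by rewrite sumrB; congr (_ - _); apply/funext => n; rewrite fct_sumE.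
Qed.

Lemma finite_biorthogonal k (f : 'I_k -> R -> R) : (forall i, inLp p (f i)) ->
  exists2 y : 'I_k -> R -> R, forall i, inLp q (y i) &
    forall j, null_seq U p ((fun=> f j) - \sum_i pairing (f j) (y i) *: (fun=> f i)).
Proof.
move=> Lf; have [y [Ly yE]] := dual_family subLq (fun j => pairing_linear_r pq (Lf j)).
exists y => // j; have Lsum : inLp p (\sum_i pairing (f j) (y i) *: f i).
  by apply: subspace_sum => // i; exact: subspaceZ.
rewrite (_ : _ - _ = fun=> f j - \sum_i pairing (f j) (y i) *: f i); last first.
  by apply/funext => n; rewrite -[LHS]/(f j - (\sum_i _) n) fct_sumE.
apply: null_seq_cst; first exact: subspaceB.
apply: (normLp_sub_eq0 pq) => // z Lz; rewrite (linear_on_sum subLp (pairing_linear_l pq Lz)) //.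
by rewrite yE //; apply: eq_bigr => i _; rewrite mulrC.
Qed.

Variables (N M0 : set (useq R)).
Local Notation M := (annihilator U p (constants q `|` N)).
Hypotheses (subN : subspace N) (wN : N `<=` weakly_null U q p).
Hypothesis compatible_N : forall psi g, N psi -> weakly_null U p q g ->
  compatible_estimates U p q g psi.
Hypothesis M0_M : M0 `<=` M.
Hypothesis M0_dense : forall x, M x -> forall d : R, 0 < d ->
  exists2 g, M0 g & ultranorm U p (x - g) <= d.
Hypothesis compatible_M0 : forall psi g, weakly_null U q p psi -> M0 g ->
  compatible_estimates U p q g psi.
Hypothesis operator_M : forall T x, bounded_operator p q T -> M x -> M (ultraop T x).

Section trace.
Variables (k : nat) (phi : 'I_k -> useq R -> R).
Hypothesis Fphi : forall j, ultra_functional U p (phi j).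

Definition trace_zero (x : 'I_k -> useq R) : Prop :=
  forall T, bounded_operator p q T -> \sum_j phi j (ultraop T (x j)) = 0.

Lemma trace_rank_one (h : 'I_k -> useq R) g psi : (forall j, weakly_null U p q (h j)) ->
  trace_zero h -> bounded_seq p g -> weakly_null U q p psi -> compatible_estimates U p q g psi ->
  \sum_j ultrapair U (h j) psi * phi j g = 0.
Proof.
move=> wh h0 bg wpsi [s [s' [ss' ug upsi]]].
have [T bT Th] := exists_rank_one_operator Unp Usel pq ss' bg ug wpsi upsi wh.
rewrite -[RHS](h0 T bT); apply: eq_bigr => j _.
rewrite -(linear_onZ bounded_p (Fphi j).1) //; apply/esym.
apply: (ultra_functional_congr (Fphi j) _ _ (Th j)); last exact: subspaceZ.
exact: (bounded_seq_operator bT (wh j).1).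
Qed.

(* Subtracting a suitable combination of the [h i] makes [h j] orthogonal to [W]; the
   trace does not change because [\sum_j <h j, w> phi j] vanishes on [G]. *)
Lemma trace_reduction (h : 'I_k -> useq R) (W G : set (useq R)) : subspace W ->
  W `<=` bounded_seq q -> (forall j, bounded_seq p (h j)) ->
  (forall w g, W w -> G g -> \sum_j ultrapair U (h j) w * phi j g = 0) ->
  exists h' : 'I_k -> useq R,
  [/\ forall V, subspace V -> (forall i, V (h i)) -> forall j, V (h' j),
      forall j w, W w -> ultrapair U (h' j) w = 0 &
      forall A, ultra_operator U p A -> (forall i, G (A (h i))) ->
        \sum_j phi j (A (h' j)) = \sum_j phi j (A (h j))].
Proof.
move=> subW bW bh trG.
have [|w [Ww wE]] := @dual_family _ _ k (fun j w => ultrapair U (h j) w) W subW.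
  by move=> j a u v Wu Wv; apply: (ultrapair_linear_r pq (bh j)); exact: bW.
exists (fun j => h j - \sum_i ultrapair U (h j) (w i) *: h i).
have bc j : bounded_seq p (\sum_i ultrapair U (h j) (w i) *: h i).
  by apply: subspace_sum => // i; exact: subspaceZ.
split=> [V subV Vh j|j u Wu|A [bA FA] GA].
- by apply: subspaceB => //; apply: subspace_sum => // i; exact: subspaceZ.
- have lin := ultrapair_linear_l (UF := UF) pq (bW _ Wu).
  rewrite (linear_onB lin) // (linear_on_sum bounded_p lin) // wE //.
  by under eq_bigr do rewrite mulrC; rewrite subrr.
have phiA j := (FA _ (Fphi j)).1.
under eq_bigr => j _ do rewrite -[phi j _]/((phi j \o A) _) (linear_onB (phiA j)) //
  (linear_on_sum bounded_p (phiA j)) //.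
rewrite sumrB exchange_big /= [X in _ - X]big1 ?subr0 // => i _.
exact: trG.
Qed.

Definition preserves_constants A : Prop := forall f : R -> R, inLp p f ->
  exists2 g : R -> R, inLp p g & null_seq U p (A (fun=> f) - (fun=> g)).

Lemma trace_constants (x : 'I_k -> useq R) (f : 'I_k -> R -> R) A : trace_zero x ->
  (forall j, inLp p (f j)) -> (forall j, weakly_null U p q (x j - (fun=> f j))) ->
  ultra_operator U p A -> preserves_constants A -> \sum_j phi j (A (fun=> f j)) = 0.
Proof.
move=> x0 Lf wx [bA FA] cA; have [y Ly f_eq] := finite_biorthogonal Lf.
have bcf j := bounded_seq_cst (Lf j).
have [g Lg nAg] : exists2 g : 'I_k -> R -> R, forall i, inLp p (g i) &
    forall i, null_seq U p (A (fun=> f i) - (fun=> g i)).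
  have /choice[g gP] i : exists g : R -> R, inLp p g /\ null_seq U p (A (fun=> f i) - (fun=> g)).
    by have [g Lg ng] := cA _ (Lf i); exists g.
  by exists g => i; have [] := gP i.
have bcg i := bounded_seq_cst (Lg i).
rewrite -[RHS](x0 _ (finite_rank_operator pq Lg Ly)); apply: eq_bigr => j _.
have bx : bounded_seq p (x j).
  by rewrite -[x j](subrK (fun=> f j)); apply: subspaceD => //; exact: (wx j).1.
have xy i : ultrapair U (x j) (fun=> y i) = pairing (f j) (y i).
  have bxf := (wx j).1; have lin := ultrapair_linear_l (UF := UF) pq (bounded_seq_cst (Ly i)).
  rewrite -[x j](subrK (fun=> f j)) (linear_onD lin) // (ultrapair_const (wx j)) // add0r.
  exact: ultrapair_cst.
transitivity (\sum_i pairing (f j) (y i) * phi j (A (fun=> f i))).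
  rewrite -(linear_on_sum bounded_p (FA _ (Fphi j)).1) //.
  apply: (ultra_functional_congr (FA _ (Fphi j)) _ _ (f_eq j)) => //.
  by apply: subspace_sum => // i; exact: subspaceZ.
rewrite (eq_bigr (fun i => ultrapair U (x j) (fun=> y i) * phi j (fun=> g i)))
    => [|i _]; last first.
  by rewrite xy; congr (_ * _); apply: (ultra_functional_congr (Fphi j)) (nAg i) => //; exact: bA.
rewrite -(linear_on_sum bounded_p (Fphi j).1) //; apply/esym/(ultra_functional_congr (Fphi j)).
- exact: (bounded_seq_operator (finite_rank_operator pq Lg Ly)).
- by apply: subspace_sum => // i; exact: subspaceZ.
exact: finite_rank_constants.
Qed.

Lemma trace_weakly_null (h : 'I_k -> useq R) A : (forall j, weakly_null U p q (h j)) ->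
  trace_zero h -> ultra_operator U p A ->
  (forall x, weakly_null U p q x -> weakly_null U p q (A x)) -> (forall x, M x -> M (A x)) ->
  \sum_j phi j (A (h j)) = 0.
Proof.
move=> wh h0 oA wA MA; have bN : N `<=` bounded_seq q by move=> psi /wN[].
have [|h' [h'_span h'N h'A]] :=
    trace_reduction subN bN (fun j => (wh j).1) (G := weakly_null U p q).
  move=> psi g Npsi wg; apply: trace_rank_one (wN Npsi) _ => //; first exact: wg.1.
  exact: compatible_N.
have wh' := h'_span _ (weakly_null_subspace (UF := UF) pq) wh.
have Mh' j : M (h' j).
  by split=> [|psi [cpsi|]]; [exact: (wh' j).1|exact: (wh' j).2|exact: h'N].
have h'0 : trace_zero h'.
  move=> T bT; have oT := ultraop_ultra_operator (UF := UF) pq bT.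
  by rewrite (h'A _ oT) ?(h0 _ bT) // => j; exact: ultraop_weakly_null.
have [||h'' [h''_span h''w h''A]] :=
    trace_reduction (weakly_null_subspace (conj_expC pq)) _ (fun j => (Mh' j).1) (G := M).
- by move=> psi [].
- move=> psi g wpsi Mg.
  have Ftr : ultra_functional U p (fun z => \sum_j ultrapair U (h' j) psi * phi j z).
    exact: ultra_functional_sum.
  apply: (ultra_functional_eq0_of_dense pq Ftr _ Mg.1 _ (M0_dense Mg)) => [y /M0_M[]//|y M0y].
  by apply: trace_rank_one wpsi (compatible_M0 wpsi M0y) => //; exact: (M0_M M0y).1.
rewrite -h'A // => [|j]; last exact: wA.
rewrite -h''A // => [|j]; last exact: MA.
apply: big1 => j _; apply: (ultra_functional_null (oA.2 _ (Fphi j))).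
by apply: (weakly_null_separated pq) (h''w j); exact: h''_span (weakly_null_subspace pq) wh' j.
Qed.

Lemma trace_invariant (x : 'I_k -> useq R) A : (forall j, bounded_seq p (x j)) ->
  trace_zero x -> ultra_operator U p A -> preserves_constants A ->
  (forall z, weakly_null U p q z -> weakly_null U p q (A z)) -> (forall z, M z -> M (A z)) ->
  \sum_j phi j (A (x j)) = 0.
Proof.
move=> bx x0 oA cA wA MA.
have [f Lf wxf] : exists2 f : 'I_k -> R -> R, forall j, inLp p (f j) &
    forall j, weakly_null U p q (x j - (fun=> f j)).
  have /choice[f fP] j : exists f : R -> R, inLp p f /\ weakly_null U p q (x j - (fun=> f)).
    by have [f Lf wf] := weak_limit (UF := UF) pq (bx j); exists f.
  by exists f => j; have [] := fP j.
pose h j := x j - (fun=> f j).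
have split_sum B : ultra_operator U p B -> \sum_j phi j (B (x j)) =
    \sum_j phi j (B (h j)) + \sum_j phi j (B (fun=> f j)).
  move=> oB; rewrite -big_split; apply: eq_bigr => j _.
  have lin := (oB.2 _ (Fphi j)).1; rewrite -{1}[x j](subrK (fun=> f j)).
  by rewrite [LHS](linear_onD lin) //; [exact: (wxf j).1|exact: bounded_seq_cst].
rewrite split_sum // (trace_constants x0) // addr0; apply: trace_weakly_null => // T bT.
have oT := ultraop_ultra_operator (UF := UF) pq bT.
have [LT _ _] := bT; have cT : preserves_constants (ultraop T).
  move=> g Lg; exists (T g); first exact: LT.
  by rewrite [X in null_seq U p X]subrr; case: null_p.
by have := x0 T bT; rewrite (split_sum _ oT) (trace_constants x0 Lf wxf oT cT) addr0.
Qed.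

End trace.

Lemma WOT_closure_of_invariant S : UOp p U S -> uinvariant S (Lconst p U) ->
  uinvariant S (Lhat p U) -> uinvariant S M -> WOT_closure_ultraops p U S.
Proof.
move=> oS cS wS MS k xs phis e e0; rewrite UP_bounded_seq => bxs Dphis.
have Fphi i : ultra_functional U p (phis i) by exact/(UDualP pq).
have oS' := UOp_ultra_operator (UF := UF) pq oS.
pose W := [set u : 'I_k -> R | exists2 T, bounded_operator p q T &
  forall i, u i = phis i (ultraop T (xs i))].
suff [T bT TE] : W (fun i => phis i (S (xs i))).
  by exists T; split=> [|i]; [exact/(LpOpP pq)|rewrite TE subrr normr0].
have subW : subspace W.
  split=> [|a u v [T1 bT1 uE] [T2 bT2 vE]].
    by exists (fun=> 0); [exact: zero_operator|move=> i; rewrite (linear_on0 bounded_p (Fphi i).1)].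
  exists (fun f => a *: T1 f + T2 f); first exact: bounded_operator_comb.
  move=> i; rewrite -[LHS]/(a * u i + v i) uE vE -(Fphi i).1 //.
    exact: (bounded_seq_operator bT1 (bxs i)).
  exact: (bounded_seq_operator bT2 (bxs i)).
apply: (subspace_bipolar subW) => a aW; have Zx i : bounded_seq p (a i *: xs i) by exact: subspaceZ.
have phiZ A i : ultra_operator U p A -> phis i (A (a i *: xs i)) = a i * phis i (A (xs i)).
  by move=> oA; rewrite [LHS](linear_onZ bounded_p (oA.2 _ (Fphi i)).1).
rewrite -(eq_bigr _ (fun i _ => phiZ S i oS')).
apply: (trace_invariant Fphi Zx) => // [T bT|f Lf|z].
- rewrite (eq_bigr _ (fun i _ => phiZ _ i (ultraop_ultra_operator (UF := UF) pq bT))).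
  by apply: aW; exists T.
- have [_ [g [Lg /(ueqP pq _ _) nSg]]] : Lconst p U (S (fun=> f)).
    apply: cS; rewrite (Lconst_annihilator pq); split=> [|psi wpsi]; first exact: bounded_seq_cst.
    by rewrite ultrapairC (ultrapair_const wpsi).
  rewrite Lp_inLp in Lg; exists g => //; apply: nSg; last exact: bounded_seq_cst.
  by apply: oS'.1; exact: bounded_seq_cst.
by rewrite -(Lhat_weakly_null pq); exact: wS.
Qed.

Lemma annihilator_determines_WOT_closure : determines_WOT_closure p U M.
Proof.
move=> S oS; split=> [wS|[cS [hS MS]]]; last exact: WOT_closure_of_invariant.
have bounded_wnull : weakly_null U q p `<=` bounded_seq q by move=> psi [].
split; last split.
- rewrite (Lconst_annihilator pq); apply: (WOT_closure_annihilator pq oS wS) => // T x bT.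
  apply: (ultraop_annihilator pq bT) => // T' psi bT'.
  exact: (ultraop_weakly_null (conj_expC pq) bT').
- rewrite (Lhat_weakly_null pq); apply: (WOT_closure_annihilator pq oS wS (@constants_bounded R q)).
  by move=> T x; exact: ultraop_weakly_null.
apply: (WOT_closure_annihilator pq oS wS) => // psi [|/wN/bounded_wnull//].
exact: constants_bounded.
Qed.

End density.

(** * Uniqueness *)

Definition ultra_rank_one {R : realType} (U : set_system nat) (psi y x : useq R) : useq R :=
  ultrapair U x psi *: y.

Section uniqueness.
Context {R : realType} (U : set_system nat) {UF : UltraFilter U}.
Variables p q : R.
Hypothesis pq : conj_exp p q.
Implicit Types (x y z psi : useq R) (M : set (useq R)).

Let bounded_p := bounded_seq_subspace (ltW (conj_exp_gt1 pq)).

Lemma usubspace_subspace M : usubspace p U M -> subspace M.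
Proof.
move=> [_ [_ [M0 [MD MZ]]]]; split=> // a x y Mx My.
by rewrite -uaddE -uscaleE; apply: MD => //; exact: MZ.
Qed.

Lemma ultra_rank_one_UOp psi y : bounded_seq q psi -> bounded_seq p y ->
  UOp p U (ultra_rank_one U psi y).
Proof.
move=> bpsi by_; have Fpsi := ultra_functional_ultrapair (UF := UF) pq bpsi.
have bS x : bounded_seq p (ultra_rank_one U psi y x) by exact: subspaceZ.
have refl x z : bounded_seq p x -> x = z -> ueq p U x z.
  move=> bx <-; apply/(ueqP pq bx bx); rewrite subrr.
  by case: (vanishing_subspace (U := U) _ (lexx p)).
rewrite /UOp UP_bounded_seq; split; last split; last split; last split.
- by move=> x _; exact: bS.
- move=> x z bx bz /(ueqP pq bx bz) nxz; apply: refl => //; congr (_ *: _).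
  exact: ultra_functional_congr Fpsi bx bz nxz.
- move=> x z bx bz; apply: refl => //.
  by rewrite /ultra_rank_one uaddE (linear_onD Fpsi.1) // scalerDl.
- move=> a x bx; apply: refl => //.
  by rewrite /ultra_rank_one !uscaleE (linear_onZ bounded_p Fpsi.1) // scalerA.
have [_ [C C0 psi_le]] := Fpsi; exists (C * ultranorm U p y) => x a b bx.
move=> /(unorm_ultranorm _ bx) <- /(unorm_ultranorm _ (bS x)) <-.
rewrite ultranormZ // mulrAC ler_wpM2r ?ultranorm_ge0 //; exact: psi_le.
Qed.

Lemma ultra_rank_one_Lconst psi y : weakly_null U q p psi -> bounded_seq p y ->
  uinvariant (ultra_rank_one U psi y) (Lconst p U).
Proof.
move=> wpsi by_ x; rewrite (Lconst_annihilator pq) => -[_ x0].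
rewrite /ultra_rank_one x0 // scale0r; split=> [|chi wchi]; first by case: bounded_p.
exact: (linear_on0 bounded_p (ultrapair_linear_l pq wchi.1)).
Qed.

Lemma ultra_rank_one_Lhat psi y : weakly_null U p q y ->
  uinvariant (ultra_rank_one U psi y) (Lhat p U).
Proof.
by rewrite (Lhat_weakly_null pq) => wy x _; apply: subspaceZ wy; exact: weakly_null_subspace.
Qed.

Lemma determines_transfer M M' psi y :
  determines_WOT_closure p U M -> determines_WOT_closure p U M' ->
  weakly_null U q p psi -> weakly_null U p q y ->
  uinvariant (ultra_rank_one U psi y) M -> uinvariant (ultra_rank_one U psi y) M'.
Proof.
move=> detM detM' wpsi wy MS; have oS := ultra_rank_one_UOp wpsi.1 wy.1.
suff /(detM' _ oS)[_ []//] : WOT_closure_ultraops p U (ultra_rank_one U psi y).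
apply/(detM _ oS); split; first exact: ultra_rank_one_Lconst wy.1.
by split=> //; exact: ultra_rank_one_Lhat.
Qed.

Lemma exists_nonorthogonal x : weakly_null U p q x -> ~ null_seq U p x ->
  exists2 psi, weakly_null U q p psi & ultrapair U x psi != 0.
Proof.
move=> wx nx; apply: contrapT => no_psi; apply: nx.
apply: (weakly_null_separated pq) => // psi wpsi.
by apply/eqP; apply: contrapT => /negP x_psi; apply: no_psi; exists psi.
Qed.

Lemma determines_subset M M' : subspace M -> subspace M' ->
  M `<=` weakly_null U p q -> M' `<=` weakly_null U p q ->
  determines_WOT_closure p U M -> determines_WOT_closure p U M' ->
  (exists2 x, M' x & ~ null_seq U p x) -> M `<=` M'.
Proof.
move=> subM subM' Mw M'w detM detM' [x M'x nx] z Mz.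
have [psi wpsi x_psi] := exists_nonorthogonal (M'w _ M'x) nx.
have M'Sx : M' (ultra_rank_one U psi z x).
  apply: (determines_transfer detM detM' wpsi (Mw _ Mz)) M'x => y _; exact: subspaceZ.
by rewrite -[z](scalerK x_psi); exact: subspaceZ.
Qed.

Lemma determines_unique M M' : subspace M -> subspace M' ->
  M `<=` weakly_null U p q -> M' `<=` weakly_null U p q ->
  determines_WOT_closure p U M -> determines_WOT_closure p U M' ->
  (exists2 x, M x & ~ null_seq U p x) -> (exists2 y, weakly_null U p q y & ~ M y) -> M' = M.
Proof.
move=> subM subM' Mw M'w detM detM' Mx [y wy nMy]; apply/seteqP.
split; apply: determines_subset => //; apply: contrapT => M'_null; apply: nMy.
have [x {}Mx nx] := Mx; have [psi wpsi x_psi] := exists_nonorthogonal (Mw _ Mx) nx.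
rewrite -[y](scalerK x_psi); apply: subspaceZ => //.
apply: (determines_transfer detM' detM wpsi wy) Mx => z M'z.
rewrite /ultra_rank_one (null_seq_ultrapair (UF := UF) pq _ wpsi.1) ?scale0r; first by case: subM'.
by apply: contrapT => nz; apply: M'_null; exists z.
Qed.

End uniqueness.

(** * Square-bounded weakly null sequences *)

Section square_bounded.
Context {R : realType} (U : set_system nat) {UF : UltraFilter U}.
Variables r s : R.
Hypothesis rs : conj_exp r s.
Implicit Types (x y z : useq R) (w : R -> R).

Let conj2 := @conj_exp2 R.

Lemma weakly_null_exp_le r' s' : r <= r' -> 0 <= s' -> s' <= s ->
  weakly_null U r' s' `<=` weakly_null U r s.
Proof.
move=> rr' s'0 s's x [bx x0]; split=> [|_ [y Ly <-]]; first exact: bounded_seq_exp_le bx.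
by apply: x0; exists y => //; exact: Lp_exp_le Ly.
Qed.

Lemma weakly_null2_lt2 : r < 2 -> weakly_null U 2 2 `<=` weakly_null U r s.
Proof. by move=> r2; apply: weakly_null_exp_le; rewrite ?ler0n // ltW // (conj_exp_gt2 rs). Qed.

Lemma weakly_null2_upper_estimate x : r < 2 -> weakly_null U 2 2 x -> upper_estimate U r 2 x.
Proof.
move=> r2 wx; apply: (upper_estimate_exp_le _ (ltW r2) wx.1) => //.
by have := weakly_null_upper_estimate (UF := UF) conj2 wx; rewrite minxx.
Qed.

Lemma normLp_sub_weak_limit_le x y w : weakly_null U r s x -> bounded_seq r y -> inLp r w ->
  weakly_null U r s (y - (fun=> w)) -> normLp r w <= ultranorm U r (x - y).
Proof.
move=> wx by_ Lw ywx; have sub := bounded_seq_subspace (ltW (conj_exp_gt1 rs)).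
have byx : bounded_seq r (y - x) by apply: subspaceB => //; exact: wx.1.
have -> : ultranorm U r (x - y) = ultranorm U r (y - x).
  by rewrite /ultranorm; congr (lim (_ @ U)); apply/funext => n; exact: normLp_distC.
apply: (normLp_weak_limit_le rs byx Lw) => f Lf.
have lin := ultrapair_linear_l (UF := UF) rs (bounded_seq_cst Lf).
rewrite (linear_onB lin) // ?(ultrapair_const wx Lf) ?subr0; last exact: wx.1.
rewrite -(ultrapair_cst (U := U)); apply/esym/eqP; rewrite -subr_eq0 -(linear_onB lin) //.
  by rewrite (ultrapair_const ywx Lf).
exact: bounded_seq_cst.
Qed.

(* Truncating at a large height and subtracting the weak limit in L^2 changes little. *)
Lemma weakly_null2_dense x : nonprincipal U -> r < 2 ->
  weakly_null U r s x -> equiintegrable U r s x ->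
  forall d : R, 0 < d -> exists2 g, weakly_null U 2 2 g & ultranorm U r (x - g) <= d.
Proof.
move=> Unp r2 wx ex d d0; have bx := wx.1; have r1 := ltW (conj_exp_gt1 rs).
have sub := bounded_seq_subspace r1.
have subE := annihilator_subspace (UF := UF) rs (@concentrating_bounded R U s).
have [K /= [cxb eb b_approx]] := concentrating_splitting rs Unp bx.
set b := fun n => _ in cxb eb b_approx.
have nxb : null_seq U r (x - b).
  by apply: (concentrating_equiintegrable_null rs); split=> //; exact: (subspaceB subE).
have [k bk] := b_approx _ (divr_gt0 d0 (ltr0n R 2)).
pose y n := trunc k%:R (x n); have by_ : bounded_seq r y by exact: (bounded_seq_trunc (fun=> k%:R)).
have my n : measurable01 (y n) by apply: measurable01_trunc; exact: Lp_measurable (bx.1 n).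
have yk n t : `|y n t| <= k%:R by exact: normr_trunc_le.
have [w Lw wyw] := weak_limit (UF := UF) conj2 (bounded_seq_of_bound (ltr0n R 2) my yk).
have Lwr : inLp r w by apply: Lp_exp_le Lw => //; exact: ltW.
exists (y - (fun=> w)) => //; have bxy := subspaceB sub bx by_.
have xy : ultranorm U r (x - y) <= d / 2.
  have -> : x - y = (x - b) + (b - y) by rewrite addrA subrK.
  have bby := subspaceB sub eb.1 by_.
  by rewrite (le_trans (ultranormD r1 nxb.1 bby)) // (null_seqP nxb.1).1 // add0r.
have -> : x - (y - (fun=> w)) = (x - y) + (fun=> w) by rewrite opprB addrCA addrC.
rewrite (le_trans (ultranormD r1 bxy (bounded_seq_cst Lwr))) // ultranorm_cst (splitr d) lerD //.
exact: le_trans (normLp_sub_weak_limit_le wx by_ Lwr (weakly_null2_lt2 r2 wyw)) xy.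
Qed.

Lemma concentrating_annihilator : 2 < r ->
  concentrating U r = annihilator U r (constants s `|` weakly_null U 2 2).
Proof.
move=> r2; have s2 := conj_exp_lt2 rs r2; rewrite annihilatorU; have sr := conj_expC rs.
apply/seteqP; split=> x => [cx|[wx [bx x0]]].
  split; first exact: (concentrating_weakly_null rs).
  split=> [|psi [bpsi _]]; first exact: cx.1.
  by rewrite ultrapairC; apply: (bounded_seq_equiintegrable sr s2 bpsi).2.
pose sg n t := Num.sg (x n t).
have msg n : measurable01 (sg n) by apply: measurable01_sg; exact: Lp_measurable (bx.1 n).
have sg1 n t : `|sg n t| <= 1 by rewrite normr_sg; case: (_ != 0); rewrite ?ler01.
have [w Lw wsg] := weak_limit (UF := UF) conj2 (bounded_seq_of_bound (ltr0n R 2) msg sg1).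
have Lws : inLp s w by apply: Lp_exp_le Lw => //; exact: ltW.
have bsg : bounded_seq s sg by exact: bounded_seq_of_bound msg sg1.
have := x0 _ wsg; rewrite (linear_onB (ultrapair_linear_r rs bx)) //; last exact: bounded_seq_cst.
rewrite (ultrapair_const wx Lws) subr0 => x_sg; split=> //; rewrite -[X in _ --> X]x_sg.
rewrite (_ : (fun n => _) = (fun n => pairing (x n) (sg n))); first exact: (ultrapair_cvg rs).
by apply/funext => n; rewrite normLp1E; congr int01; apply/funext => t; rewrite normrEsg mulrC.
Qed.

End square_bounded.

(** * Concentrating and oscillating sequences *)

Section spikes.
Context {R : realType}.

Lemma normLp_indic_itv (r a : R) : 0 < r -> 0 <= a <= 1 ->
  normLp r (\1_(`[0, a]%classic) : R -> R) = a `^ r^-1.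
Proof.
move=> r0 /andP[a0 a1]; rewrite normLpE (_ : (fun t => _) = \1_(`[0, a]%classic)); last first.
  apply/funext => t; rewrite indicE; case: (_ \in _); rewrite ?normr1 ?normr0 ?powR1 //.
  by rewrite powR0 ?gt_eqF.
congr (_ `^ _); rewrite int01.unlock /Rintegral integral_indic // (_ : _ `&` _ = `[0, a]%classic).
  rewrite (congr1 fine (@lebesgue_measure_itv R `[0%R, a])) /= lte_fin.
  case: ltP => [_|a0']; first by rewrite oppr0 adde0.
  by apply/le_anti; rewrite a0 a0'.
apply/setIidPl => t /=; rewrite /I01 /= !in_itv /= => /andP[-> ta].
exact: le_trans a1.
Qed.

Lemma nonprincipal_cvg_oo (U : set_system nat) {UF : UltraFilter U} :
  nonprincipal U -> U --> \oo.
Proof. by move=> Unp A [N _ NA]; apply: filterS (nonprincipal_near_ge Unp N). Qed.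

Lemma exists_concentrating (U : set_system nat) {UF : UltraFilter U} (r s : R) :
  nonprincipal U -> conj_exp r s -> exists2 x, concentrating U r x & ~ null_seq U r x.
Proof.
move=> Unp rs.
pose a n : R := n.+1%:R^-1; have a0 n : 0 < a n by rewrite invr_gt0 ltr0Sn.
have a01 n : 0 <= a n <= 1 by rewrite ltW //= invf_le1 ?ltr0Sn // ler1n.
pose i n : R -> R := \1_(`[0, a n]%classic); pose x n := ((a n)^-1 `^ r^-1) *: i n.
have Li t n : 0 < t -> inLp t (i n).
  move=> t0; apply: (@Lp_bounded _ _ _ 1) => [||v]; first exact: ltW.
    by apply: measurable_indic; exact: measurable_itv.
  by rewrite /i indicE; case: (_ \in _); rewrite ?normr1 ?normr0.
have ri t n : 0 < t -> normLp t (i n) = a n `^ t^-1 by move=> t0; exact: normLp_indic_itv.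
have xE t n : 0 < t -> normLp t (x n) = (a n)^-1 `^ r^-1 * a n `^ t^-1.
  by move=> t0; rewrite normLpZ ?ri ?ger0_norm ?powR_ge0 //; exact: Li.
have xr n : normLp r (x n) = 1.
  by rewrite xE // -powRM ?invr_ge0 ?(ltW (a0 n)) // mulVf ?gt_eqF // powR1.
exists x; last first.
  move=> nx; have : ultranorm U r x = 1.
    by apply: ultranormE; under eq_fun do rewrite xr; exact: cvg_cst.
  by rewrite (null_seqP nx.1).1 // => /eqP; rewrite eq_sym oner_eq0.
split; first by split=> [n|]; [apply: LpZ; [exact: ltW|exact: Li]|exists 1 => n; rewrite xr].
rewrite (_ : (fun n => _) = fun n => a n `^ s^-1).
  apply: cvg0_powR; [by rewrite invr_gt0|by move=> n; exact: ltW|].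
  by apply: cvg_trans (@cvg_harmonic R); apply: cvg_app; exact: nonprincipal_cvg_oo.
apply/funext => n; rewrite xE // invr1 powRr1 ?ltW // -[X in _ * X](powR_conj_exp rs) ?ltW //.
by rewrite mulrA -powRM ?invr_ge0 ?(ltW (a0 n)) // mulVf ?gt_eqF // powR1 mul1r.
Qed.

End spikes.

Section oscillation.
Context {R : realType}.
Implicit Types (m n : nat) (k t : R).

Definition cosine n t : R := cos (n.+1%:R * pi * t).

Lemma sin_natpi n : sin (n%:R * pi) = 0 :> R.
Proof. by elim: n => [|n IH]; rewrite ?mul0r ?sin0 // -natr1 mulrDl mul1r sinDpi IH oppr0. Qed.

Lemma continuous_cosine n : continuous (cosine n).
Proof.
move=> t; apply: continuous_comp; last exact: continuous_cos.
by apply: cvgM; [exact: cvg_cst|exact: cvg_id].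
Qed.

Lemma measurable01_cosine n : measurable01 (cosine n).
Proof.
apply: (@measurable_funS _ _ _ _ setT) => //.
by apply: continuous_measurable_fun; exact: continuous_cosine.
Qed.

Lemma normr_cosine_le1 n t : `|cosine n t| <= 1.
Proof. by rewrite ler_norml cos_geN1 cos_le1. Qed.

Lemma Lp_cosine (r : R) n : 0 <= r -> inLp r (cosine n).
Proof. by move=> r0; exact: Lp_bounded r0 (measurable01_cosine n) (normr_cosine_le1 n). Qed.

Lemma int01_cosine n : int01 (cosine n) = 0.
Proof.
set k : R := n.+1%:R * pi; have k0 : k != 0 by rewrite mulf_neq0 ?pnatr_eq0 // gt_eqF // pi_gt0.
pose F t := k^-1 * sin (k * t); have dF t : is_derive t 1 F (cosine n t).
  have dk : is_derive t 1 (fun u : R => k * u) k.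
    by apply: is_derive_eq (is_deriveZ k (is_derive_id t 1)) _; rewrite scaler1.
  have := is_deriveZ k^-1 (is_derive1_comp (is_derive_sin (k * t)) dk).
  by move=> d; apply: is_derive_eq d _; rewrite /cosine -/k /GRing.scale /=; field.
have cF : continuous F.
  by move=> t; apply: differentiable_continuous; apply/derivable1_diffP; have [] := dF t.
rewrite int01.unlock /Rintegral /I01 (@continuous_FTC2 _ _ F) //.
- by rewrite -EFinB /F mulr1 mulr0 sin0 /k sin_natpi !mulr0 subrr.
- by apply: continuous_subspaceT; exact: continuous_cosine.
- split; [by move=> t _; have [] := dF t|exact/cvg_at_right_filter/cF|exact/cvg_at_left_filter/cF].
by move=> t _; rewrite derive1E derive_val.
Qed.

Lemma cosine_mul m n t :
  cosine m t * cosine n t = 2^-1 * cosine (m + n).+1 t + 2^-1 * cos ((n%:R - m%:R) * pi * t).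
Proof.
rewrite -mulrDr /cosine; set a := m.+1%:R * pi * t; set b := n.+1%:R * pi * t.
have -> : (m + n).+2%:R * pi * t = b + a.
  by rewrite /a /b -addnS -addSn natrD; ring.
have -> : (n%:R - m%:R) * pi * t = b - a by rewrite /a /b -!natr1; ring.
by rewrite cosD cosB; field.
Qed.

Lemma pairing_cosine_eq0 m n : m != n -> pairing (cosine m) (cosine n) = 0.
Proof.
wlog mn : m n / (m < n)%N => [wlog_mn|_].
  by case: (ltngtP m n) => // mn _; [|rewrite pairingC]; apply: wlog_mn => //; rewrite ltn_eqF.
rewrite /pairing (_ : (fun t => _) = 2^-1 *: cosine (m + n).+1 + 2^-1 *: cosine (n - m).-1).
  have L1 l : inLp 1 (cosine l) by exact: Lp_cosine.
  have Z l : inLp 1 (2^-1 *: cosine l) by apply: subspaceZ => //; exact: Lp1_subspace.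
  rewrite int01_linear // (linear_onZ (@Lp1_subspace R) (@int01_linear R)) //.
  by rewrite !int01_cosine !mulr0 addr0.
by apply/funext => t; rewrite cosine_mul -natrB ?(ltnW mn) // /cosine prednK ?subn_gt0.
Qed.

Lemma pairing_cosine_diag n : pairing (cosine n) (cosine n) = 2^-1.
Proof.
rewrite /pairing (_ : (fun t => _) = 2^-1 *: cosine (n + n).+1 + (fun=> 2^-1)).
  rewrite int01_linear ?int01_cosine ?int01_cst ?mulr0 ?add0r //; first exact: Lp_cosine.
  exact: Lp_cst.
by apply/funext => t; rewrite cosine_mul subrr !mul0r cos0 mulr1.
Qed.

(* The weak limit [w] of the cosines is orthogonal to all of them, so that
   [1/2 = <cosine n, cosine n - w>] bounds the L^1 norm of [cosine n - w] from below. *)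
Lemma exists_oscillating (U : set_system nat) {UF : UltraFilter U} (r s : R) :
  nonprincipal U -> conj_exp r s ->
  exists2 x : useq R, weakly_null U r s x & ~ normLp 1 (x n) @[n --> U] --> 0.
Proof.
move=> Unp rs; have [r0 r1] : 0 < r /\ 1 <= r by [].
have bc := bounded_seq_of_bound r0 measurable01_cosine normr_cosine_le1.
have [w Lw wcw] := weak_limit (UF := UF) rs bc; exists (cosine - (fun=> w)) => // c1.
have Lcs n : inLp s (cosine n) by exact: Lp_cosine.
have cw m : pairing (cosine m) w = 0.
  have lin := ultrapair_linear_l (UF := UF) rs (bounded_seq_cst (Lcs m)).
  have := ultrapair_const wcw (Lcs m); rewrite (linear_onB lin) //; last exact: bounded_seq_cst.
  rewrite ultrapair_cst pairingC (_ : ultrapair _ _ _ = 0) ?sub0r => [/eqP|].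
    by rewrite oppr_eq0 => /eqP.
  apply: ultrapairE; apply: cvg_near_cst; apply: filterS (nonprincipal_near_ge Unp m.+1) => n mn.
  by rewrite pairing_cosine_eq0 // gtn_eqF.
have e0 : 0 < 4^-1 :> R by rewrite invr_gt0.
have /cvgr0Pnorm_le/(_ _ e0)/filter_ex[n] := c1; rewrite ger0_norm //.
have L1d : inLp 1 (cosine n - w) by apply: (Lp_Lp1 r1); apply: LpB => //; exact: Lp_cosine.
have [_] := normr_int01_mul_bounded L1d (measurable01_cosine n) (normr_cosine_le1 n).
rewrite -/(pairing (cosine n - w) (cosine n)) pairingC.
rewrite (linear_onB (pairing_linear_r (conj_expC rs) (Lcs n))) //; last exact: Lp_cosine.
rewrite cw subr0 pairing_cosine_diag mul1r ger0_norm ?invr_ge0 // => /le_trans h /h; lra.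
Qed.

End oscillation.

(** * The two ranges of exponents *)

Definition determining_annihilator {R : realType} (p q : R) (U : set_system nat)
    (N : set (useq R)) : Prop :=
  let M := annihilator U p (constants q `|` N) in
  [/\ N `<=` bounded_seq q, determines_WOT_closure p U M, complemented_in p U (Lhat p U) M,
      exists2 x, M x & ~ null_seq U p x & exists2 y, weakly_null U p q y & ~ M y].

Section exponents.
Context {R : realType} (U : set_system nat) {UF : UltraFilter U}.
Hypotheses (Unp : nonprincipal U) (Usel : selective U).
Variables p q : R.
Hypothesis pq : conj_exp p q.
Implicit Types (x y psi g : useq R).

Let qp := conj_expC pq.

Lemma equiintegrable_subspace : subspace (equiintegrable U p q).
Proof. by apply: (annihilator_subspace pq); exact: concentrating_bounded. Qed.

Lemma null_seq_equiintegrable : null_seq U p `<=` equiintegrable U p q.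
Proof. by apply: (null_seq_annihilator pq); exact: concentrating_bounded. Qed.

Lemma concentrating_determines : 2 < p ->
  determines_WOT_closure p U (annihilator U p (constants q `|` weakly_null U 2 2)).
Proof.
move=> p2; have q2 := conj_exp_lt2 pq p2; have ME := concentrating_annihilator (UF := UF) pq p2.
apply: (annihilator_determines_WOT_closure Unp Usel pq (M0 := concentrating U p)); rewrite -?ME //.
- exact: (weakly_null_subspace (@conj_exp2 R)).
- exact: (weakly_null2_lt2 qp q2).
- move=> psi g wpsi wg; exists 2, 2.
  split; [exact: conj_exp2| |exact: (weakly_null2_upper_estimate qp)].
  by have := weakly_null_upper_estimate (UF := UF) pq wg; rewrite min_r // ltW.
- move=> x cx d d0; exists x => //.
  by rewrite subrr (ultranorm_cst p (0 : R -> R)) normLp0 // ltW.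
- move=> psi g wpsi cg; exists p, q; split=> //; first exact: (concentrating_upper_estimate pq).
  by have := weakly_null_upper_estimate (UF := UF) qp wpsi; rewrite min_l // ltW.
by move=> T x bT; exact: (concentrating_operator pq).
Qed.

Lemma concentrating_complemented : complemented_in p U (Lhat p U) (concentrating U p).
Proof.
apply: (complemented_of_splitting pq (C := equiintegrable U p q)).
- exact: (concentrating_subspace pq).
- exact: equiintegrable_subspace.
- exact: (concentrating_weakly_null pq).
- exact: null_seq_equiintegrable.
- exact: (concentrating_equiintegrable_null pq).
move=> x wx; have [K /= [cxb eb _]] := concentrating_splitting pq Unp wx.1.
exists (x - (fun n => trunc (K n)%:R (x n))); split=> //; first by rewrite subKr.
apply: (ler_cvg_to (ultranorm_cvg cxb.1) (ultranorm_cvg wx.1)); apply: nearW => n.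
by apply: normLp_sub_trunc_le => //; exact: wx.1.1.
Qed.

Lemma determining_annihilator_gt2 : 2 < p ->
  determining_annihilator p q U (weakly_null U 2 2).
Proof.
move=> p2; have ME := concentrating_annihilator (UF := UF) pq p2.
split; [|exact: concentrating_determines| | |]; rewrite -?ME.
- by move=> psi wpsi; have [] := weakly_null2_lt2 qp (conj_exp_lt2 pq p2) wpsi.
- exact: concentrating_complemented.
- exact: exists_concentrating pq.
have [x wx nx] := exists_oscillating Unp pq; exists x => // cx.
by apply: nx; exact: cx.2.
Qed.

Lemma equiintegrable_determines : p < 2 ->
  determines_WOT_closure p U (annihilator U p (constants q `|` concentrating U q)).
Proof.
move=> p2; have q2 := conj_exp_gt2 pq p2.
apply: (annihilator_determines_WOT_closure Unp Usel pq (M0 := weakly_null U 2 2)).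
- exact: (concentrating_subspace qp).
- exact: (concentrating_weakly_null qp).
- move=> psi g cpsi wg; exists p, q; split=> //; last exact: (concentrating_upper_estimate qp).
  by have := weakly_null_upper_estimate (UF := UF) pq wg; rewrite min_l // ltW.
- rewrite annihilatorU => x wx; split; first exact: (weakly_null2_lt2 pq p2).
  exact: (bounded_seq_equiintegrable pq p2 wx.1).
- by rewrite annihilatorU => x [wx ex]; exact: (weakly_null2_dense pq Unp p2 wx ex).
- move=> psi g wpsi wg; exists 2, 2.
  split; [exact: conj_exp2|exact: (weakly_null2_upper_estimate pq)|].
  by have := weakly_null_upper_estimate (UF := UF) qp wpsi; rewrite min_r // ltW.
move=> T x bT; rewrite annihilatorU => -[wx ex]; split; first exact: (ultraop_weakly_null pq).
apply: (ultraop_annihilator pq bT _ _ ex) => [|T' psi bT']; first exact: concentrating_bounded.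
exact: (concentrating_operator qp).
Qed.

Lemma equiintegrable_complemented :
  complemented_in p U (Lhat p U) (weakly_null U p q `&` equiintegrable U p q).
Proof.
apply: (complemented_of_splitting pq (C := concentrating U p)).
- by apply: subspaceI; [exact: weakly_null_subspace|exact: equiintegrable_subspace].
- exact: (concentrating_subspace pq).
- by move=> x [].
- exact: (null_seq_concentrating pq).
- by move=> x [[_ ex] cx]; exact: (concentrating_equiintegrable_null pq).
move=> x wx; have [K /= [cxb eb _]] := concentrating_splitting pq Unp wx.1.
set b := fun n => _ in cxb eb; exists b; split=> //.
  split=> //; rewrite -[b](subKr x); apply: subspaceB => //; first exact: weakly_null_subspace.
  exact: (concentrating_weakly_null pq).
apply: (ler_cvg_to (ultranorm_cvg eb.1) (ultranorm_cvg wx.1)); apply: nearW => n.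
by apply: normLp_trunc_le => //; exact: wx.1.1.
Qed.

Lemma determining_annihilator_lt2 : p < 2 -> determining_annihilator p q U (concentrating U q).
Proof.
move=> p2; split; [exact: concentrating_bounded|exact: equiintegrable_determines| | |];
  rewrite annihilatorU.
- exact: equiintegrable_complemented.
- have [x wx nx] := exists_oscillating Unp (@conj_exp2 R); exists x.
    by split; [exact: (weakly_null2_lt2 pq p2)|exact: (bounded_seq_equiintegrable pq p2 wx.1)].
  by move=> /(null_seq_concentrating pq)[].
have [x cx nx] := exists_concentrating Unp pq.
exists x; first exact: (concentrating_weakly_null pq).
by move=> [_ ex]; apply: nx; exact: (concentrating_equiintegrable_null pq).
Qed.

End exponents.

Theorem theorem1p1 (R : realType) (p : R) (U : set (set nat)) :
  1 < p -> p != 2 ->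
  ultrafilter_nat U -> nonprincipal U -> selective U ->
  exists M : set (useq R),
    (M `<=` Lhat p U /\ usubspace p U M /\ uclosed p U M /\
     complemented_in p U (Lhat p U) M /\
     forall S, UOp p U S ->
       (WOT_closure_ultraops p U S <->
        uinvariant S (Lconst p U) /\ uinvariant S (Lhat p U) /\ uinvariant S M)) /\
    forall M' : set (useq R),
      (M' `<=` Lhat p U /\ usubspace p U M' /\ uclosed p U M' /\
       complemented_in p U (Lhat p U) M' /\
       forall S, UOp p U S ->
         (WOT_closure_ultraops p U S <->
          uinvariant S (Lconst p U) /\ uinvariant S (Lhat p U) /\ uinvariant S M')) ->
      M' = M.
Proof.
move=> p1 p2 UF Unp Usel; have pq := conj_exp_div p1; set q := p / (p - 1) in pq.
have [N [bN detN compN nzN prN]] : exists N, determining_annihilator p q U N.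
  move: p2; rewrite neq_lt => /orP[p2|p2].
    by exists (concentrating U q); exact: determining_annihilator_lt2.
  by exists (weakly_null U 2 2); exact: determining_annihilator_gt2.
have bcN : constants q `|` N `<=` bounded_seq q.
  by rewrite subUset; split=> //; exact: constants_bounded.
have Mw : annihilator U p (constants q `|` N) `<=` Lhat p U.
  by rewrite (Lhat_weakly_null pq) annihilatorU => x [].
exists (annihilator U p (constants q `|` N)); split=> [|M' [M'w [sM' [_ [_ detM']]]]].
  split; first exact: Mw.
  split; first exact: (annihilator_usubspace pq).
  by split; first exact: (annihilator_uclosed pq).
rewrite (Lhat_weakly_null pq) in Mw M'w; have subM' := usubspace_subspace sM'.
apply: (determines_unique pq _ subM' Mw M'w detN detM' nzN prN).
exact: (annihilator_subspace pq).
Qed.
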